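(* Let $d\ge2$. (1) Let $y\in\ell^\infty(\mathbb Z^d)$ with $\rho(y)\in X_{\mathscr I_d^3}$. Then there is a unique $c(y)\in[0,1)$ such that $f^{(d)}\cdot y+\tilde c(y)\in\ell^\infty(\mathbb Z^d,\mathbb Z)$, where $\tilde c(y)$ is the constant sequence with value $c(y)$; and for every constant integer sequence $\tilde m$, $$v=f^{(d)}\cdot y+\tilde c(y)+\tilde m\in K_d.$$ (2) Let $\Gamma\subset\mathbb Z^d$ be a subgroup of finite index. An element $v\in\ell^\infty(\mathbb Z^d,\mathbb Z)$ which is $\Gamma$-invariant (i.e. $v_{\mathbf n+\boldsymbol\gamma}=v_{\mathbf n}$ for all $\boldsymbol\gamma\in\Gamma$, $\mathbf n\in\mathbb Z^d$) lies in $K_d$ if and only if it is of the form in (1) with $y\in\ell^\infty(\mathbb Z^d)$ $\Gamma$-invariant, $\rho(y)\in X_{\mathscr I_d^3}$, and $\tilde m$ a constant integer sequence.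
   Context: $R_d=\mathbb Z[u_1^{\pm1},\dots,u_d^{\pm1}]$; sequences identified with formal series; $(a\cdot b)_{\mathbf n}=\sum_{\mathbf k}a_{\mathbf k}b_{\mathbf n-\mathbf k}$ when defined; $w^*_{\mathbf n}=w_{-\mathbf n}$. $f^{(d)}=2d-\sum_i(u_i+u_i^{-1})$. $w^{(2)}_{\mathbf n}=\int_{\mathbb T^2}(e^{-2\pi i\langle\mathbf n,\mathbf t\rangle}-1)/F^{(2)}(\mathbf t)\,d\mathbf t$; for $d\ge3$, $w^{(d)}_{\mathbf n}=\int_{\mathbb T^d}e^{-2\pi i\langle\mathbf n,\mathbf t\rangle}/F^{(d)}(\mathbf t)\,d\mathbf t$, $F^{(d)}(\mathbf t)=2d-2\sum_j\cos(2\pi t_j)$. $I_d=\{g\in R_d:g\cdot w^{(d)}\in\ell^1(\mathbb Z^d)\}$; $\mathscr I_d=\{h\in R_d:h(1,\dots,1)=0\}$. $\rho$ = reduction mod 1 into $\mathbb T^{\mathbb Z^d}$; $(\alpha^{\mathbf m}x)_{\mathbf n}=x_{\mathbf m+\mathbf n}$, $h(\alpha)=\sum h_{\mathbf m}\alpha^{\mathbf m}$; for an ideal $J\subset R_d$, $X_J=\{x\in\mathbb T^{\mathbb Z^d}:g(\alpha)(x)=0\ \forall g\in J\}$. For $g\in I_d$ and $v\in\ell^\infty(\mathbb Z^d,\mathbb Z)$, $\xi_g(v)=\rho((g^*\cdot w^{(d)})\cdot v)$, and $K_d=\bigcap_{g\in I_d}\ker\xi_g$. *)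

(* Defs.v *)
From Stdlib Require Import Reals List ZArith ClassicalEpsilon ClassicalDescription.
From Stdlib Require Fin.
Import ListNotations.
Open Scope R_scope.

Definition Zd (d : nat) := Fin.t d -> Z.
Definition Rd (d : nat) := Fin.t d -> R.

Definition zadd {d} (u v : Zd d) : Zd d := fun i => (u i + v i)%Z.
Definition zopp {d} (u : Zd d) : Zd d := fun i => (- u i)%Z.
Definition zsub {d} (u v : Zd d) : Zd d := fun i => (u i - v i)%Z.
Definition zzero {d} : Zd d := fun _ => 0%Z.
Definition zunit {d} (i : Fin.t d) : Zd d :=
  fun j => if Fin.eq_dec i j then 1%Z else 0%Z.

Definition vcons {A : Type} {d} (k : A) (v : Fin.t d -> A) : Fin.t (S d) -> A :=
  fun i => Fin.caseS' i (fun _ => A) k v.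
Definition vnil {A : Type} : Fin.t 0 -> A := fun i => Fin.case0 (fun _ => A) i.

Fixpoint fsum (d : nat) : (Fin.t d -> R) -> R :=
  match d with
  | O => fun _ => 0
  | S d' => fun f => f Fin.F1 + fsum d' (fun i => f (Fin.FS i))
  end.
Fixpoint fins (d : nat) : list (Fin.t d) :=
  match d with
  | O => []
  | S d' => Fin.F1 :: map Fin.FS (fins d')
  end.

(** ** Laurent polynomials R_d = Z[u_1^{±1},...,u_d^{±1}] as finite lists of
    monomials (coefficient, exponent); two lists represent the same element iff
    they have the same coefficient function [lcoef]. *)
Definition lpoly (d : nat) := list (Z * Zd d).

Definition lcoef {d} (p : lpoly d) (n : Zd d) : Z :=
  fold_right (fun ce acc => if excluded_middle_informative (snd ce = n)
                            then (fst ce + acc)%Z else acc) 0%Z p.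

Definition pmul {d} (p q : lpoly d) : lpoly d :=
  flat_map (fun ce => map (fun ce' => ((fst ce * fst ce')%Z, zadd (snd ce) (snd ce'))) q) p.

Definition pstar {d} (p : lpoly d) : lpoly d := map (fun ce => (fst ce, zopp (snd ce))) p.

Definition peval1 {d} (p : lpoly d) : Z := fold_right (fun ce acc => (fst ce + acc)%Z) 0%Z p.

Definition fpoly (d : nat) : lpoly d :=
  (Z.of_nat (2 * d), zzero) ::
  flat_map (fun i => [(-1, zunit i); (-1, zopp (zunit i))]%Z) (fins d).

Definition rseq (d : nat) := Zd d -> R.

Definition pconv {d} (p : lpoly d) (a : rseq d) : rseq d :=
  fun n => fold_right (fun ce acc => IZR (fst ce) * a (zsub n (snd ce)) + acc) 0 p.

Definition palpha {d} (p : lpoly d) (x : rseq d) : rseq d :=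
  fun n => fold_right (fun ce acc => IZR (fst ce) * x (zadd (snd ce) n) + acc) 0 p.

Definition zrange (N : nat) : list Z :=
  map (fun k => (Z.of_nat k - Z.of_nat N)%Z) (seq 0 (2 * N + 1)).
Fixpoint box (d N : nat) : list (Zd d) :=
  match d with
  | O => [vnil]
  | S d' => flat_map (fun k => map (vcons k) (box d' N)) (zrange N)
  end.
Definition boxsum {d} (a : rseq d) (N : nat) : R :=
  fold_right (fun k acc => a k + acc) 0 (box d N).

Definition l1 {d} (a : rseq d) : Prop :=
  exists B, forall N, boxsum (fun k => Rabs (a k)) N <= B.
Definition series_to {d} (a : rseq d) (s : R) : Prop :=
  Un_cv (fun N => boxsum a N) s.

Definition linf {d} (a : rseq d) : Prop := exists B, forall n, Rabs (a n) <= B.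
Definition is_int (x : R) : Prop := exists z : Z, x = IZR z.
Definition linfZ {d} (a : rseq d) : Prop := linf a /\ forall n, is_int (a n).

Fixpoint IInt (d : nat) : (Rd d -> R) -> R -> Prop :=
  match d with
  | O => fun f l => l = f vnil
  | S d' => fun f l =>
      exists g : R -> R,
        (forall t, 0 <= t <= 1 -> IInt d' (fun s => f (vcons t s)) (g t)) /\
        exists pr : Riemann_integrable g 0 1, RiemannInt pr = l
  end.

Definition Fd (d : nat) (t : Rd d) : R := 2 * INR d - 2 * fsum d (fun j => cos (2 * PI * t j)).
Definition ip {d} (n : Zd d) (t : Rd d) : R := fsum d (fun j => IZR (n j) * t j).

(** real part of the numerator e^{-2 pi i <n,t>} (- 1 when d = 2) *)
Definition numer (d : nat) (n : Zd d) (t : Rd d) : R :=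
  if Nat.eqb d 2 then cos (2 * PI * ip n t) - 1 else cos (2 * PI * ip n t).

Definition tinv (M x : R) : R := if Rle_dec x (/ M) then M else / x.

Definition green_rel (d : nat) (n : Zd d) (w : R) : Prop :=
  exists I : nat -> R,
    (forall M, IInt d (fun t => numer d n t * tinv (INR (S M)) (Fd d t)) (I M)) /\
    Un_cv I w.

Definition green (d : nat) : rseq d :=
  fun n => epsilon (inhabits 0) (green_rel d n).

Definition inI (d : nat) (g : lpoly d) : Prop := l1 (pconv g (green d)).

Definition Iscr (d : nat) (h : lpoly d) : Prop := peval1 h = 0%Z.
Definition Iscr3 (d : nat) (g : lpoly d) : Prop :=
  exists l : list (lpoly d * lpoly d * lpoly d),
    Forall (fun abc => Iscr d (fst (fst abc)) /\ Iscr d (snd (fst abc)) /\ Iscr d (snd abc)) l /\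
    lcoef g = lcoef (flat_map (fun abc => pmul (fst (fst abc)) (pmul (snd (fst abc)) (snd abc))) l).

(** rho(y) \in X_J : g(alpha)(rho y) = 0 in T^{Z^d} for all g in J *)
Definition inX (d : nat) (J : lpoly d -> Prop) (y : rseq d) : Prop :=
  forall g, J g -> forall n, is_int (palpha g y n).

(** K_d = intersection of ker xi_g, g in I_d, inside l^infty(Z^d,Z) *)
Definition inK (d : nat) (v : rseq d) : Prop :=
  linfZ v /\
  forall g, inI d g -> forall n, exists s,
    series_to (fun k => pconv (pstar g) (green d) k * v (zsub n k)) s /\ is_int s.

Definition subgroup_fi (d : nat) (G : Zd d -> Prop) : Prop :=
  G zzero /\ (forall a b, G a -> G b -> G (zadd a b)) /\ (forall a, G a -> G (zopp a)) /\
  exists L : list (Zd d), forall n, exists r g, In r L /\ G g /\ n = zadd r g.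

Definition invariant {d} (G : Zd d -> Prop) (v : rseq d) : Prop :=
  forall g n, G g -> v (zadd n g) = v n.

(* Main.v *)
Require Import Defs.
From Stdlib Require Import Reals ZArith.
From Stdlib Require Import List Lra Lia Permutation.
From Stdlib Require Import FunctionalExtensionality ClassicalEpsilon ClassicalDescription Classical.
From Stdlib Require Fin.
From Coquelicot Require Import Coquelicot.
Import ListNotations.
Open Scope R_scope.

(** The symbol of [f] vanishes only at the origin, where it is [(2 pi)^2 |t|^2] up to higher order,
    and the truncated integrals defining [w] converge, so [f.w = delta].

    If [g] is in [I_d], then [a = g^*.w] is summable and [f.a = g^*], so the Fourier transform of
    [g] is [F] times a continuous function with value [s = sum a] at the origin.  Hence the moments of
    [g] of order at most [1] vanish and its second moments are those of [s.f]; in particular [s] is an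
    integer.  If the third differences of [y] are integers, the quadratic Taylor expansion of [y]
    modulo 1 then gives [g(alpha) y = s (f.y)] modulo 1.  This is part (1).

    Conversely, third differences of [w] are summable.  Let [Q = 1 - f/(4d)] be the lazy random walk; a
    martingale argument bounds the sup-norm operator [(u_i - 1) Q^n] by a multiple of [n^(-1/2)], so
    [D_i D_j D_l (1 + Q + Q^2) Q^(3n)] is [O(n^(-3/2))] and the Neumann series of
    [D_i D_j D_l / f] converges in [l^1].  So every element of [K_d] that is [f.y] up to a constant
    has a [y] with integral third differences.  The same gradient bound shows that [Q^n] contracts the
    oscillation of periodic sequences, which solves [f.y = v - const] with [y] periodic. *)

(** No asymptotic expansion of [w] is used. Its defining integrals enter mainly through one
    uniqueness principle, [green_potential]: a summable [b] with [f.b = k] must be [k.w]. With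
    [b = delta] it gives [f.w = delta]; for third differences [b] comes from the random walk.
    Pairing [f.b = k] with the constant 1 shows that the coefficients of [k] sum to 0, so the 1
    subtracted in the plane disappears and all dimensions are treated alike.

    The walk estimates are made for operators on bounded sequences, and the sup-norm of such an
    operator is the l^1 norm of its kernel. Each difference gains [n^(-1/2)]: two would give only
    [1/n], three give a summable rate.

    The obstacle in both parts is that [f] annihilates constants, so a real constant is left
    undetermined. In part (1) it contributes its value times [s], and integrality of [s], finer than
    that of the second moment [-2 s], absorbs it. In the converse the test polynomials are products
    of three differences, for which [s = 0], so the constant drops out. *)

Lemma Un_cv_const c : Un_cv (fun _ => c) c.
Proof. intros eps He. exists 0%nat. intros. unfold Rdist. now rewrite Rminus_diag, Rabs_R0. Qed.

Ltac zd := let i := fresh "i" in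
  apply functional_extensionality; intro i;
  unfold zadd, zsub, zopp, zzero in *; simpl; lia.

(** * Finite sums over lists *)

Definition lsum {A} (l : list A) (f : A -> R) : R :=
  fold_right (fun k acc => f k + acc) 0 l.

Lemma lsum_ext {A} (l : list A) f g :
  (forall x, In x l -> f x = g x) -> lsum l f = lsum l g.
Proof.
  induction l as [|a l IH]; intros H; simpl; [easy|].
  rewrite (H a), IH; simpl; auto. intros; apply H; simpl; auto.
Qed.

Lemma lsum_app {A} (l l' : list A) f : lsum (l ++ l') f = lsum l f + lsum l' f.
Proof. induction l; simpl; lra. Qed.

Lemma lsum_map {A B} (h : A -> B) l f : lsum (map h l) f = lsum l (fun x => f (h x)).
Proof. induction l; simpl; lra. Qed.

Lemma lsum_flat_map {A B} (h : A -> list B) l f :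
  lsum (flat_map h l) f = lsum l (fun x => lsum (h x) f).
Proof. induction l; simpl; [easy|]. rewrite lsum_app; lra. Qed.

Lemma lsum_plus {A} (l : list A) f g :
  lsum l (fun x => f x + g x) = lsum l f + lsum l g.
Proof. induction l; simpl; lra. Qed.

Lemma lsum_minus {A} (l : list A) f g :
  lsum l (fun x => f x - g x) = lsum l f - lsum l g.
Proof. induction l; simpl; lra. Qed.

Lemma lsum_scal {A} (l : list A) c f : lsum l (fun x => c * f x) = c * lsum l f.
Proof. induction l; simpl; lra. Qed.

Lemma lsum_0 {A} (l : list A) f : (forall x, In x l -> f x = 0) -> lsum l f = 0.
Proof.
  intros H. rewrite (lsum_ext l f (fun _ => 0 * 0)).
  - rewrite lsum_scal; lra.
  - intros; rewrite H; auto; lra.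
Qed.

Lemma lsum_exchange {A B} (l : list A) (l' : list B) f :
  lsum l (fun x => lsum l' (f x)) = lsum l' (fun y => lsum l (fun x => f x y)).
Proof.
  induction l; simpl.
  - symmetry; apply lsum_0; auto.
  - rewrite IHl. rewrite <- lsum_plus. easy.
Qed.

Lemma lsum_le {A} (l : list A) f g :
  (forall x, In x l -> f x <= g x) -> lsum l f <= lsum l g.
Proof.
  induction l as [|a l IH]; intros H; simpl; [lra|].
  apply Rplus_le_compat; [apply H|apply IH; intros; apply H]; simpl; auto.
Qed.

Lemma lsum_nonneg {A} (l : list A) f : (forall x, In x l -> 0 <= f x) -> 0 <= lsum l f.
Proof.
  intros H. rewrite <- (lsum_0 l (fun _ => 0)) by auto. apply lsum_le; auto.
Qed.

Lemma lsum_abs {A} (l : list A) f : Rabs (lsum l f) <= lsum l (fun x => Rabs (f x)).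
Proof.
  induction l; simpl; [rewrite Rabs_R0; lra|].
  eapply Rle_trans; [apply Rabs_triang|]; lra.
Qed.

Lemma lsum_perm {A} (l l' : list A) f : Permutation l l' -> lsum l f = lsum l' f.
Proof. induction 1; simpl; lra. Qed.

Lemma lsum_filter {A} (p : A -> bool) l f :
  lsum l f = lsum (filter p l) f + lsum (filter (fun x => negb (p x)) l) f.
Proof. induction l; simpl; [lra|]. destruct (p a); simpl; lra. Qed.

Lemma is_int_lsum {A} (l : list A) f :
  (forall x, In x l -> is_int (f x)) -> is_int (lsum l f).
Proof.
  induction l as [|a l IH]; intros H; simpl; [now exists 0%Z|].
  destruct (H a) as [u Hu]; [simpl; auto|].
  destruct IH as [w Hw]; [intros; apply H; simpl; auto|].
  exists (u + w)%Z. rewrite plus_IZR; lra.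
Qed.

Definition mem {d} (l : list (Zd d)) (n : Zd d) : bool :=
  if excluded_middle_informative (In n l) then true else false.

Lemma mem_true {d} (l : list (Zd d)) n : mem l n = true <-> In n l.
Proof. unfold mem; destruct excluded_middle_informative; split; easy. Qed.
Lemma mem_false {d} (l : list (Zd d)) n : negb (mem l n) = true <-> ~ In n l.
Proof. unfold mem; destruct excluded_middle_informative; simpl; split; easy. Qed.

Lemma lsum_incl_split {d} (l0 l : list (Zd d)) f :
  NoDup l0 -> NoDup l -> incl l0 l ->
  lsum l f = lsum l0 f + lsum (filter (fun n => negb (mem l0 n)) l) f.
Proof.
  intros N0 N1 I. rewrite (lsum_filter (mem l0) l). f_equal.
  apply lsum_perm, NoDup_Permutation; auto using NoDup_filter.
  intros x. rewrite filter_In, mem_true. split; [tauto|auto].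
Qed.

Lemma lsum_delta {d} (l : list (Zd d)) (m : Zd d) (f : Zd d -> R) :
  NoDup l -> In m l ->
  lsum l (fun n => if excluded_middle_informative (m = n) then f n else 0) = f m.
Proof.
  intros N I. rewrite (lsum_incl_split [m] l).
  - simpl. destruct excluded_middle_informative; [|easy].
    rewrite lsum_0; [lra|]. intros x. rewrite filter_In, mem_false. simpl.
    intros [_ H]. destruct excluded_middle_informative; [subst; tauto|easy].
  - constructor; simpl; auto; constructor.
  - easy.
  - intros x [<-|[]]; easy.
Qed.

Lemma lsum_sub_le {d} (l0 l : list (Zd d)) f :
  NoDup l0 -> NoDup l -> incl l0 l -> (forall n, 0 <= f n) -> lsum l0 f <= lsum l f.
Proof.
  intros N0 N1 I P. rewrite (lsum_incl_split l0 l) by easy.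
  assert (0 <= lsum (filter (fun n => negb (mem l0 n)) l) f) by (apply lsum_nonneg; auto).
  lra.
Qed.

(** ** Boxes *)

Lemma vcons_eta {A} {d} (v : Fin.t (S d) -> A) : vcons (v Fin.F1) (fun i => v (Fin.FS i)) = v.
Proof.
  apply functional_extensionality; intros i.
  pattern i; apply Fin.caseS'; reflexivity.
Qed.

Lemma vnil_eta {A} (v : Fin.t 0 -> A) : v = vnil.
Proof. apply functional_extensionality; intros i; inversion i. Qed.

Lemma in_zrange N k : In k (zrange N) <-> (Z.abs k <= Z.of_nat N)%Z.
Proof.
  unfold zrange. rewrite in_map_iff. split.
  - intros [x [<- H]]. apply in_seq in H. lia.
  - intros H. exists (Z.to_nat (k + Z.of_nat N)). rewrite in_seq. lia.
Qed.

Lemma NoDup_zrange N : NoDup (zrange N).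
Proof.
  apply FinFun.Injective_map_NoDup; [|apply seq_NoDup]. intros x y H; lia.
Qed.

Lemma in_box d N (n : Zd d) : In n (box d N) <-> forall i, (Z.abs (n i) <= Z.of_nat N)%Z.
Proof.
  induction d as [|d IH].
  - simpl. split; [intros _ i; inversion i|]. intros _. left. symmetry. apply vnil_eta.
  - simpl. rewrite in_flat_map. split.
    + intros [k [Hk H]]. apply in_map_iff in H. destruct H as [v [<- Hv]].
      apply in_zrange in Hk. rewrite IH in Hv.
      intros i. pattern i; apply Fin.caseS'; simpl; auto.
    + intros H. exists (n Fin.F1). split; [apply in_zrange, H|].
      apply in_map_iff. exists (fun i => n (Fin.FS i)). split; [apply vcons_eta|].
      apply IH. intros; apply H.
Qed.

Lemma NoDup_flat_map {A B} (h : A -> list B) l :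
  NoDup l -> (forall a, In a l -> NoDup (h a)) ->
  (forall a b x, In a l -> In b l -> In x (h a) -> In x (h b) -> a = b) ->
  NoDup (flat_map h l).
Proof.
  induction 1 as [|a l Ha N IH]; intros H1 H2; simpl; [constructor|].
  apply NoDup_app.
  - apply H1; simpl; auto.
  - apply IH; [intros; apply H1; simpl; auto|].
    intros; eapply H2; simpl; eauto.
  - intros x Hx Hx'. apply in_flat_map in Hx'. destruct Hx' as [b [Hb Hx']].
    apply Ha. rewrite (H2 a b x); simpl; auto.
Qed.

Lemma NoDup_box d N : NoDup (box d N).
Proof.
  induction d; simpl.
  - constructor; simpl; auto; constructor.
  - apply NoDup_flat_map.
    + apply NoDup_zrange.
    + intros k _. apply FinFun.Injective_map_NoDup; auto.
      intros x y H. apply functional_extensionality; intros i.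
      exact (f_equal (fun v => v (Fin.FS i)) H).
    + intros a b x _ _ Ha Hb. apply in_map_iff in Ha, Hb.
      destruct Ha as [u [<- _]], Hb as [v [E _]].
      symmetry. exact (f_equal (fun v => v Fin.F1) E).
Qed.

Lemma fin_bound d (n : Zd d) : exists N, forall i, (Z.abs (n i) <= Z.of_nat N)%Z.
Proof.
  induction d as [|d IH].
  - exists 0%nat. intros i; inversion i.
  - destruct (IH (fun i => n (Fin.FS i))) as [N H].
    exists (N + Z.to_nat (Z.abs (n Fin.F1)))%nat. intros i. pattern i; apply Fin.caseS'.
    + lia.
    + intros p. specialize (H p). simpl in H. lia.
Qed.

Lemma list_in_box d (l : list (Zd d)) : exists N, forall M, (N <= M)%nat -> incl l (box d M).
Proof.
  induction l as [|a l [N IH]].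
  - exists 0%nat. intros M _ x [].
  - destruct (fin_bound d a) as [N' H']. exists (N + N')%nat. intros M HM x [<-|Hx].
    + apply in_box. intros i. specialize (H' i). lia.
    + apply IH; auto; lia.
Qed.

Lemma box_incl d N M : (N <= M)%nat -> incl (box d N) (box d M).
Proof.
  intros H x. rewrite !in_box. intros H' i. specialize (H' i). lia.
Qed.

(** ** Absolutely summable sequences *)

Lemma boxsum_lsum {d} (a : rseq d) N : boxsum a N = lsum (box d N) a.
Proof. reflexivity. Qed.

(** Bounding the sums over all duplicate-free lists, and not only over boxes, frees summability from
    the order of summation; injective reindexing then costs nothing. *)
Lemma l1_list {d} (a : rseq d) :
  l1 a -> exists B, forall l, NoDup l -> lsum l (fun k => Rabs (a k)) <= B.
Proof.
  intros [B HB]. exists B. intros l Nl. destruct (list_in_box d l) as [N HN].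
  eapply Rle_trans; [|apply (HB N)]. rewrite boxsum_lsum.
  apply lsum_sub_le; auto using NoDup_box, Rabs_pos.
Qed.

Lemma list_l1 {d} (a : rseq d) B :
  (forall l, NoDup l -> lsum l (fun k => Rabs (a k)) <= B) -> l1 a.
Proof. intros H. exists B. intros N. apply H, NoDup_box. Qed.

Lemma l1_inj {d} (a : rseq d) (h : Zd d -> Zd d) :
  FinFun.Injective h -> l1 a -> l1 (fun k => a (h k)).
Proof.
  intros Hh Ha. apply l1_list in Ha. destruct Ha as [B HB].
  apply (list_l1 _ B). intros l Nl.
  rewrite <- (lsum_map h l (fun k => Rabs (a k))).
  apply HB, FinFun.Injective_map_NoDup; auto.
Qed.

Lemma l1_ext {d} (a b : rseq d) : (forall n, a n = b n) -> l1 a -> l1 b.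
Proof. intros H. replace b with a; auto. apply functional_extensionality; auto. Qed.

Lemma l1_mult {d} (a v : rseq d) : l1 a -> linf v -> l1 (fun k => a k * v k).
Proof.
  intros [B HB] [C HC]. exists (C * B). intros N.
  assert (0 <= C) by (eapply Rle_trans; [apply Rabs_pos|apply (HC zzero)]).
  eapply Rle_trans with (C * boxsum (fun k => Rabs (a k)) N).
  - rewrite !boxsum_lsum, <- lsum_scal. apply lsum_le. intros x _.
    rewrite Rabs_mult, Rmult_comm. apply Rmult_le_compat_r; auto using Rabs_pos.
  - apply Rmult_le_compat_l; auto.
Qed.

Lemma l1_tail {d} (a : rseq d) : l1 a -> forall eps, 0 < eps ->
  exists N, forall l, NoDup l -> (forall n, In n l -> ~ In n (box d N)) ->
    lsum l (fun k => Rabs (a k)) <= eps.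
Proof.
  intros H eps He. apply l1_list in H. destruct H as [B HB].
  set (E := fun x => exists N, x = boxsum (fun k => Rabs (a k)) N).
  destruct (completeness E) as [s [Hs1 Hs2]].
  - exists B. intros x [N ->]. apply HB, NoDup_box.
  - exists (boxsum (fun k => Rabs (a k)) 0). now exists 0%nat.
  - assert (HN : exists N, s - eps < boxsum (fun k => Rabs (a k)) N).
    { apply NNPP. intros Hn. assert (s <= s - eps); [|lra]. apply Hs2.
      intros x [N ->]. apply Rnot_lt_le. intros Hl. apply Hn. now exists N. }
    destruct HN as [N HN]. exists N. intros l Nl Hl.
    destruct (list_in_box d (box d N ++ l)) as [M HM]. specialize (HM M (le_n _)).
    assert (HM' : boxsum (fun k => Rabs (a k)) M <= s) by (apply Hs1; now exists M).
    assert (lsum (box d N ++ l) (fun k => Rabs (a k)) <= boxsum (fun k => Rabs (a k)) M).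
    { apply lsum_sub_le; auto using NoDup_box, Rabs_pos.
      apply NoDup_app; auto using NoDup_box. intros x Hx Hx'. eapply Hl; eauto. }
    rewrite lsum_app in H. rewrite boxsum_lsum in *. lra.
Qed.

(** Both lists contain the box, so they differ by two finite sets outside it, each contributing at
    most [eps]. Convergence, its error bound and invariance under translation rest on this. *)
Lemma tail_lists {d} (a : rseq d) N eps l1 l2 :
  (forall l, NoDup l -> (forall n, In n l -> ~ In n (box d N)) ->
    lsum l (fun k => Rabs (a k)) <= eps) ->
  NoDup l1 -> NoDup l2 -> incl (box d N) l1 -> incl (box d N) l2 ->
  Rabs (lsum l1 a - lsum l2 a) <= 2 * eps.
Proof.
  intros H N1 N2 I1 I2.
  rewrite (lsum_incl_split (box d N) l1), (lsum_incl_split (box d N) l2); auto using NoDup_box.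
  set (m1 := filter _ l1). set (m2 := filter _ l2).
  assert (H1 : Rabs (lsum m1 a) <= eps).
  { eapply Rle_trans; [apply lsum_abs|]. apply H; [now apply NoDup_filter|].
    intros n Hn. apply filter_In in Hn. now apply mem_false. }
  assert (H2 : Rabs (lsum m2 a) <= eps).
  { eapply Rle_trans; [apply lsum_abs|]. apply H; [now apply NoDup_filter|].
    intros n Hn. apply filter_In in Hn. now apply mem_false. }
  revert H1 H2. unfold Rabs. repeat destruct Rcase_abs; lra.
Qed.

Lemma l1_series {d} (a : rseq d) : l1 a -> exists s, series_to a s.
Proof.
  intros H. destruct (Rcomplete.R_complete (fun N => boxsum a N)) as [s Hs]; [|now exists s].
  intros eps He. destruct (l1_tail a H (eps / 4)) as [N HN]; [lra|].
  exists N. intros n m Hn Hm. unfold Rdist. rewrite !boxsum_lsum.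
  eapply Rle_lt_trans; [eapply tail_lists|]; eauto using NoDup_box; try (apply box_incl; lia).
  lra.
Qed.

Lemma series_near {d} (a : rseq d) s N eps :
  (forall l, NoDup l -> (forall n, In n l -> ~ In n (box d N)) ->
    lsum l (fun k => Rabs (a k)) <= eps) ->
  series_to a s -> forall M, (N <= M)%nat -> Rabs (s - boxsum a M) <= 2 * eps.
Proof.
  intros H Hs M HM. apply Rnot_lt_le. intros Hl.
  destruct (Hs (Rabs (s - boxsum a M) - 2 * eps)) as [K HK]; [lra|].
  specialize (HK (max K M) (Nat.le_max_l _ _)). unfold Rdist in HK.
  assert (H3 : Rabs (boxsum a (max K M) - boxsum a M) <= 2 * eps).
  { rewrite !boxsum_lsum. eapply tail_lists; eauto using NoDup_box; apply box_incl; lia. }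
  revert HK H3 Hl. unfold Rabs. repeat destruct Rcase_abs; lra.
Qed.

Lemma series_ext {d} (a b : rseq d) s : (forall n, a n = b n) -> series_to a s -> series_to b s.
Proof. intros H. replace b with a; auto. apply functional_extensionality; auto. Qed.

Lemma series_unique {d} (a : rseq d) s s' : series_to a s -> series_to a s' -> s = s'.
Proof. apply UL_sequence. Qed.

Lemma series_plus {d} (a b : rseq d) s t :
  series_to a s -> series_to b t -> series_to (fun k => a k + b k) (s + t).
Proof.
  intros Ha Hb. eapply Un_cv_ext; [|apply (CV_plus _ _ _ _ Ha Hb)].
  intros n. simpl. rewrite !boxsum_lsum. symmetry; apply lsum_plus.
Qed.

Lemma series_scal {d} (a : rseq d) c s :
  series_to a s -> series_to (fun k => c * a k) (c * s).
Proof.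
  intros Ha. eapply Un_cv_ext; [|apply (CV_mult (fun _ => c) _ c _ (Un_cv_const c) Ha)].
  intros n. simpl. rewrite !boxsum_lsum. symmetry; apply lsum_scal.
Qed.

Lemma series_zero {d} : series_to (fun _ : Zd d => 0) 0.
Proof.
  eapply Un_cv_ext; [|apply (Un_cv_const 0)]. intros n. symmetry; apply lsum_0; auto.
Qed.

Lemma series_lsum {d} {A} (l : list A) (a : A -> rseq d) (s : A -> R) :
  (forall x, In x l -> series_to (a x) (s x)) ->
  series_to (fun k => lsum l (fun x => a x k)) (lsum l s).
Proof.
  induction l as [|x l IH]; intros H; simpl.
  - apply series_zero.
  - apply series_plus; [apply H; simpl; auto|apply IH; intros; apply H; simpl; auto].
Qed.

(** A translated box still contains the box of radius [N] once its radius exceeds [N] by the size of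
    [m], so translated and original partial sums agree up to tails. *)
Lemma series_shift {d} (a : rseq d) (m : Zd d) s :
  l1 a -> series_to a s -> series_to (fun k => a (zsub k m)) s.
Proof.
  intros Ha Hs eps He. destruct (l1_tail a Ha (eps / 8)) as [N HN]; [lra|].
  destruct (fin_bound d m) as [N' HN'].
  exists (N + N')%nat. intros M HM. unfold Rdist.
  assert (H1 : Rabs (s - boxsum a M) <= 2 * (eps / 8)).
  { eapply series_near; eauto; lia. }
  assert (H2 : Rabs (lsum (map (fun k => zsub k m) (box d M)) a - lsum (box d M) a)
               <= 2 * (eps / 8)).
  { eapply tail_lists; eauto using NoDup_box.
    - apply FinFun.Injective_map_NoDup; [|apply NoDup_box].
      intros x y E. apply functional_extensionality; intros i.
      apply (f_equal (fun v => v i)) in E. unfold zsub in E. lia.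
    - intros x Hx. apply in_map_iff. exists (zadd x m). split; [zd|].
      apply in_box. intros i. rewrite in_box in Hx. specialize (Hx i). specialize (HN' i).
      unfold zadd. lia.
    - apply box_incl; lia. }
  rewrite lsum_map in H2. rewrite boxsum_lsum in *.
  revert H1 H2. unfold Rabs. repeat destruct Rcase_abs; lra.
Qed.

(** ** Laurent polynomials *)

Lemma pconv_lsum {d} (p : lpoly d) a n :
  pconv p a n = lsum p (fun ce => IZR (fst ce) * a (zsub n (snd ce))).
Proof. reflexivity. Qed.

Lemma palpha_lsum {d} (p : lpoly d) a n :
  palpha p a n = lsum p (fun ce => IZR (fst ce) * a (zadd (snd ce) n)).
Proof. reflexivity. Qed.

Lemma lcoef_lsum {d} (p : lpoly d) n :
  IZR (lcoef p n) = lsum p (fun ce => if excluded_middle_informative (snd ce = n)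
                            then IZR (fst ce) else 0).
Proof.
  induction p as [|[c e] p IH]; simpl; [easy|].
  destruct excluded_middle_informative; [rewrite plus_IZR|]; simpl; lra.
Qed.

Lemma lcoef_sum {d} (p : lpoly d) l (y : rseq d) :
  NoDup l -> incl (map snd p) l ->
  lsum p (fun ce => IZR (fst ce) * y (snd ce)) = lsum l (fun k => IZR (lcoef p k) * y k).
Proof.
  intros Nl Hl. symmetry.
  rewrite (lsum_ext l _ (fun k => lsum p (fun ce =>
      if excluded_middle_informative (snd ce = k) then IZR (fst ce) * y k else 0))).
  - rewrite lsum_exchange. apply lsum_ext. intros ce Hce.
    rewrite (lsum_delta l (snd ce) (fun k => IZR (fst ce) * y k)); auto.
    apply Hl, in_map, Hce.
  - intros k _. rewrite lcoef_lsum, Rmult_comm, <- lsum_scal. apply lsum_ext.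
    intros ce _. destruct excluded_middle_informative; lra.
Qed.

(** [Iscr3] prescribes an element only through its coefficient function; this lets [palpha] pass
    from the given list to the explicit sum of products. *)
Lemma palpha_lcoef {d} (p q : lpoly d) x n : lcoef p = lcoef q -> palpha p x n = palpha q x n.
Proof.
  intros E. rewrite !palpha_lsum.
  destruct (list_in_box d (map snd p ++ map snd q)) as [N HN]. specialize (HN N (le_n _)).
  rewrite (lcoef_sum p (box d N) (fun k => x (zadd k n))), (lcoef_sum q (box d N) (fun k => x (zadd k n))), E;
    auto using NoDup_box; intros z Hz; apply HN, in_or_app; auto.
Qed.

Lemma series_lcoef {d} (p : lpoly d) (y : rseq d) n :
  series_to (fun k => IZR (lcoef p k) * y (zsub n k)) (pconv p y n).
Proof.
  destruct (list_in_box d (map snd p)) as [N HN].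
  intros eps He. exists N. intros M HM. unfold Rdist.
  rewrite boxsum_lsum, pconv_lsum, (lcoef_sum p (box d M) (fun k => y (zsub n k)));
    auto using NoDup_box.
  rewrite Rminus_diag, Rabs_R0; auto.
Qed.

(** Summation by parts. The sums of [a . (q.y)] and of [(q.a) . y] are the same finite combination
    of the values [S m] of the convolution of [a] and [y]: the first by translating [y], the second
    by translating the summation index. *)
Lemma series_by_parts {d} (q p : lpoly d) (a y : rseq d) n :
  l1 a -> linf y -> (forall k, pconv q a k = IZR (lcoef p k)) ->
  series_to (fun k => a k * pconv q y (zsub n k)) (pconv p y n).
Proof.
  intros Ha Hy Hq.
  assert (Hl1 : forall m, l1 (fun k => a k * y (zsub m k))).
  { intros m. apply l1_mult; auto. destruct Hy as [B HB]. now exists B. }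
  assert (Hs : forall m, exists s, series_to (fun k => a k * y (zsub m k)) s)
    by (intros; now apply l1_series).
  destruct (choice _ Hs) as [S HS].
  assert (E1 : series_to (fun k => a k * pconv q y (zsub n k))
     (lsum q (fun ce => IZR (fst ce) * S (zsub n (snd ce))))).
  { eapply series_ext; [|apply (series_lsum q
      (fun ce k => IZR (fst ce) * (a k * y (zsub (zsub n (snd ce)) k))))].
    - intros k. simpl. rewrite pconv_lsum, <- lsum_scal. apply lsum_ext. intros ce _.
      replace (zsub (zsub n (snd ce)) k) with (zsub (zsub n k) (snd ce)) by zd. ring.
    - intros ce _. apply series_scal, HS. }
  assert (E2 : series_to (fun k => pconv q a k * y (zsub n k))
     (lsum q (fun ce => IZR (fst ce) * S (zsub n (snd ce))))).
  { eapply series_ext; [|apply (series_lsum q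
      (fun ce k => IZR (fst ce) * (a (zsub k (snd ce)) * y (zsub n k))))].
    - intros k. simpl. rewrite pconv_lsum, Rmult_comm, <- lsum_scal. apply lsum_ext.
      intros ce _. ring.
    - intros ce _. apply series_scal.
      eapply series_ext; [|apply (series_shift _ (snd ce) _ (Hl1 (zsub n (snd ce))) (HS _))].
      intros k. simpl. do 2 f_equal. zd. }
  replace (pconv p y n) with (lsum q (fun ce => IZR (fst ce) * S (zsub n (snd ce)))); auto.
  eapply series_unique; [apply E2|].
  eapply series_ext; [|apply series_lcoef]. intros k. simpl. now rewrite Hq.
Qed.

Lemma fsum_lsum d f : fsum d f = lsum (fins d) f.
Proof.
  induction d; simpl; auto. rewrite IHd, lsum_map. easy.
Qed.

Lemma in_fins d (i : Fin.t d) : In i (fins d).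
Proof. induction i; simpl; auto. right. now apply in_map. Qed.

(** ** Iterated integrals *)

Definition cube {d} (t : Rd d) : Prop := forall i, 0 <= t i <= 1.

Lemma cube_vcons d u (t : Rd d) : 0 <= u <= 1 -> cube t -> cube (vcons u t).
Proof. intros Hu Ht i. pattern i; apply Fin.caseS'; simpl; auto. Qed.

(** Trades the integrability witness in the definition for [is_RInt], whose calculus is used from
    here on. *)
Lemma IInt_S d f l :
  IInt (S d) f l <-> exists g, (forall t, 0 <= t <= 1 -> IInt d (fun s => f (vcons t s)) (g t)) /\
                       is_RInt g 0 1 l.
Proof.
  simpl. split; intros [g [Hg H]]; exists g; split; auto.
  - destruct H as [pr <-]. rewrite <- RInt_Reals. apply (RInt_correct (V := R_CompleteNormedModule)), ex_RInt_Reals_1, pr.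
  - assert (pr : Riemann_integrable g 0 1) by (apply ex_RInt_Reals_0; now exists l).
    exists pr. rewrite <- RInt_Reals. now apply is_RInt_unique.
Qed.

Lemma IInt_mono d : forall f g l m, IInt d f l -> IInt d g m ->
  (forall t, cube t -> f t <= g t) -> l <= m.
Proof.
  induction d as [|d IH]; intros f g l m Hf Hg H.
  - simpl in *. subst. apply H. intros i; inversion i.
  - apply IInt_S in Hf, Hg. destruct Hf as [f' [Hf If]], Hg as [g' [Hg Ig]].
    apply (is_RInt_le f' g' 0 1); auto; [lra|].
    intros x Hx. eapply IH; [apply Hf; lra|apply Hg; lra|].
    intros t Ht. apply H, cube_vcons; auto; lra.
Qed.

Lemma IInt_ext d : forall f g l, (forall t, f t = g t) -> IInt d f l -> IInt d g l.
Proof. intros f g l H. replace g with f; auto. apply functional_extensionality; auto. Qed.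

Lemma IInt_plus d : forall f g l m, IInt d f l -> IInt d g m ->
  IInt d (fun t => f t + g t) (l + m).
Proof.
  induction d as [|d IH]; intros f g l m Hf Hg.
  - simpl in *. now subst.
  - apply IInt_S in Hf, Hg. destruct Hf as [f' [Hf If]], Hg as [g' [Hg Ig]].
    apply IInt_S. exists (fun t => f' t + g' t). split; [intros t Ht; auto|].
    apply (is_RInt_plus f' g'); auto.
Qed.

Lemma IInt_scal d : forall f c l, IInt d f l -> IInt d (fun t => c * f t) (c * l).
Proof.
  induction d as [|d IH]; intros f c l Hf.
  - simpl in *. now subst.
  - apply IInt_S in Hf. destruct Hf as [f' [Hf If]].
    apply IInt_S. exists (fun t => c * f' t). split; [intros t Ht; auto|].
    apply (is_RInt_scal f'); auto.
Qed.

Lemma IInt_minus d f g l m : IInt d f l -> IInt d g m ->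
  IInt d (fun t => f t - g t) (l - m).
Proof.
  intros Hf Hg. replace (l - m) with (l + (-1) * m) by ring.
  eapply IInt_ext; [|apply (IInt_plus _ _ _ _ _ Hf (IInt_scal _ _ (-1) _ Hg))].
  intros t; simpl; ring.
Qed.

Lemma IInt_const d c : IInt d (fun _ => c) c.
Proof.
  induction d as [|d IH]; [reflexivity|].
  apply IInt_S. exists (fun _ => c). split; auto.
  assert (H := is_RInt_const (V := R_NormedModule) 0 1 c).
  assert (E : scal (1 - 0) c = c) by (change ((1 - 0) * c = c); ring).
  exact (eq_rect _ (fun l : R => is_RInt (fun _ => c) 0 1 l) H _ E).
Qed.

Lemma IInt_lsum d {A} (l : list A) (f : A -> Rd d -> R) (s : A -> R) :
  (forall x, In x l -> IInt d (f x) (s x)) ->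
  IInt d (fun t => lsum l (fun x => f x t)) (lsum l s).
Proof.
  induction l as [|x l IH]; intros H; simpl.
  - apply IInt_const.
  - apply IInt_plus; [apply H; simpl; auto|apply IH; intros; apply H; simpl; auto].
Qed.

Lemma IInt_prod_cons d (h : R -> R) g c l :
  is_RInt h 0 1 c -> IInt d g l ->
  IInt (S d) (fun t => h (t Fin.F1) * g (fun i => t (Fin.FS i))) (c * l).
Proof.
  intros Hh Hg. apply IInt_S. exists (fun t => h t * l). split.
  - intros t Ht. simpl. apply IInt_scal, Hg.
  - eapply is_RInt_ext; [|rewrite Rmult_comm; apply (is_RInt_scal h 0 1 l), Hh].
    intros x _. unfold scal; simpl; unfold mult; simpl. ring.
Qed.

(** * Lipschitz integrands *)

Definition Lip {d} (f : Rd d -> R) : Prop :=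
  exists L, 0 <= L /\ forall t s, Rabs (f t - f s) <= L * fsum d (fun i => Rabs (t i - s i)).

(** Integrating out the later coordinates keeps the Lipschitz constant in the first one, so the
    inner integral is continuous and the induction proceeds. The truncated integrands below are all
    of this kind. *)
Lemma Lip_IInt d : forall f, Lip f -> exists l, IInt d f l.
Proof.
  induction d as [|d IH]; intros f [L [HL0 HL]].
  - now exists (f vnil).
  - assert (H : forall t, exists l, IInt d (fun s => f (vcons t s)) l).
    { intros t. apply IH. exists L. split; auto. intros u s.
      eapply Rle_trans; [apply HL|]. apply Rmult_le_compat_l; auto. simpl.
      rewrite Rminus_diag, Rabs_R0. right. ring. }
    destruct (choice _ H) as [g Hg].
    assert (Hc : forall t t', g t - g t' <= L * Rabs (t - t')).
    { intros t t'. apply (IInt_mono d (fun s => f (vcons t s) - f (vcons t' s))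
        (fun _ => L * Rabs (t - t'))).
      - now apply IInt_minus.
      - apply IInt_const.
      - intros s _. eapply Rle_trans; [apply Rle_abs|].
        eapply Rle_trans; [apply HL|]. apply Rmult_le_compat_l; auto. simpl.
        rewrite fsum_lsum, lsum_0; [simpl; lra|]. intros i _. now rewrite Rminus_diag, Rabs_R0. }
    assert (He : ex_RInt g 0 1).
    { apply (ex_RInt_continuous (V := R_CompleteNormedModule)). intros z _.
      apply continuity_pt_filterlim. intros eps He.
      exists (eps / (L + 1)). split; [apply Rdiv_lt_0_compat; lra|].
      intros x [_ Hx]. simpl in *. unfold Rdist in *.
      assert (Hz : Rabs (g x - g z) <= L * Rabs (x - z)).
      { apply Rabs_le. split.
        - generalize (Hc z x). rewrite (Rabs_minus_sym z x). lra.
        - apply Hc. }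
      assert ((L + 1) * Rabs (x - z) < eps).
      { apply Rmult_lt_compat_l with (r := L + 1) in Hx; [|lra].
        replace ((L + 1) * (eps / (L + 1))) with eps in Hx by (field; lra). easy. }
      generalize (Rabs_pos (x - z)). lra. }
    destruct He as [l Hl]. exists l. apply IInt_S. exists g. auto.
Qed.

Lemma Lip_const {d} c : Lip (fun _ : Rd d => c).
Proof.
  exists 0. split; [lra|]. intros. rewrite Rminus_diag, Rabs_R0. lra.
Qed.

Lemma Lip_coord {d} (i : Fin.t d) : Lip (fun t : Rd d => t i).
Proof.
  exists 1. split; [lra|]. intros t s. rewrite Rmult_1_l.
  rewrite fsum_lsum. generalize (in_fins d i). generalize (fins d).
  induction l as [|a l IH]; simpl; [easy|]. intros [<-|H].
  - assert (0 <= lsum l (fun i => Rabs (t i - s i))) by (apply lsum_nonneg; intros; apply Rabs_pos). lra.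
  - specialize (IH H). generalize (Rabs_pos (t a - s a)). lra.
Qed.

Lemma Lip_comp {d} (h : R -> R) (f : Rd d -> R) K :
  0 <= K -> (forall x y, Rabs (h x - h y) <= K * Rabs (x - y)) -> Lip f -> Lip (fun t => h (f t)).
Proof.
  intros HK Hh [L [HL0 HL]]. exists (K * L). split; [now apply Rmult_le_pos|]. intros t s.
  eapply Rle_trans; [apply Hh|]. rewrite Rmult_assoc. apply Rmult_le_compat_l; auto.
Qed.

Lemma Lip_plus {d} (f g : Rd d -> R) : Lip f -> Lip g -> Lip (fun t => f t + g t).
Proof.
  intros [L [HL0 HL]] [K [HK0 HK]]. exists (L + K). split; [lra|]. intros t s.
  replace (f t + g t - (f s + g s)) with ((f t - f s) + (g t - g s)) by ring.
  eapply Rle_trans; [apply Rabs_triang|]. specialize (HL t s). specialize (HK t s). lra.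
Qed.

Lemma Lip_scal {d} c (f : Rd d -> R) : Lip f -> Lip (fun t => c * f t).
Proof.
  apply (Lip_comp (fun x => c * x) f (Rabs c)); [apply Rabs_pos|].
  intros x y. rewrite <- Rmult_minus_distr_l, Rabs_mult. lra.
Qed.

Lemma Lip_ext {d} (f g : Rd d -> R) : (forall t, f t = g t) -> Lip f -> Lip g.
Proof. intros H. replace g with f; auto. apply functional_extensionality; auto. Qed.

Lemma Lip_minus {d} (f g : Rd d -> R) : Lip f -> Lip g -> Lip (fun t => f t - g t).
Proof.
  intros Hf Hg. apply (Lip_ext (fun t => f t + (-1) * g t)); [intros; ring|].
  now apply Lip_plus, Lip_scal.
Qed.

Lemma Lip_mult {d} (f g : Rd d -> R) A B : (forall t, Rabs (f t) <= A) -> (forall t, Rabs (g t) <= B) ->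
  Lip f -> Lip g -> Lip (fun t => f t * g t).
Proof.
  intros HA HB [L [HL0 HL]] [K [HK0 HK]].
  assert (0 <= A) by (eapply Rle_trans; [apply Rabs_pos|apply (HA (fun _ => 0))]).
  assert (0 <= B) by (eapply Rle_trans; [apply Rabs_pos|apply (HB (fun _ => 0))]).
  exists (A * K + L * B). split.
  { assert (0 <= A * K) by now apply Rmult_le_pos.
    assert (0 <= L * B) by now apply Rmult_le_pos. lra. }
  intros t s.
  replace (f t * g t - f s * g s) with (f t * (g t - g s) + (f t - f s) * g s) by ring.
  eapply Rle_trans; [apply Rabs_triang|]. rewrite !Rabs_mult, Rmult_plus_distr_r.
  apply Rplus_le_compat.
  - rewrite Rmult_assoc. apply Rmult_le_compat; auto using Rabs_pos.
  - rewrite (Rmult_comm L B), Rmult_assoc, (Rmult_comm B).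
    apply Rmult_le_compat; auto using Rabs_pos.
Qed.

Lemma Lip_lsum {d} {A} (l : list A) (f : A -> Rd d -> R) :
  (forall x, Lip (f x)) -> Lip (fun t => lsum l (fun x => f x t)).
Proof.
  intros H. induction l; simpl; [apply Lip_const|now apply Lip_plus].
Qed.

Lemma cos_lip x y : Rabs (cos x - cos y) <= 1 * Rabs (x - y).
Proof.
  destruct (MVT_gen cos y x (fun z => - sin z)) as [c [_ Hc]].
  - intros z _. auto_derive; auto; ring.
  - intros z _. apply continuity_cos.
  - rewrite Hc, Rabs_mult, Rabs_Ropp. apply Rmult_le_compat_r; [apply Rabs_pos|].
    apply Rabs_le, SIN_bound.
Qed.

(** The step is an equivalence, so it covers both directions along each axis. [PZ] moves along one
    axis by any integer; [H] then corrects the coordinates one at a time. *)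
Lemma zd_ind {d} (P : Zd d -> Prop) :
  P zzero -> (forall n i, P n <-> P (zadd n (zunit i))) -> forall n, P n.
Proof.
  intros P0 PS.
  assert (PZ : forall n i k, P n <-> P (zadd n (fun j => (k * zunit i j)%Z))).
  { intros n i. apply (Z.peano_ind (fun k => P n <-> P (zadd n (fun j => (k * zunit i j)%Z)))).
    - replace (zadd n _) with n by zd. tauto.
    - intros k ->. rewrite (PS (zadd n _) i).
      replace (zadd (zadd n _) _) with (zadd n (fun j => (Z.succ k * zunit i j)%Z)); [tauto|zd].
    - intros k ->. rewrite (PS (zadd n (fun j => (Z.pred k * zunit i j)%Z)) i).
      replace (zadd (zadd n _) _) with (zadd n (fun j => (k * zunit i j)%Z)); [tauto|zd]. }
  assert (H : forall l n m, (forall i, ~ In i l -> n i = m i) -> (P n <-> P m)).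
  { induction l as [|i l IH]; intros n m H.
    - replace m with n; [tauto|]. apply functional_extensionality; intros i; apply H; auto.
    - rewrite (PZ n i (m i - n i)%Z). apply IH. intros j Hj. unfold zadd, zunit.
      destruct (Fin.eq_dec i j) as [->|Hn]; [lia|].
      rewrite H; [lia|]. intros [E|E]; auto. }
  intros n. apply (H (fins d) zzero n); auto.
  intros i Hi. destruct Hi. apply in_fins.
Qed.

Lemma zunit_FS {d} (i j : Fin.t d) : zunit (Fin.FS i) (Fin.FS j) = zunit i j.
Proof.
  unfold zunit. destruct (Fin.eq_dec i j) as [->|H], (Fin.eq_dec (Fin.FS _) (Fin.FS _)) as [E|E]; auto.
  - now destruct E.
  - apply Fin.FS_inj in E. easy.
Qed.

Lemma lsum_zunit {d} (i : Fin.t d) (f : Fin.t d -> R) :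
  lsum (fins d) (fun j => IZR (zunit i j) * f j) = f i.
Proof.
  assert (E1 : forall d (j : Fin.t d), zunit Fin.F1 (Fin.FS j) = 0%Z).
  { intros e j. unfold zunit. destruct Fin.eq_dec; [discriminate|easy]. }
  assert (E2 : forall d (j : Fin.t d), zunit (Fin.FS j) Fin.F1 = 0%Z).
  { intros e j. unfold zunit. destruct Fin.eq_dec; [discriminate|easy]. }
  induction i as [d|d i IH]; simpl; rewrite lsum_map.
  - rewrite lsum_0; [|intros j _; rewrite E1; ring].
    unfold zunit. destruct Fin.eq_dec; [ring|easy].
  - rewrite (lsum_ext _ _ (fun j => IZR (zunit i j) * f (Fin.FS j))).
    + rewrite (IH (fun j => f (Fin.FS j))), E2. ring.
    + intros j _. now rewrite zunit_FS.
Qed.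

(** * Characters and the symbol of the Laplacian *)

Lemma ip_lsum {d} (n : Zd d) t : ip n t = lsum (fins d) (fun j => IZR (n j) * t j).
Proof. apply fsum_lsum. Qed.

Lemma ip_zadd {d} (n m : Zd d) t : ip (zadd n m) t = ip n t + ip m t.
Proof.
  rewrite !ip_lsum, <- lsum_plus. apply lsum_ext. intros. unfold zadd. rewrite plus_IZR. ring.
Qed.

Lemma ip_zsub {d} (n m : Zd d) t : ip (zsub n m) t = ip n t - ip m t.
Proof.
  rewrite !ip_lsum, <- lsum_minus. apply lsum_ext. intros. unfold zsub. rewrite minus_IZR. ring.
Qed.

Lemma ip_zopp {d} (n : Zd d) t : ip (zopp n) t = - ip n t.
Proof.
  rewrite !ip_lsum. replace (- lsum (fins d) (fun j => IZR (n j) * t j)) with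
   (-1 * lsum (fins d) (fun j => IZR (n j) * t j)) by ring. rewrite <- lsum_scal.
  apply lsum_ext. intros. unfold zopp. rewrite opp_IZR. ring.
Qed.

Lemma ip_zunit {d} (i : Fin.t d) t : ip (zunit i) t = t i.
Proof. rewrite ip_lsum. apply lsum_zunit. Qed.

Lemma ip_zzero {d} t : ip (@zzero d) t = 0.
Proof. rewrite ip_lsum. apply lsum_0. intros. unfold zzero. ring. Qed.

Lemma lsum_fins_const d c : lsum (fins d) (fun _ => c) = INR d * c.
Proof.
  induction d; simpl fins; simpl lsum; [simpl; ring|]. rewrite lsum_map, IHd, S_INR. ring.
Qed.

Lemma pconv_fpoly {d} (x : rseq d) n :
  pconv (fpoly d) x n =
  2 * INR d * x n - lsum (fins d) (fun i => x (zsub n (zunit i)) + x (zadd n (zunit i))).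
Proof.
  unfold fpoly. rewrite pconv_lsum. simpl lsum. rewrite lsum_flat_map.
  rewrite (lsum_ext (fins d) _ (fun i => (-1) * (x (zsub n (zunit i)) + x (zadd n (zunit i))))).
  - rewrite lsum_scal. replace (zsub n zzero) with n by zd.
    change (d + (d + 0))%nat with (2 * d)%nat.
    cbn [fst snd]. rewrite Nat2Z.inj_mul, mult_IZR, <- (INR_IZR_INZ d). simpl. ring.
  - intros i _. simpl. replace (zsub n (zopp (zunit i))) with (zadd n (zunit i)) by zd. ring.
Qed.

Lemma Fd_lsum d t : Fd d t = lsum (fins d) (fun i => 2 - 2 * cos (2 * PI * t i)).
Proof.
  unfold Fd. rewrite fsum_lsum, lsum_minus, lsum_scal, lsum_fins_const. ring.
Qed.

(** Characters are eigenvectors of the Laplacian, with its symbol as eigenvalue. The phase [a] keeps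
    this real: 0 gives the cosine and [- (PI / 2)] the sine. *)
Lemma pconv_fpoly_cos {d} a t (n : Zd d) :
  pconv (fpoly d) (fun m => cos (a + 2 * PI * ip m t)) n = Fd d t * cos (a + 2 * PI * ip n t).
Proof.
  rewrite pconv_fpoly, Fd_lsum, lsum_minus, lsum_fins_const, lsum_scal.
  rewrite (lsum_ext _ _ (fun i => (2 * cos (a + 2 * PI * ip n t)) * cos (2 * PI * t i))).
  - rewrite lsum_scal. ring.
  - intros i _. rewrite ip_zsub, ip_zadd, ip_zunit.
    replace (a + 2 * PI * (ip n t - t i)) with (a + 2 * PI * ip n t - 2 * PI * t i) by ring.
    replace (a + 2 * PI * (ip n t + t i)) with (a + 2 * PI * ip n t + 2 * PI * t i) by ring.
    generalize (a + 2 * PI * ip n t) (2 * PI * t i). intros x y. rewrite cos_minus, cos_plus. ring.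
Qed.

Lemma Fd_term d t i : 0 <= 2 - 2 * cos (2 * PI * t i) <= Fd d t.
Proof.
  assert (P : forall i, 0 <= 2 - 2 * cos (2 * PI * t i))
    by (intros j; generalize (COS_bound (2 * PI * t j)); lra).
  split; auto. rewrite Fd_lsum. generalize (in_fins d i). generalize (fins d).
  induction l as [|a l IH]; simpl; [easy|]. intros [<-|H].
  - assert (0 <= lsum l (fun i => 2 - 2 * cos (2 * PI * t i))) by (apply lsum_nonneg; auto). lra.
  - specialize (IH H). specialize (P a). lra.
Qed.

Lemma Fd_nonneg d t : 0 <= Fd d t.
Proof.
  rewrite Fd_lsum. apply lsum_nonneg. intros i _. generalize (COS_bound (2 * PI * t i)); lra.
Qed.

Lemma Fd_le d t : Fd d t <= 4 * INR d.
Proof.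
  rewrite Fd_lsum. replace (4 * INR d) with (INR d * 4) by ring. rewrite <- lsum_fins_const.
  apply lsum_le. intros i _. generalize (COS_bound (2 * PI * t i)); lra.
Qed.

Lemma Lip_cos_ip {d} a (n : Zd d) : Lip (fun t => cos (a + 2 * PI * ip n t)).
Proof.
  apply (Lip_comp cos _ 1); [lra|apply cos_lip|].
  apply Lip_plus; [apply Lip_const|]. apply Lip_scal.
  apply (Lip_ext (fun t => lsum (fins d) (fun j => IZR (n j) * t j))).
  - intros; symmetry; apply ip_lsum.
  - apply Lip_lsum. intros. apply Lip_scal, Lip_coord.
Qed.

Lemma Lip_Fd d : Lip (Fd d).
Proof.
  apply (Lip_ext (fun t => lsum (fins d) (fun i => 2 - 2 * cos (2 * PI * t i)))).
  - intros; symmetry; apply Fd_lsum.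
  - apply Lip_lsum. intros i. apply Lip_minus; [apply Lip_const|]. apply Lip_scal.
    apply (Lip_comp cos _ 1); [lra|apply cos_lip|]. apply Lip_scal, Lip_coord.
Qed.

(** * The truncated reciprocal *)

Lemma tinv_Rmax M x : 0 < M -> tinv M x = / Rmax x (/ M).
Proof.
  intros HM. unfold tinv, Rmax. destruct (Rle_dec x (/ M)); auto. now rewrite Rinv_inv.
Qed.

Lemma tinv_pos M x : 0 < M -> 0 < tinv M x.
Proof.
  intros HM. rewrite tinv_Rmax by auto. apply Rinv_0_lt_compat.
  eapply Rlt_le_trans; [apply Rinv_0_lt_compat, HM|apply Rmax_r].
Qed.

Lemma tinv_anti M x y : 0 < M -> x <= y -> tinv M y <= tinv M x.
Proof.
  intros HM H. rewrite !tinv_Rmax by auto. apply Rinv_le_contravar.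
  - eapply Rlt_le_trans; [apply Rinv_0_lt_compat, HM|apply Rmax_r].
  - now apply Rle_max_compat_r.
Qed.

Lemma tinv_le M x : 0 < M -> tinv M x <= M.
Proof.
  intros HM. rewrite tinv_Rmax by auto. rewrite <- (Rinv_inv M) at 2.
  apply Rinv_le_contravar; [now apply Rinv_0_lt_compat|apply Rmax_r].
Qed.

Lemma tinv_grow M N x : 0 < M <= N -> tinv M x <= tinv N x.
Proof.
  intros [HM HN]. rewrite !tinv_Rmax by lra. apply Rinv_le_contravar.
  - eapply Rlt_le_trans; [apply Rinv_0_lt_compat, (Rlt_le_trans _ _ _ HM HN)|apply Rmax_r].
  - apply Rle_max_compat_l. apply Rinv_le_contravar; lra.
Qed.

Lemma mult_tinv_le M x : 0 < M -> 0 <= x -> 0 <= x * tinv M x <= 1.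
Proof.
  intros HM Hx. split; [apply Rmult_le_pos; auto; left; now apply tinv_pos|].
  rewrite tinv_Rmax by auto. assert (H : 0 < Rmax x (/ M)).
  { eapply Rlt_le_trans; [apply Rinv_0_lt_compat, HM|apply Rmax_r]. }
  apply Rmult_le_reg_r with (Rmax x (/ M)); auto.
  rewrite Rmult_assoc, Rinv_l, Rmult_1_l, Rmult_1_r by lra. apply Rmax_l.
Qed.

Lemma tinv_lip M x y : 0 < M -> Rabs (tinv M x - tinv M y) <= M * M * Rabs (x - y).
Proof.
  intros HM.
  assert (H : forall x y, x <= y -> tinv M x - tinv M y <= M * M * (y - x)).
  { clear x y. intros x y Hxy. rewrite !tinv_Rmax by auto.
    assert (H0 : 0 < / M) by now apply Rinv_0_lt_compat.
    assert (Hx := Rmax_r x (/ M)). assert (Hy := Rmax_r y (/ M)).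
    assert (Hd : 0 <= Rmax y (/ M) - Rmax x (/ M) <= y - x).
    { unfold Rmax. destruct (Rle_dec x (/ M)), (Rle_dec y (/ M)); lra. }
    set (u := Rmax x (/ M)) in *. set (v := Rmax y (/ M)) in *.
    replace (/ u - / v) with ((/ u * / v) * (v - u)) by (field; lra).
    assert (forall w, / M <= w -> 0 < / w <= M).
    { intros w Hw. split; [apply Rinv_0_lt_compat; lra|].
      rewrite <- (Rinv_inv M). now apply Rinv_le_contravar. }
    apply Rmult_le_compat; try lra.
    - apply Rmult_le_pos; left; apply H; auto.
    - apply Rmult_le_compat; try apply H; auto; left; apply H; auto. }
  destruct (Rle_dec x y) as [Hl|Hl].
  - rewrite (Rabs_pos_eq (tinv M x - tinv M y)), Rabs_left1; [|lra|].
    + replace (- (x - y)) with (y - x) by ring. auto.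
    + generalize (tinv_anti M x y HM Hl). lra.
  - rewrite Rabs_left1, (Rabs_pos_eq (x - y)); [|lra|].
    + replace (- (tinv M x - tinv M y)) with (tinv M y - tinv M x) by ring. apply H; lra.
    + assert (tinv M x <= tinv M y) by (apply tinv_anti; lra). lra.
Qed.

Lemma Lip_tinv d M : 0 < M -> Lip (fun t => tinv M (Fd d t)).
Proof.
  intros HM. apply (Lip_comp (tinv M) _ (M * M)); [apply Rmult_le_pos; lra| |apply Lip_Fd].
  intros. now apply tinv_lip.
Qed.

Lemma Lip_mult_tinv d M f B : 0 < M -> (forall t, Rabs (f t) <= B) -> Lip f ->
  Lip (fun t => f t * tinv M (Fd d t)).
Proof.
  intros HM HB Hf. apply (Lip_mult f _ B M); auto using Lip_tinv.
  intros t. rewrite Rabs_pos_eq; [now apply tinv_le|left; now apply tinv_pos].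
Qed.

Lemma cos_abs x : Rabs (cos x) <= 1.
Proof. apply Rabs_le, COS_bound. Qed.

(** ** Orthogonality of characters *)

Lemma sin_2PI_Z a k : sin (a + 2 * PI * IZR k) = sin a.
Proof.
  destruct (Z_le_gt_dec 0 k) as [H|H].
  - rewrite <- (Z2Nat.id k) by auto. rewrite <- INR_IZR_INZ.
    rewrite <- (sin_period a (Z.to_nat k)). f_equal. ring.
  - rewrite <- (sin_period (a + 2 * PI * IZR k) (Z.to_nat (- k))). f_equal.
    rewrite INR_IZR_INZ, Z2Nat.id, opp_IZR by lia. ring.
Qed.

Lemma is_RInt_cos_Z a k :
  is_RInt (fun t => cos (a + 2 * PI * IZR k * t)) 0 1 (if Z.eq_dec k 0 then cos a else 0).
Proof.
  destruct (Z.eq_dec k 0) as [->|Hk].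
  - apply (is_RInt_ext (fun _ => cos a)).
    + intros x _. f_equal. ring.
    + assert (H := is_RInt_const (V := R_NormedModule) 0 1 (cos a)).
      assert (E : scal (1 - 0) (cos a) = cos a) by (change ((1 - 0) * cos a = cos a); ring).
      exact (eq_rect _ (fun l : R => is_RInt (fun _ => cos a) 0 1 l) H _ E).
  - assert (Hk' : 2 * PI * IZR k <> 0).
    { apply Rmult_integral_contrapositive. split; [generalize PI_RGT_0; lra|].
      now apply not_0_IZR. }
    set (c := 2 * PI * IZR k) in *.
    assert (H : is_RInt (fun t => cos (a + c * t)) 0 1
      (minus ((fun t => sin (a + c * t) / c) 1) ((fun t => sin (a + c * t) / c) 0))).
    { apply (is_RInt_derive (V := R_CompleteNormedModule) (fun t => sin (a + c * t) / c)).
      - intros x _. auto_derive; auto. field; auto.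
      - intros x _. apply (ex_derive_continuous (V := R_NormedModule)). auto_derive; auto. }
    assert (E : minus (sin (a + c * 1) / c) (sin (a + c * 0) / c) = 0).
    { change (sin (a + c * 1) / c - sin (a + c * 0) / c = 0).
      rewrite Rmult_1_r, Rmult_0_r, Rplus_0_r. unfold c. rewrite sin_2PI_Z. ring. }
    exact (eq_rect _ (fun l : R => is_RInt (fun t => cos (a + c * t)) 0 1 l) H _ E).
Qed.

Lemma IInt_cos d : forall a (n : Zd d),
  IInt d (fun t => cos (a + 2 * PI * ip n t))
    (if excluded_middle_informative (n = zzero) then cos a else 0).
Proof.
  induction d as [|d IH]; intros a n.
  - destruct excluded_middle_informative as [_|H].
    + simpl. f_equal. unfold ip; simpl; ring.
    + destruct H. apply functional_extensionality; intros i; inversion i.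
  - apply IInt_S.
    set (n' := fun i => n (Fin.FS i)).
    exists (fun t => if excluded_middle_informative (n' = zzero)
              then cos (a + 2 * PI * IZR (n Fin.F1) * t) else 0).
    split.
    + intros t _. eapply IInt_ext; [|apply (IH (a + 2 * PI * IZR (n Fin.F1) * t) n')].
      intros s. simpl. f_equal. unfold ip. simpl. unfold n'. ring.
    + destruct (excluded_middle_informative (n' = zzero)) as [H|H].
      * assert (H1 := is_RInt_cos_Z a (n Fin.F1)).
        destruct (Z.eq_dec (n Fin.F1) 0) as [E|E], (excluded_middle_informative (n = zzero)) as [E'|E']; auto.
        -- destruct E'. rewrite <- (vcons_eta n). fold n'. rewrite H, E.
           apply functional_extensionality; intros i. pattern i; apply Fin.caseS'; reflexivity.
        -- subst n. destruct E. reflexivity.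
      * destruct (excluded_middle_informative (n = zzero)) as [E'|E'].
        -- destruct H. subst n. reflexivity.
        -- assert (H1 := is_RInt_const (V := R_NormedModule) 0 1 0).
           assert (E : scal (1 - 0) 0 = 0) by (change ((1 - 0) * 0 = 0); ring).
           exact (eq_rect _ (fun l : R => is_RInt (fun _ => 0) 0 1 l) H1 _ E).
Qed.

(** ** Estimates near the zero of [Fd] *)

(** Up to a factor 2, [1 - cos] is subadditive, so the bound for a unit vector propagates along a
    lattice path from 0 to [n]. Hence [1 - cos] times the truncated reciprocal of [F] is bounded
    uniformly in the truncation, in every dimension. *)
Lemma one_minus_cos_le {d} (n : Zd d) :
  exists C, 0 <= C /\ forall t, 1 - cos (2 * PI * ip n t) <= C * Fd d t.
Proof.
  assert (Hc : forall x y, 1 - cos (x + y) <= 2 * (1 - cos x) + 2 * (1 - cos y)).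
  { intros x y. replace (x + y) with (2 * ((x + y) / 2)) by field.
    replace x with (2 * (x / 2)) at 2 by field. replace y with (2 * (y / 2)) at 2 by field.
    rewrite !cos_2a_sin. replace ((x + y) / 2) with (x / 2 + y / 2) by field.
    rewrite sin_plus. generalize (sin2_cos2 (x / 2)) (sin2_cos2 (y / 2)). unfold Rsqr.
    set (a := sin (x / 2)). set (b := cos (x / 2)). set (c := sin (y / 2)). set (e := cos (y / 2)).
    intros H1 H2.
    assert (0 <= (a * e - b * c) * (a * e - b * c)) by apply Rle_0_sqr.
    assert (a * a * (e * e) <= a * a * 1) by (apply Rmult_le_compat_l; nra).
    assert (c * c * (b * b) <= c * c * 1) by (apply Rmult_le_compat_l; nra).
    nra. }
  apply (zd_ind (fun n => exists C, 0 <= C /\ forall t, 1 - cos (2 * PI * ip n t) <= C * Fd d t)).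
  - exists 0. split; [lra|]. intros t. rewrite ip_zzero, Rmult_0_r, cos_0. lra.
  - intros m i. split; intros [C [HC H]]; exists (2 * C + 1); (split; [lra|]); intros t;
      specialize (H t); generalize (Fd_term d t i); intros Hi.
    + rewrite ip_zadd, ip_zunit, Rmult_plus_distr_l.
      eapply Rle_trans; [apply Hc|]. lra.
    + rewrite ip_zadd, ip_zunit, Rmult_plus_distr_l in H.
      replace (2 * PI * ip m t) with ((2 * PI * ip m t + 2 * PI * t i) + - (2 * PI * t i)) by ring.
      eapply Rle_trans; [apply Hc|]. rewrite cos_neg. lra.
Qed.

(** The left side is compared with [4 sin^2 x], where [x = PI * t <= 2]. The cubic Taylor bound
    gives [sin x >= x - x^3/6 >= x/3 >= t], since [PI >= 3]. *)
Lemma two_minus_cos_lower t : 0 <= t <= 1 / 2 -> 4 * t ^ 2 <= 2 - 2 * cos (2 * PI * t).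
Proof.
  intros Ht. replace (2 * PI * t) with (2 * (PI * t)) by ring. rewrite cos_2a_sin.
  generalize PI2_3_2 PI_4. intros H3 H4.
  assert (Hs : PI * t - (PI * t) ^ 3 / 6 <= sin (PI * t)).
  { destruct (sin_bound (PI * t) 0) as [H _]; try nra.
    unfold sin_approx, sin_term in H. simpl in H. lra. }
  assert (0 <= PI * t <= 2) by nra.
  assert (t <= sin (PI * t)).
  { set (x := PI * t) in *. assert (x ^ 3 <= 4 * x) by (simpl; nra).
    assert (3 * t <= x) by (unfold x; nra). lra. }
  nra.
Qed.

Lemma two_minus_cos_lower' t : 1 / 2 <= t <= 1 -> 4 * (1 - t) ^ 2 <= 2 - 2 * cos (2 * PI * t).
Proof.
  intros Ht. replace (cos (2 * PI * t)) with (cos (2 * PI * (1 - t))).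
  - apply two_minus_cos_lower; lra.
  - replace (2 * PI * (1 - t)) with (- (2 * PI * t) + 2 * INR 1 * PI) by (simpl; ring).
    now rewrite cos_period, cos_neg.
Qed.

(** A nonnegative function of the distance from [t] to the nearest integer is dominated by the sum
    of its values at the distances to both ends. That sum has an explicit antiderivative on the
    whole interval, and the shift [a] keeps the singularity of [h] outside. *)
Lemma is_RInt_pair (h H : R -> R) a : 0 < a ->
  (forall x, 0 < x -> is_derive H x (h x)) -> (forall x, 0 < x -> continuous h x) ->
  is_RInt (fun t => h (t + a) + h (1 - t + a)) 0 1 (2 * (H (1 + a) - H a)).
Proof.
  intros Ha HD HC.
  assert (H1 : is_RInt (fun t => h (t + a) + h (1 - t + a)) 0 1
    (minus ((fun t => H (t + a) - H (1 - t + a)) 1) ((fun t => H (t + a) - H (1 - t + a)) 0))).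
  { apply (is_RInt_derive (V := R_CompleteNormedModule) (fun t => H (t + a) - H (1 - t + a))).
    - intros x Hx. rewrite Rmin_left, Rmax_right in Hx by lra.
      replace (h (x + a) + h (1 - x + a)) with (1 * h (x + a) - (-1) * h (1 - x + a)) by ring.
      apply (is_derive_minus (V := R_NormedModule) (fun t => H (t + a)) (fun t => H (1 - t + a))).
      + apply (is_derive_comp H (fun t => t + a)); [apply HD; lra|auto_derive; auto; ring].
      + apply (is_derive_comp H (fun t => 1 - t + a)); [apply HD; lra|auto_derive; auto; ring].
    - intros x Hx. rewrite Rmin_left, Rmax_right in Hx by lra.
      apply (continuous_plus (V := R_NormedModule) (fun t => h (t + a)) (fun t => h (1 - t + a))).
      + apply (continuous_comp (fun t => t + a) h); [|apply HC; lra].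
        apply (ex_derive_continuous (V := R_NormedModule)); auto_derive; auto.
      + apply (continuous_comp (fun t => 1 - t + a) h); [|apply HC; lra].
        apply (ex_derive_continuous (V := R_NormedModule)); auto_derive; auto. }
  assert (E : minus (H (1 + a) - H (1 - 1 + a)) (H (0 + a) - H (1 - 0 + a)) = 2 * (H (1 + a) - H a)).
  { change (H (1 + a) - H (1 - 1 + a) - (H (0 + a) - H (1 - 0 + a)) = 2 * (H (1 + a) - H a)).
    rewrite Rplus_0_l. replace (1 - 1 + a) with a by ring. replace (1 - 0 + a) with (1 + a) by ring. ring. }
  exact (eq_rect _ (fun l : R => is_RInt (fun t => h (t + a) + h (1 - t + a)) 0 1 l) H1 _ E).
Qed.

Definition near0 (t : R) : R := if Rle_dec t (1 / 2) then t else 1 - t.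

Lemma near0_bound t : 0 <= t <= 1 -> 0 <= near0 t <= 1 /\ 4 * near0 t ^ 2 <= 2 - 2 * cos (2 * PI * t).
Proof.
  intros Ht. unfold near0. destruct (Rle_dec t (1 / 2)).
  - split; [lra|]. apply two_minus_cos_lower; lra.
  - split; [lra|]. apply two_minus_cos_lower'; lra.
Qed.

Lemma near0_le (h : R -> R) a t : (forall x, 0 < x -> 0 <= h x) -> 0 < a -> 0 <= t <= 1 ->
  h (near0 t + a) <= h (t + a) + h (1 - t + a).
Proof.
  intros Hh Ha Ht. unfold near0.
  assert (0 <= h (t + a)) by (apply Hh; lra). assert (0 <= h (1 - t + a)) by (apply Hh; lra).
  destruct (Rle_dec t (1 / 2)); lra.
Qed.

Definition cbrt_inv2 (x : R) : R := Rpower x (- (2 / 3)).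

Lemma cbrt_inv2_pos x : 0 < cbrt_inv2 x.
Proof. apply exp_pos. Qed.

(** With at least three variables, this dominates [1/F] by a product of integrable functions of one
    variable. *)
Lemma amgm_inv x y z : 0 < x -> 0 < y -> 0 < z ->
  / (x ^ 2 + y ^ 2 + z ^ 2) <= cbrt_inv2 x * (cbrt_inv2 y * cbrt_inv2 z).
Proof.
  intros Hx Hy Hz.
  assert (Hp : forall x, 0 < x -> x ^ 2 = Rpower x (2 / 3) ^ 3).
  { intros w Hw. rewrite <- (Rpower_pow 2 w), <- Rpower_pow, Rpower_mult by (auto; apply exp_pos).
    f_equal. simpl; field. }
  unfold cbrt_inv2. rewrite !Rpower_Ropp, !Hp by auto.
  assert (Px : 0 < Rpower x (2 / 3)) by apply exp_pos.
  assert (Py : 0 < Rpower y (2 / 3)) by apply exp_pos.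
  assert (Pz : 0 < Rpower z (2 / 3)) by apply exp_pos.
  set (u := Rpower x (2 / 3)) in *. set (v := Rpower y (2 / 3)) in *. set (w := Rpower z (2 / 3)) in *.
  rewrite <- !Rinv_mult. apply Rinv_le_contravar.
  - repeat apply Rmult_lt_0_compat; auto.
  - assert (H : u ^ 3 + v ^ 3 + w ^ 3 - 3 * (u * (v * w)) =
      (u + v + w) * ((u - v) ^ 2 + (v - w) ^ 2 + (w - u) ^ 2) / 2) by field.
    assert (0 <= (u + v + w) * ((u - v) ^ 2 + (v - w) ^ 2 + (w - u) ^ 2) / 2).
    { apply Rmult_le_pos; [|lra]. apply Rmult_le_pos; [lra|].
      generalize (pow2_ge_0 (u - v)) (pow2_ge_0 (v - w)) (pow2_ge_0 (w - u)); lra. }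
    assert (0 < u * (v * w)) by (repeat apply Rmult_lt_0_compat; auto). lra.
Qed.

(** The antiderivative of [x^(-2/3)] is [3 x^(1/3)]; the bound [12 = 2 * 3 * 2] is uniform in the
    shift because [(1 + a)^(1/3) <= 1 + a <= 2]. *)
Lemma cbrt_inv2_RInt a : 0 < a <= 1 -> exists l,
  is_RInt (fun t => cbrt_inv2 (t + a) + cbrt_inv2 (1 - t + a)) 0 1 l /\ 0 <= l <= 12.
Proof.
  intros Ha. exists (2 * (3 * Rpower (1 + a) (1 / 3) - 3 * Rpower a (1 / 3))). split.
  - apply (is_RInt_pair cbrt_inv2 (fun x => 3 * Rpower x (1 / 3))); [lra| |].
    + intros x Hx. unfold Rpower, cbrt_inv2. auto_derive; auto.
      replace (exp (1 / 3 * ln x) ) with (Rpower x (-(2/3)) * x).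
      * field. lra.
      * rewrite <- (Rpower_1 x) at 2 by auto. rewrite <- Rpower_plus. unfold Rpower. f_equal. field.
    + intros x Hx. unfold cbrt_inv2, Rpower.
      apply (ex_derive_continuous (V := R_NormedModule)). auto_derive; auto.
  - assert (Rpower a (1 / 3) <= Rpower (1 + a) (1 / 3)) by (apply Rle_Rpower_l; lra).
    assert (0 < Rpower a (1 / 3)) by apply exp_pos.
    assert (Rpower (1 + a) (1 / 3) <= Rpower (1 + a) 1) by (apply Rle_Rpower; lra).
    rewrite (Rpower_1 (1 + a)) in * by lra. lra.
Qed.

Lemma tinv_bound d M t : 1 <= M -> cube t ->
  tinv M (Fd (S (S (S d))) t) <=
  7 * ((cbrt_inv2 (t Fin.F1 + / sqrt M) + cbrt_inv2 (1 - t Fin.F1 + / sqrt M)) *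
   ((cbrt_inv2 (t (Fin.FS Fin.F1) + / sqrt M) + cbrt_inv2 (1 - t (Fin.FS Fin.F1) + / sqrt M)) *
    (cbrt_inv2 (t (Fin.FS (Fin.FS Fin.F1)) + / sqrt M)
     + cbrt_inv2 (1 - t (Fin.FS (Fin.FS Fin.F1)) + / sqrt M)))).
Proof.
  intros HM Ht.
  set (a := / sqrt M).
  assert (HsM : 0 < sqrt M) by (apply sqrt_lt_R0; lra).
  assert (Ha : 0 < a) by now apply Rinv_0_lt_compat.
  assert (Ha2 : a ^ 2 = / M).
  { unfold a. rewrite pow_inv. f_equal. simpl. rewrite Rmult_1_r. apply sqrt_sqrt; lra. }
  set (t1 := t Fin.F1). set (t2 := t (Fin.FS Fin.F1)). set (t3 := t (Fin.FS (Fin.FS Fin.F1))).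
  assert (H1 : 0 <= t1 <= 1) by apply Ht. assert (H2 : 0 <= t2 <= 1) by apply Ht.
  assert (H3 : 0 <= t3 <= 1) by apply Ht.
  destruct (near0_bound t1 H1) as [N1 B1], (near0_bound t2 H2) as [N2 B2], (near0_bound t3 H3) as [N3 B3].
  set (s := (near0 t1 + a) ^ 2 + (near0 t2 + a) ^ 2 + (near0 t3 + a) ^ 2).
  apply Rle_trans with (7 * / s).
  - rewrite tinv_Rmax by lra.
    assert (Hs : 0 < s).
    { unfold s. generalize (pow2_ge_0 (near0 t2 + a)) (pow2_ge_0 (near0 t3 + a)).
      assert (0 < (near0 t1 + a) ^ 2) by (apply pow_lt; lra). lra. }
    (* As [(x + a)^2 <= 2 x^2 + 2 a^2] in each of the three coordinates and [a^2 = 1/M],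
       [s <= F/2 + 6/M], which is below 7 times the maximum. *)
    assert (HF : s <= 7 * Rmax (Fd (S (S (S d))) t) (/ M)).
    { assert (HF : 4 * near0 t1 ^ 2 + 4 * near0 t2 ^ 2 + 4 * near0 t3 ^ 2 <= Fd (S (S (S d))) t).
      { rewrite Fd_lsum. simpl fins. simpl lsum. fold t1 t2 t3. rewrite !lsum_map.
        match goal with |- _ <= _ + (_ + (_ + ?r)) => assert (0 <= r) end.
        { apply lsum_nonneg. intros i _.
          match goal with |- 0 <= 2 - 2 * cos ?x => generalize (COS_bound x); lra end. }
        lra. }
      generalize (Rmax_l (Fd (S (S (S d))) t) (/ M)) (Rmax_r (Fd (S (S (S d))) t) (/ M)).
      rewrite <- Ha2. unfold s.
      generalize (pow2_ge_0 (near0 t1 - a)) (pow2_ge_0 (near0 t2 - a)) (pow2_ge_0 (near0 t3 - a)).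
      generalize (pow2_ge_0 (near0 t1)) (pow2_ge_0 (near0 t2)) (pow2_ge_0 (near0 t3)).
      generalize (pow2_ge_0 a). nra. }
    assert (0 < Rmax (Fd (S (S (S d))) t) (/ M)).
    { eapply Rlt_le_trans; [|apply Rmax_r]. apply Rinv_0_lt_compat; lra. }
    replace (7 * / s) with (/ (s / 7)) by (field; lra).
    apply Rinv_le_contravar; lra.
  - apply Rmult_le_compat_l; [lra|].
    eapply Rle_trans; [apply amgm_inv; lra|].
    assert (P : forall x, 0 < x -> 0 <= cbrt_inv2 x) by (intros; left; apply cbrt_inv2_pos).
    assert (Q : forall x, 0 <= cbrt_inv2 x) by (intros; left; apply cbrt_inv2_pos).
    apply Rmult_le_compat; auto; [apply Rmult_le_pos; auto|apply near0_le; auto|].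
    apply Rmult_le_compat; auto; apply near0_le; auto.
Qed.

Lemma tinv_IInt_bounded d M l : (3 <= d)%nat -> 1 <= M ->
  IInt d (fun t => tinv M (Fd d t)) l -> l <= 7 * 12 ^ 3.
Proof.
  intros Hd HM Hl. destruct d as [|[|[|d]]]; try lia.
  assert (Ha : 0 < / sqrt M <= 1).
  { split; [apply Rinv_0_lt_compat, sqrt_lt_R0; lra|].
    rewrite <- Rinv_1. apply Rinv_le_contravar; [lra|]. rewrite <- sqrt_1. apply sqrt_le_1_alt, HM. }
  destruct (cbrt_inv2_RInt _ Ha) as [c [Hc Bc]].
  assert (H := IInt_mono _ _ _ _ _ Hl
    (IInt_scal _ _ 7 _ (IInt_prod_cons _ _ _ _ _ Hc (IInt_prod_cons _ _ _ _ _ Hc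
       (IInt_prod_cons _ _ _ _ _ Hc (IInt_const d 1)))))).
  eapply Rle_trans; [apply H|].
  - intros t Ht. rewrite Rmult_1_r. now apply tinv_bound.
  - rewrite Rmult_1_r. apply Rmult_le_compat_l; [lra|].
    replace (12 ^ 3) with (12 * (12 * 12)) by ring.
    apply Rmult_le_compat; try lra; [apply Rmult_le_pos; lra|]. apply Rmult_le_compat; lra.
Qed.

(** The integrand vanishes where [F > 1/M] and is at most 1 elsewhere, and there the first
    coordinate lies within [a = 1/sqrt M] of an integer. With [x] this distance,
    [h (x + a) = 4 a^2 / (x + a)^2] is at least 1 for [x <= a], and its integral is of order [a]. *)
Lemma defect_bound d M l : 1 <= M ->
  IInt (S d) (fun t => 1 - Fd (S d) t * tinv M (Fd (S d) t)) l -> l <= 8 * / sqrt M.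
Proof.
  intros HM Hl.
  set (a := / sqrt M).
  assert (HsM : 0 < sqrt M) by (apply sqrt_lt_R0; lra).
  assert (Ha : 0 < a) by now apply Rinv_0_lt_compat.
  assert (Ha2 : a ^ 2 = / M).
  { unfold a. rewrite pow_inv. f_equal. simpl. rewrite Rmult_1_r. apply sqrt_sqrt; lra. }
  set (h := fun x => 4 * a ^ 2 / x ^ 2).
  assert (Hh : is_RInt (fun t => h (t + a) + h (1 - t + a)) 0 1
    (2 * ((- (4 * a ^ 2 / (1 + a))) - (- (4 * a ^ 2 / a))))).
  { apply (is_RInt_pair h (fun x => - (4 * a ^ 2 / x))); auto.
    - intros x Hx. unfold h. auto_derive; [lra|]. field. lra.
    - intros x Hx. apply (ex_derive_continuous (V := R_NormedModule)). unfold h. auto_derive.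
      assert (0 < x * (x * 1)) by nra. lra. }
  assert (Hpos : forall x, 0 < x -> 0 <= h x).
  { intros x Hx. unfold h. apply Rmult_le_pos; [generalize (pow2_ge_0 a); lra|].
    left. apply Rinv_0_lt_compat, pow_lt, Hx. }
  apply Rle_trans with (2 * ((- (4 * a ^ 2 / (1 + a))) - (- (4 * a ^ 2 / a))) * 1).
  - apply (IInt_mono (S d) _ _ _ _ Hl (IInt_prod_cons _ _ _ _ _ Hh (IInt_const d 1))).
    intros t Ht. rewrite Rmult_1_r. set (t1 := t Fin.F1).
    assert (H1 : 0 <= t1 <= 1) by apply Ht.
    destruct (near0_bound t1 H1) as [N1 B1].
    eapply Rle_trans; [|apply near0_le; auto].
    destruct (Rle_dec (Fd (S d) t) (/ M)) as [Hle|Hgt].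
    + assert (0 <= Fd (S d) t * tinv M (Fd (S d) t)) by (apply mult_tinv_le; [lra|apply Fd_nonneg]).
      assert (1 <= h (near0 t1 + a)); [|lra].
      assert (HF := proj2 (Fd_term (S d) t Fin.F1)). fold t1 in HF.
      assert (Hn : near0 t1 <= a) by nra.
      unfold h. apply Rmult_le_reg_r with ((near0 t1 + a) ^ 2); [apply pow_lt; lra|].
      unfold Rdiv. rewrite Rmult_assoc, Rinv_l by (apply pow_nonzero; lra). nra.
    + unfold tinv. destruct (Rle_dec (Fd (S d) t) (/ M)); [lra|].
      assert (0 < / M) by (apply Rinv_0_lt_compat; lra).
      rewrite Rinv_r by lra. rewrite Rminus_diag. apply Hpos. lra.
  - replace (2 * ((- (4 * a ^ 2 / (1 + a))) - (- (4 * a ^ 2 / a))) * 1) with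
      (8 * a - 8 * a ^ 2 / (1 + a)) by (field; lra).
    assert (0 <= 8 * a ^ 2 / (1 + a)).
    { apply Rmult_le_pos; [generalize (pow2_ge_0 a); lra|]. left. apply Rinv_0_lt_compat; lra. }
    lra.
Qed.

Lemma INR_S_ge_1 M : 1 <= INR (S M).
Proof. rewrite S_INR. generalize (pos_INR M). lra. Qed.

Lemma sqrt_S_inv_cv : Un_cv (fun M => / sqrt (INR (S M))) 0.
Proof.
  intros eps He. destruct (INR_unbounded (/ (eps * eps))) as [N HN].
  assert (He2 : 0 < / (eps * eps)) by (apply Rinv_0_lt_compat; nra).
  exists N. intros n Hn. unfold Rdist. rewrite Rminus_0_r, Rabs_pos_eq.
  - rewrite <- (Rinv_inv eps). apply Rinv_lt_contravar.
    + apply Rmult_lt_0_compat; [now apply Rinv_0_lt_compat|].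
      apply sqrt_lt_R0. generalize (INR_S_ge_1 n). lra.
    + rewrite <- (sqrt_Rsqr (/ eps)) by (left; now apply Rinv_0_lt_compat).
      apply sqrt_lt_1_alt. unfold Rsqr. rewrite <- Rinv_mult. split; [lra|].
      apply le_INR in Hn. rewrite S_INR. lra.
  - left. apply Rinv_0_lt_compat, sqrt_lt_R0. generalize (INR_S_ge_1 n). lra.
Qed.

(** ** The Green function *)

Lemma growing_IInt d (h : Rd d -> R) B C :
  (forall t, 0 <= h t <= C) -> Lip h ->
  (forall M l, IInt d (fun t => h t * tinv (INR (S M)) (Fd d t)) l -> l <= B) ->
  exists I : nat -> R, (forall M, IInt d (fun t => h t * tinv (INR (S M)) (Fd d t)) (I M)) /\
    exists w, Un_cv I w.
Proof.
  intros Hh HL HB.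
  assert (He : forall M, exists l, IInt d (fun t => h t * tinv (INR (S M)) (Fd d t)) l).
  { intros M. apply Lip_IInt. apply (Lip_mult_tinv _ _ _ C); auto.
    - generalize (INR_S_ge_1 M); lra.
    - intros t. rewrite Rabs_pos_eq; apply Hh. }
  destruct (choice _ He) as [I HI]. exists I. split; auto.
  destruct (growing_cv I) as [w Hw]; [| |now exists w].
  - intros M. apply (IInt_mono _ _ _ _ _ (HI M) (HI (S M))). intros t _.
    apply Rmult_le_compat_l; [apply Hh|]. apply tinv_grow.
    rewrite (S_INR (S M)). generalize (INR_S_ge_1 M); lra.
  - exists B. intros x [M ->]. eapply HB, HI.
Qed.

Lemma numer_eq d n t : numer d n t = cos (0 + 2 * PI * ip n t) - (if Nat.eqb d 2 then 1 else 0).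
Proof. unfold numer. rewrite Rplus_0_l. destruct Nat.eqb; ring. Qed.

(** Truncated integrals of a nonnegative numerator increase with the truncation level, so bounds
    suffice. The numerator [1 - cos] is controlled in all dimensions and is, up to sign, the whole
    numerator for [d = 2]; for [d >= 3] the numerator is [1 - (1 - cos)], and the integral with
    numerator 1 is bounded too. *)
Lemma green_spec d (n : Zd d) : (2 <= d)%nat -> green_rel d n (green d n).
Proof.
  intros Hd. unfold green. apply epsilon_spec.
  destruct (one_minus_cos_le n) as [C [HC HCn]].
  destruct (growing_IInt d (fun t => 1 - cos (0 + 2 * PI * ip n t)) C 2) as [A [HA [wA HwA]]].
  { intros t. generalize (COS_bound (0 + 2 * PI * ip n t)). lra. }
  { apply Lip_minus; [apply Lip_const|apply Lip_cos_ip]. }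
  { intros M l Hl. apply (IInt_mono _ _ _ _ _ Hl (IInt_const d C)). intros t _.
    assert (HM : 0 < INR (S M)) by (generalize (INR_S_ge_1 M); lra).
    apply Rle_trans with (C * Fd d t * tinv (INR (S M)) (Fd d t)).
    - apply Rmult_le_compat_r; [left; now apply tinv_pos|]. rewrite Rplus_0_l. apply HCn.
    - rewrite Rmult_assoc. rewrite <- (Rmult_1_r C) at 2. apply Rmult_le_compat_l; auto.
      apply mult_tinv_le; auto. apply Fd_nonneg. }
  destruct (Nat.eq_dec d 2) as [E|E].
  - exists (- wA), (fun M => - A M). split.
    + intros M. replace (- A M) with (-1 * A M) by ring.
      eapply IInt_ext; [|apply (IInt_scal _ _ (-1) _ (HA M))].
      intros t. simpl. rewrite numer_eq. apply Nat.eqb_eq in E. rewrite E. ring.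
    + apply CV_opp, HwA.
  - destruct (growing_IInt d (fun _ => 1) (7 * 12 ^ 3) 1) as [B [HB [wB HwB]]].
    { intros; lra. } { apply Lip_const. }
    { intros M l Hl. apply (tinv_IInt_bounded d (INR (S M))); [lia|apply INR_S_ge_1|].
      eapply IInt_ext; [|apply Hl]. intros; simpl; ring. }
    exists (wB - wA), (fun M => B M - A M). split.
    + intros M. eapply IInt_ext; [|apply (IInt_minus _ _ _ _ _ (HB M) (HA M))].
      intros t. rewrite numer_eq. apply Nat.eqb_neq in E. rewrite E. ring.
    + apply CV_minus; auto.
Qed.

(** Both values are chosen by [epsilon], so it is the two predicates that must coincide; they do
    because the real numerator is even in [n]. *)
Lemma green_opp d n : green d (zopp n) = green d n.
Proof.
  unfold green. f_equal. apply functional_extensionality; intros w.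
  unfold green_rel. replace (numer d (zopp n)) with (numer d n); auto.
  apply functional_extensionality; intros t. rewrite !numer_eq, ip_zopp.
  replace (0 + 2 * PI * - ip n t) with (- (0 + 2 * PI * ip n t)) by ring. now rewrite cos_neg.
Qed.

Lemma Un_cv_lsum {A} (l : list A) (u : A -> nat -> R) (s : A -> R) :
  (forall x, In x l -> Un_cv (u x) (s x)) -> Un_cv (fun M => lsum l (fun x => u x M)) (lsum l s).
Proof.
  induction l as [|x l IH]; intros H; simpl.
  - apply Un_cv_const.
  - apply (CV_plus (u x)); [apply H; simpl; auto|apply IH; intros; apply H; simpl; auto].
Qed.

Lemma Un_cv_scal c u s : Un_cv u s -> Un_cv (fun n : nat => c * u n) (c * s).
Proof. intros H. apply (CV_mult (fun _ => c)); auto using Un_cv_const. Qed.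

(** Fourier inversion. Pairing [f.b = k] with a character says that the transform of [k] is [F]
    times that of [b]. After multiplication by the truncated reciprocal and integration, one side
    tends to [k.w], while on the other [F * tinv] tends to 1 and returns [b n]. Sums over a box
    stand in for the exchange of series and integral. *)
Lemma green_potential d (b : rseq d) (k : lpoly d) : (2 <= d)%nat ->
  l1 b -> (forall n, pconv (fpoly d) b n = IZR (lcoef k n)) ->
  forall n, pconv k (green d) n = b n.
Proof.
  intros Hd Hb Hf n.
  assert (HM0 : forall M, 0 < INR (S M)) by (intros M; generalize (INR_S_ge_1 M); lra).
  set (T := fun M (t : Rd d) => tinv (INR (S M)) (Fd d t)).
  assert (HT : forall M t, 0 <= Fd d t * T M t <= 1)
    by (intros; apply mult_tinv_le; auto using Fd_nonneg).
  assert (HT0 : forall M t, 0 <= T M t) by (intros; left; apply tinv_pos; auto).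
  (* Pairing with the constant 1, which [f] annihilates. This cancels the [- 1] in [numer] when
     [d = 2]. *)
  assert (Hk0 : lsum k (fun ce => IZR (fst ce) * 1) = 0).
  { assert (Hone : linf (fun _ : Zd d => 1)) by (exists 1; intros; rewrite Rabs_R1; lra).
    assert (H := series_by_parts (fpoly d) k b (fun _ => 1) zzero Hb Hone Hf).
    rewrite pconv_lsum in H. eapply series_unique; [apply H|].
    eapply series_ext; [|apply series_zero]. intros j. cbv beta.
    rewrite pconv_fpoly, lsum_fins_const. ring. }
  assert (HS : forall t, series_to (fun j => b j * (Fd d t * cos (0 + 2 * PI * ip (zsub n j) t)))
     (lsum k (fun ce => IZR (fst ce) * numer d (zsub n (snd ce)) t))).
  { intros t.
    assert (Hbd : linf (fun m : Zd d => cos (0 + 2 * PI * ip m t))) by (exists 1; intros; apply cos_abs).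
    assert (H := series_by_parts (fpoly d) k b _ n Hb Hbd Hf).
    rewrite pconv_lsum in H.
    replace (lsum k (fun ce => IZR (fst ce) * numer d (zsub n (snd ce)) t)) with
      (lsum k (fun ce => IZR (fst ce) * cos (0 + 2 * PI * ip (zsub n (snd ce)) t))).
    - eapply series_ext; [|apply H]. intros j. cbv beta. now rewrite pconv_fpoly_cos.
    - set (kap := if Nat.eqb d 2 then 1 else 0).
      replace (lsum k (fun ce => IZR (fst ce) * numer d (zsub n (snd ce)) t)) with
        (lsum k (fun ce => IZR (fst ce) * cos (0 + 2 * PI * ip (zsub n (snd ce)) t))
          - kap * lsum k (fun ce => IZR (fst ce) * 1)).
      + rewrite Hk0. ring.
      + rewrite <- lsum_scal, <- lsum_minus. apply lsum_ext. intros ce _.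
        rewrite numer_eq. fold kap. ring. }
  destruct (choice _ (fun m => green_spec d m Hd)) as [I HI].
  assert (HIK : forall M, IInt d (fun t => lsum k (fun ce => IZR (fst ce) * numer d (zsub n (snd ce)) t) * T M t)
     (lsum k (fun ce => IZR (fst ce) * I (zsub n (snd ce)) M))).
  { intros M. eapply IInt_ext; [|apply (IInt_lsum d k
       (fun ce t => IZR (fst ce) * (numer d (zsub n (snd ce)) t * T M t)))].
    - intros t. simpl. rewrite Rmult_comm, <- lsum_scal. apply lsum_ext. intros; ring.
    - intros ce _. apply IInt_scal, HI. }
  assert (HIcv : Un_cv (fun M => lsum k (fun ce => IZR (fst ce) * I (zsub n (snd ce)) M))
     (pconv k (green d) n)).
  { rewrite pconv_lsum. apply (Un_cv_lsum k (fun ce M => IZR (fst ce) * I (zsub n (snd ce)) M)).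
    intros ce _. apply Un_cv_scal, HI. }
  assert (HG : forall j M, exists l,
     IInt d (fun t => cos (0 + 2 * PI * ip (zsub n j) t) * (Fd d t * T M t)) l).
  { intros j M. apply Lip_IInt. apply (Lip_mult _ _ 1 1).
    - intros; apply cos_abs.
    - intros t. rewrite Rabs_pos_eq; apply HT.
    - apply Lip_cos_ip.
    - apply (Lip_mult_tinv d _ _ (4 * INR d)); auto using Lip_Fd.
      intros t. rewrite Rabs_pos_eq; [apply Fd_le|apply Fd_nonneg]. }
  destruct (choice (fun j G => forall M,
     IInt d (fun t => cos (0 + 2 * PI * ip (zsub n j) t) * (Fd d t * T M t)) (G M))) as [G HGs].
  { intros j. apply (choice _ (HG j)). }
  assert (Hdef : forall M, exists l, IInt d (fun t => 1 - Fd d t * T M t) l).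
  { intros M. apply Lip_IInt. apply Lip_minus; [apply Lip_const|].
    apply (Lip_mult_tinv d _ _ (4 * INR d)); auto using Lip_Fd.
    intros t. rewrite Rabs_pos_eq; [apply Fd_le|apply Fd_nonneg]. }
  destruct (choice _ Hdef) as [D HD].
  assert (HDb : forall M, D M <= 8 * / sqrt (INR (S M))).
  { intros M. destruct d as [|d]; [lia|]. eapply defect_bound; [apply INR_S_ge_1|apply HD]. }
  set (dl := fun j => if excluded_middle_informative (n = j) then 1 else 0).
  (* [G j M] is a Fourier coefficient of [F * tinv], and [dl j] the same coefficient of 1. Their
     distance is at most the integral of the defect [1 - F * tinv], uniformly in [j]. *)
  assert (HGd : forall j M, Rabs (dl j - G j M) <= D M).
  { intros j M. assert (Ho := IInt_cos d 0 (zsub n j)). rewrite cos_0 in Ho.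
    replace (if excluded_middle_informative (zsub n j = zzero) then 1 else 0) with (dl j) in Ho.
    - assert (Hm := IInt_minus _ _ _ _ _ Ho (HGs j M)). apply Rabs_le. split.
      + apply Ropp_le_cancel. rewrite Ropp_involutive.
        replace (- (dl j - G j M)) with (-1 * (dl j - G j M)) by ring.
        apply (IInt_mono _ _ _ _ _ (IInt_scal _ _ (-1) _ Hm) (HD M)). intros t _. simpl.
        generalize (HT M t) (COS_bound (0 + 2 * PI * ip (zsub n j) t)). nra.
      + apply (IInt_mono _ _ _ _ _ Hm (HD M)). intros t _. simpl.
        generalize (HT M t) (COS_bound (0 + 2 * PI * ip (zsub n j) t)). nra.
    - unfold dl. destruct (excluded_middle_informative (n = j)) as [E|E],
        (excluded_middle_informative (zsub n j = zzero)) as [E'|E']; auto.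
      + destruct E'. subst. zd.
      + destruct E. apply functional_extensionality; intros i.
        apply (f_equal (fun v => v i)) in E'. unfold zsub, zzero in E'. lia. }
  eapply UL_sequence; [apply HIcv|]. intros eps He.
  (* The box is fixed before the truncation level: the tail of [b] costs [eps / 4] at every level
     because [F * tinv <= 1]. The level is then chosen so that the defect on the box costs
     [eps / 2]. *)
  destruct (l1_tail b Hb (eps / 8)) as [N0 HN0]; [lra|].
  destruct (fin_bound d n) as [N1 HN1]. set (N := (N0 + N1)%nat).
  set (Bn := boxsum (fun j => Rabs (b j)) N).
  assert (HBn : 0 <= Bn) by (apply lsum_nonneg; intros; apply Rabs_pos).
  destruct (sqrt_S_inv_cv (eps / (16 * (Bn + 1)))) as [K HK].
  { apply Rdiv_lt_0_compat; lra. }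
  exists K. intros M HM. specialize (HK M HM). unfold Rdist in *.
  rewrite Rminus_0_r in HK. apply Rle_lt_trans with (r1 := / sqrt (INR (S M))) in HK; [|apply Rle_abs].
  set (SN := fun t => lsum (box d N) (fun j => b j * (cos (0 + 2 * PI * ip (zsub n j) t) * (Fd d t * T M t)))).
  assert (HISN : IInt d SN (lsum (box d N) (fun j => b j * G j M))).
  { apply (IInt_lsum d (box d N) (fun j t => b j * (cos (0 + 2 * PI * ip (zsub n j) t) * (Fd d t * T M t)))).
    intros j _. apply IInt_scal, HGs. }
  set (KT := fun t => lsum k (fun ce => IZR (fst ce) * numer d (zsub n (snd ce)) t) * T M t).
  assert (Hdiff : forall t, Rabs (KT t - SN t) <= eps / 4).
  { intros t.
    assert (Hn : Rabs (lsum k (fun ce => IZR (fst ce) * numer d (zsub n (snd ce)) t) -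
       boxsum (fun j => b j * (Fd d t * cos (0 + 2 * PI * ip (zsub n j) t))) N)
       <= 2 * (Fd d t * (eps / 8))).
    { eapply series_near with (N := N0); [|apply HS|unfold N; lia].
      intros l Nl Hl. eapply Rle_trans; [|apply Rmult_le_compat_l; [apply Fd_nonneg|apply (HN0 l Nl Hl)]].
      rewrite <- lsum_scal. apply lsum_le. intros j _.
      rewrite !Rabs_mult, (Rabs_pos_eq (Fd d t)) by apply Fd_nonneg.
      rewrite Rmult_comm, Rmult_assoc. apply Rmult_le_compat_l; [apply Fd_nonneg|].
      rewrite <- (Rmult_1_l (Rabs (b j))) at 2.
      apply Rmult_le_compat_r; [apply Rabs_pos|apply cos_abs]. }
    replace (KT t - SN t) with ((lsum k (fun ce => IZR (fst ce) * numer d (zsub n (snd ce)) t) -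
       boxsum (fun j => b j * (Fd d t * cos (0 + 2 * PI * ip (zsub n j) t))) N) * T M t).
    - rewrite Rabs_mult, (Rabs_pos_eq (T M t)) by auto.
      apply Rle_trans with (2 * (Fd d t * (eps / 8)) * T M t); [apply Rmult_le_compat_r; auto|].
      generalize (HT M t). nra.
    - rewrite boxsum_lsum. unfold KT, SN. rewrite Rmult_minus_distr_r. f_equal.
      rewrite Rmult_comm, <- lsum_scal. apply lsum_ext. intros; ring. }
  assert (H1 : Rabs (lsum k (fun ce => IZR (fst ce) * I (zsub n (snd ce)) M) -
       lsum (box d N) (fun j => b j * G j M)) <= eps / 4).
  { assert (Hm := IInt_minus _ _ _ _ _ (HIK M) HISN). apply Rabs_le. split.
    - apply (IInt_mono _ _ _ _ _ (IInt_const d (- (eps / 4))) Hm). intros t _.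
      generalize (Hdiff t). unfold KT, Rabs. destruct Rcase_abs; lra.
    - apply (IInt_mono _ _ _ _ _ Hm (IInt_const d (eps / 4))). intros t _.
      generalize (Hdiff t). unfold KT, Rabs. destruct Rcase_abs; lra. }
  assert (H2 : Rabs (b n - lsum (box d N) (fun j => b j * G j M)) <= eps / 2).
  { replace (b n) with (lsum (box d N) (fun j => b j * dl j)).
    - rewrite <- lsum_minus. eapply Rle_trans; [apply lsum_abs|].
      apply Rle_trans with (D M * Bn).
      + unfold Bn. rewrite boxsum_lsum, <- lsum_scal. apply lsum_le. intros j _.
        rewrite <- Rmult_minus_distr_l, Rabs_mult, Rmult_comm.
        apply Rmult_le_compat_r; [apply Rabs_pos|apply HGd].
      + apply Rle_trans with (8 * (eps / (16 * (Bn + 1))) * Bn).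
        * apply Rmult_le_compat_r; auto. specialize (HDb M). lra.
        * replace (8 * (eps / (16 * (Bn + 1))) * Bn) with (eps / 2 * (Bn / (Bn + 1))) by (field; lra).
          rewrite <- (Rmult_1_r (eps / 2)) at 2. apply Rmult_le_compat_l; [lra|].
          apply Rmult_le_reg_r with (Bn + 1); [lra|]. unfold Rdiv.
          rewrite Rmult_assoc, Rinv_l; lra.
    - rewrite <- (lsum_delta (box d N) n b); [|apply NoDup_box|].
      + apply lsum_ext. intros j _. unfold dl. destruct excluded_middle_informative; ring.
      + apply in_box. intros i. specialize (HN1 i). unfold N. lia. }
  revert H1 H2. unfold Rabs. repeat destruct Rcase_abs; lra.
Qed.

(** ** Operators given by real Laurent polynomials *)

Definition ap {d} (p : list (R * Zd d)) (x : rseq d) : rseq d :=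
  fun n => lsum p (fun ce => fst ce * x (zsub n (snd ce))).

(** Finite real combinations of translations commute, are linear, pass to pointwise limits and
    preserve periodicity and boundedness. Proving this once serves differences, walks, Laurent
    polynomials and all their compositions. *)
Definition shift_op {d} (T : rseq d -> rseq d) : Prop := exists p, forall x, T x = ap p x.

Ltac fe := apply functional_extensionality; let n := fresh "n" in intro n.

Lemma ap_comm {d} (p q : list (R * Zd d)) x : ap p (ap q x) = ap q (ap p x).
Proof.
  fe. unfold ap.
  rewrite (lsum_ext p _ (fun a => lsum q (fun b => fst a * fst b * x (zsub (zsub n (snd a)) (snd b))))).
  - rewrite lsum_exchange. apply lsum_ext. intros b _. rewrite <- lsum_scal. apply lsum_ext.
    intros a _. replace (zsub (zsub n (snd a)) (snd b)) with (zsub (zsub n (snd b)) (snd a)) by zd.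
    ring.
  - intros a _. rewrite <- lsum_scal. apply lsum_ext. intros; ring.
Qed.

Lemma shift_op_comm {d} (T S : rseq d -> rseq d) : shift_op T -> shift_op S -> forall x, T (S x) = S (T x).
Proof. intros [p Hp] [q Hq] x. rewrite !Hp, !Hq. apply ap_comm. Qed.

Lemma shift_op_plus {d} (T : rseq d -> rseq d) x y : shift_op T ->
  T (fun n => x n + y n) = fun n => T x n + T y n.
Proof.
  intros [p Hp]. rewrite !Hp. fe. unfold ap. rewrite <- lsum_plus. apply lsum_ext. intros; ring.
Qed.

Lemma shift_op_minus {d} (T : rseq d -> rseq d) x y : shift_op T ->
  T (fun n => x n - y n) = fun n => T x n - T y n.
Proof.
  intros [p Hp]. rewrite !Hp. fe. unfold ap. rewrite <- lsum_minus. apply lsum_ext. intros; ring.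
Qed.

Lemma shift_op_scal {d} (T : rseq d -> rseq d) c x : shift_op T ->
  T (fun n => c * x n) = fun n => c * T x n.
Proof.
  intros [p Hp]. rewrite !Hp. fe. unfold ap. rewrite <- lsum_scal. apply lsum_ext. intros; ring.
Qed.

Lemma shift_op_lim {d} (T : rseq d -> rseq d) (u : nat -> rseq d) x : shift_op T ->
  (forall n, Un_cv (fun N => u N n) (x n)) -> forall n, Un_cv (fun N => T (u N) n) (T x n).
Proof.
  intros [p Hp] H n. rewrite Hp.
  eapply Un_cv_ext; [intros N; rewrite Hp; reflexivity|].
  apply (Un_cv_lsum p (fun ce N => fst ce * u N (zsub n (snd ce)))).
  intros. now apply Un_cv_scal.
Qed.

Lemma shift_op_invariant {d} (G : Zd d -> Prop) (T : rseq d -> rseq d) x : shift_op T ->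
  invariant G x -> invariant G (T x).
Proof.
  intros [p Hp] H g n Hg. rewrite Hp. unfold ap. apply lsum_ext. intros ce _.
  replace (zsub (zadd n g) (snd ce)) with (zadd (zsub n (snd ce)) g) by zd. now rewrite H.
Qed.

Lemma shift_op_id {d} : shift_op (fun x : rseq d => x).
Proof.
  exists [(1, zzero)]. intros x. fe. unfold ap; simpl.
  replace (zsub n zzero) with n by zd. ring.
Qed.

Lemma shift_op_comp {d} (T S : rseq d -> rseq d) : shift_op T -> shift_op S -> shift_op (fun x => T (S x)).
Proof.
  intros [p Hp] [q Hq].
  exists (flat_map (fun a => map (fun b => (fst a * fst b, zadd (snd a) (snd b))) q) p).
  intros x. rewrite Hp, Hq. fe. unfold ap. rewrite lsum_flat_map. apply lsum_ext.
  intros a _. rewrite lsum_map, <- lsum_scal. apply lsum_ext. intros b _. simpl.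
  replace (zsub n (zadd (snd a) (snd b))) with (zsub (zsub n (snd a)) (snd b)) by zd. ring.
Qed.

Lemma shift_op_add {d} (T S : rseq d -> rseq d) : shift_op T -> shift_op S -> shift_op (fun x n => T x n + S x n).
Proof.
  intros [p Hp] [q Hq]. exists (p ++ q). intros x. fe. unfold ap.
  rewrite lsum_app, Hp, Hq. easy.
Qed.

Lemma shift_op_cmul {d} c (T : rseq d -> rseq d) : shift_op T -> shift_op (fun x n => c * T x n).
Proof.
  intros [p Hp]. exists (map (fun a => (c * fst a, snd a)) p). intros x. fe. unfold ap.
  rewrite lsum_map, Hp. unfold ap. rewrite <- lsum_scal. apply lsum_ext. intros; simpl; ring.
Qed.

Lemma shift_op_ext {d} (T S : rseq d -> rseq d) : (forall x n, T x n = S x n) -> shift_op T -> shift_op S.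
Proof.
  intros H [p Hp]. exists p. intros x. rewrite <- Hp. fe. auto.
Qed.

Lemma shift_op_sub {d} (T S : rseq d -> rseq d) : shift_op T -> shift_op S -> shift_op (fun x n => T x n - S x n).
Proof.
  intros HT HS. apply (shift_op_ext (fun x n => T x n + (-1) * S x n)); [intros; ring|].
  now apply shift_op_add, shift_op_cmul.
Qed.

Lemma shift_op_zero {d} : shift_op (fun (_ : rseq d) _ => 0).
Proof. now exists []. Qed.

Lemma shift_op_iter {d} (T : rseq d -> rseq d) k : shift_op T -> shift_op (Nat.iter k T).
Proof.
  intros HT. induction k; simpl; [apply shift_op_id|]. now apply (shift_op_comp T).
Qed.

Lemma shift_op_pconv {d} (p : lpoly d) : shift_op (pconv p).
Proof.
  exists (map (fun ce => (IZR (fst ce), snd ce)) p). intros x. fe. unfold ap.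
  now rewrite lsum_map, pconv_lsum.
Qed.

Lemma palpha_pstar {d} (p : lpoly d) x : palpha p x = pconv (pstar p) x.
Proof.
  fe. rewrite palpha_lsum, pconv_lsum. unfold pstar. rewrite lsum_map. apply lsum_ext.
  intros ce _. simpl. do 2 f_equal. zd.
Qed.

Lemma shift_op_palpha {d} (p : lpoly d) : shift_op (palpha p).
Proof.
  apply (shift_op_ext (pconv (pstar p))); [|apply shift_op_pconv]. intros. now rewrite palpha_pstar.
Qed.

Definition translate {d} (e : Zd d) (x : rseq d) : rseq d := fun n => x (zadd n e).
Definition dif {d} (i : Fin.t d) (x : rseq d) : rseq d := fun n => x (zadd n (zunit i)) - x n.

Lemma shift_op_translate {d} (e : Zd d) : shift_op (translate e).
Proof.
  exists [(1, zopp e)]. intros x. fe. unfold ap, translate; simpl.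
  replace (zsub n (zopp e)) with (zadd n e) by zd. ring.
Qed.

Lemma shift_op_dif {d} (i : Fin.t d) : shift_op (dif i).
Proof. apply (shift_op_sub (translate (zunit i)) (fun x => x)); auto using shift_op_translate, shift_op_id. Qed.

(** ** The lazy random walk *)

Definition walk {d} (x : rseq d) : rseq d := fun n => x n - / (4 * INR d) * pconv (fpoly d) x n.

Definition sup_le {d} (x : rseq d) (B : R) : Prop := forall n, Rabs (x n) <= B.

Lemma shift_op_walk {d} : shift_op (@walk d).
Proof.
  apply (shift_op_sub (fun x => x) (fun x n => / (4 * INR d) * pconv (fpoly d) x n)).
  - apply shift_op_id.
  - apply (shift_op_cmul _ (pconv (fpoly d))), shift_op_pconv.
Qed.

Definition walkn {d} k : rseq d -> rseq d := Nat.iter k walk.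

Lemma shift_op_walkn {d} k : shift_op (@walkn d k).
Proof. apply shift_op_iter, shift_op_walk. Qed.

Lemma walkn_S {d} k (x : rseq d) : walkn (S k) x = walkn k (walk x).
Proof. apply (shift_op_comm walk (walkn k)); auto using shift_op_walk, shift_op_walkn. Qed.

Lemma fin_INR {d} (i : Fin.t d) : 1 <= INR d.
Proof. destruct i; apply INR_S_ge_1. Qed.

Lemma walk_eq {d} (i : Fin.t d) (x : rseq d) n : walk x n =
  / 2 * x n + / (4 * INR d) * lsum (fins d) (fun i => x (zsub n (zunit i)) + x (zadd n (zunit i))).
Proof.
  unfold walk. rewrite pconv_fpoly. assert (H := fin_INR i). field. lra.
Qed.

(** [walk] minus a fair step between [n] and [n + e_i]. *)
Definition walk_rest {d} (i : Fin.t d) (x : rseq d) : rseq d :=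
  fun n => walk x n - / (4 * INR d) * (x n + x (zadd n (zunit i))).

(** The remaining weights are nonnegative: laziness leaves [1/2 - 1/(4d)] at [n], and the weight at
    [n + e_i] is exactly used up. They add up to [1 - 1/(2d)]. Positivity is tested on [y = B + s x]
    for both signs [s]. *)
Lemma sup_le_walk_rest {d} (i : Fin.t d) x B : sup_le x B -> sup_le (walk_rest i x) ((1 - / (2 * INR d)) * B).
Proof.
  intros H n. assert (Hd := fin_INR i).
  set (c := / (4 * INR d)).
  assert (Hc : 0 < c <= / 4).
  { unfold c. split; [apply Rinv_0_lt_compat; lra|apply Rinv_le_contravar; lra]. }
  assert (E2 : / (2 * INR d) = 2 * c) by (unfold c; field; lra).
  assert (Hpos : forall s : R, (s = 1 \/ s = -1) ->
     0 <= s * walk_rest i x n + (1 - 2 * c) * B).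
  { intros s Hs. unfold walk_rest. rewrite (walk_eq i). fold c.
    set (y := fun m => B + s * x m).
    assert (Hy : forall m, 0 <= y m).
    { intros m. unfold y. generalize (H m). unfold Rabs. destruct Hs; subst; destruct Rcase_abs; lra. }
    assert (Hl : y (zadd n (zunit i)) <= lsum (fins d) (fun i => y (zsub n (zunit i)) + y (zadd n (zunit i)))).
    { generalize (in_fins d i). generalize (fins d). induction l as [|a l IH]; simpl; [easy|].
      intros [->|Hi].
      - assert (0 <= lsum l (fun i => y (zsub n (zunit i)) + y (zadd n (zunit i)))).
        { apply lsum_nonneg. intros j _. generalize (Hy (zsub n (zunit j))) (Hy (zadd n (zunit j))); lra. }
        generalize (Hy (zsub n (zunit i))). lra.
      - specialize (IH Hi). generalize (Hy (zsub n (zunit a))) (Hy (zadd n (zunit a))). lra. }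
    assert (El : lsum (fins d) (fun i => y (zsub n (zunit i)) + y (zadd n (zunit i))) =
      INR d * (2 * B) + s * lsum (fins d) (fun i => x (zsub n (zunit i)) + x (zadd n (zunit i)))).
    { rewrite <- lsum_fins_const, <- lsum_scal, <- lsum_plus. apply lsum_ext. intros; unfold y; ring. }
    rewrite El in Hl. unfold y in Hl.
    set (L := lsum (fins d) (fun i => x (zsub n (zunit i)) + x (zadd n (zunit i)))) in *.
    assert (Hyn := Hy n). unfold y in Hyn.
    assert (Hcd : c * INR d = / 4) by (unfold c; field; lra).
    assert (0 <= c * (INR d * (2 * B) + s * L - (B + s * x (zadd n (zunit i))))).
    { apply Rmult_le_pos; lra. }
    assert (0 <= (/ 2 - c) * (B + s * x n)) by (apply Rmult_le_pos; lra).
    replace (s * (/ 2 * x n + c * L - c * (x n + x (zadd n (zunit i)))) + (1 - 2 * c) * B) with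
     (c * (INR d * (2 * B) + s * L - (B + s * x (zadd n (zunit i)))) + (/ 2 - c) * (B + s * x n)
       + (/ 2 - 2 * (c * INR d)) * B) by field.
    rewrite Hcd. lra. }
  rewrite E2. generalize (Hpos 1 (or_introl eq_refl)) (Hpos (-1) (or_intror eq_refl)).
  intros. apply Rabs_le. lra.
Qed.

Lemma sup_le_walk {d} (i : Fin.t d) (x : rseq d) B : sup_le x B -> sup_le (walk x) B.
Proof.
  intros H n. assert (Hd := fin_INR i). assert (Hr := sup_le_walk_rest i x B H n).
  replace (walk x n) with (walk_rest i x n + / (4 * INR d) * (x n + x (zadd n (zunit i))))
    by (unfold walk_rest; ring).
  eapply Rle_trans; [apply Rabs_triang|]. rewrite Rabs_mult.
  assert (Hc : 0 < / (4 * INR d)) by (apply Rinv_0_lt_compat; lra).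
  rewrite (Rabs_pos_eq (/ (4 * INR d))) by lra.
  assert (Ha : Rabs (x n + x (zadd n (zunit i))) <= 2 * B).
  { eapply Rle_trans; [apply Rabs_triang|]. generalize (H n) (H (zadd n (zunit i))); lra. }
  assert (/ (4 * INR d) * Rabs (x n + x (zadd n (zunit i))) <= / (4 * INR d) * (2 * B)).
  { apply Rmult_le_compat_l; lra. }
  replace (/ (2 * INR d)) with (2 * / (4 * INR d)) in Hr by (field; lra). lra.
Qed.

(** Conditionally on the rest of the walk, the fair steps along [e_i] form a martingale [a];
    its second moment controls the gradient of [walkn k x]. *)
Lemma martingale_bound {d} (i : Fin.t d) (x : rseq d) B lam : 0 < lam -> sup_le x B ->
  forall k a, sup_le (fun n => a * walkn k x n - INR k * / (4 * INR d) * dif i (walkn (pred k) x) n)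
    (/ 2 * ((INR k * / (2 * INR d) + a * a) / lam + lam) * B).
Proof.
  intros Hlam HB. assert (Hd := fin_INR i).
  assert (HB0 : 0 <= B) by (eapply Rle_trans; [apply Rabs_pos|apply (HB zzero)]).
  set (c := / (4 * INR d)).
  assert (Hc : 0 < c <= / 4).
  { unfold c. split; [apply Rinv_0_lt_compat; lra|apply Rinv_le_contravar; lra]. }
  assert (E2 : / (2 * INR d) = 2 * c) by (unfold c; field; lra). rewrite E2.
  induction k as [|k IH]; intros a.
  - intros n. simpl. rewrite !Rmult_0_l, Rminus_0_r, Rplus_0_l, Rabs_mult.
    apply Rmult_le_compat; auto using Rabs_pos.
    (* The inequality [|a| <= (a^2/lam + lam)/2] replaces a first absolute moment by a second
       moment. *)
    apply Rmult_le_reg_r with (2 * lam); [lra|].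
    replace (/ 2 * (a * a / lam + lam) * (2 * lam)) with (a * a + lam * lam) by (field; lra).
    assert (0 <= (a - lam) * (a - lam)) by apply Rle_0_sqr.
    assert (0 <= (a + lam) * (a + lam)) by apply Rle_0_sqr.
    unfold Rabs; destruct Rcase_abs; lra.
  - set (z := fun b n => b * walkn k x n - INR k * c * dif i (walkn (pred k) x) n).
    assert (HQ : forall b n, walk (z b) n = b * walkn (S k) x n - INR k * c * dif i (walkn k x) n).
    { intros b n. unfold z. rewrite shift_op_minus, shift_op_scal, shift_op_scal by apply shift_op_walk.
      rewrite (shift_op_comm walk (dif i)) by (apply shift_op_walk || apply shift_op_dif).
      destruct k; simpl; ring. }
    (* One step of the walk: a fair step that stays at [n] raises [a] by 1, one that goes to
       [n + e_i] lowers it by 1, and any other outcome leaves [a] unchanged. *)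
    assert (Hz : forall n, a * walkn (S k) x n - INR (S k) * c * dif i (walkn (pred (S k)) x) n =
       walk_rest i (z a) n + c * (z (a + 1) n + z (a - 1) (zadd n (zunit i)))).
    { intros n. unfold walk_rest. rewrite HQ, S_INR. simpl pred. unfold z. fold c.
      unfold dif at 1. unfold dif at 2. ring_simplify. unfold dif. ring. }
    intros n. rewrite Hz.
    set (C := fun b => / 2 * ((INR k * (2 * c) + b * b) / lam + lam)).
    assert (H1 : Rabs (walk_rest i (z a) n) <= (1 - 2 * c) * (C a * B)).
    { rewrite <- E2. exact (sup_le_walk_rest i (z a) _ (IH a) n). }
    assert (H2 : Rabs (z (a + 1) n) <= C (a + 1) * B) by exact (IH (a + 1) n).
    assert (H3 : Rabs (z (a - 1) (zadd n (zunit i))) <= C (a - 1) * B) by exact (IH (a - 1) _).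
    (* Since [(a + 1)^2 + (a - 1)^2 = 2 a^2 + 2], a step raises the second moment by [2 c], the
       probability that it is fair. *)
    replace (/ 2 * ((INR (S k) * (2 * c) + a * a) / lam + lam)) with
      ((1 - 2 * c) * C a + c * (C (a + 1) + C (a - 1))).
    + eapply Rle_trans; [apply Rabs_triang|]. rewrite Rabs_mult, (Rabs_pos_eq c) by lra.
      assert (Rabs (z (a + 1) n + z (a - 1) (zadd n (zunit i))) <= C (a + 1) * B + C (a - 1) * B).
      { eapply Rle_trans; [apply Rabs_triang|]. lra. }
      assert (c * Rabs (z (a + 1) n + z (a - 1) (zadd n (zunit i))) <= c * (C (a + 1) * B + C (a - 1) * B)).
      { apply Rmult_le_compat_l; lra. }
      lra.
    + unfold C. rewrite S_INR. field. lra.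
Qed.

(** The martingale bound after [k + 1] steps, at [a = 0]: only the gradient term survives. The
    choice [lam = sqrt (k + 1)] balances the two terms on the right. *)
Lemma gradient_bound {d} (i : Fin.t d) k (x : rseq d) B : sup_le x B ->
  sup_le (dif i (walkn k x)) (4 * INR d * / sqrt (INR (S k)) * B).
Proof.
  intros HB n. assert (Hd := fin_INR i).
  assert (HB0 : 0 <= B) by (eapply Rle_trans; [apply Rabs_pos|apply (HB zzero)]).
  assert (Hk := INR_S_ge_1 k).
  set (s := sqrt (INR (S k))).
  assert (Hs : 0 < s) by (apply sqrt_lt_R0; lra).
  assert (Hss : s * s = INR (S k)) by (apply sqrt_sqrt; lra).
  assert (H := martingale_bound i x B s Hs HB (S k) 0 n). change (Init.Nat.pred (S k)) with k in H.
  rewrite <- Hss in H.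
  replace (0 * walkn (S k) x n - s * s * / (4 * INR d) * dif i (walkn k x) n) with
    (- (s * s * / (4 * INR d)) * dif i (walkn k x) n) in H by ring.
  rewrite Rabs_mult, Rabs_Ropp, (Rabs_pos_eq (s * s * _)) in H.
  2: { apply Rmult_le_pos; [nra|]. left; apply Rinv_0_lt_compat; lra. }
  apply Rmult_le_reg_l with (s * s * / (4 * INR d)).
  { apply Rmult_lt_0_compat; [nra|]. apply Rinv_0_lt_compat; lra. }
  eapply Rle_trans; [apply H|].
  replace (s * s * / (4 * INR d) * (4 * INR d * / s * B)) with (s * B) by (field; lra).
  apply Rmult_le_compat_r; auto.
  replace (/ 2 * ((s * s * / (2 * INR d) + 0 * 0) / s + s)) with (s * (/ 2 * (/ (2 * INR d) + 1)))
    by (field; lra).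
  rewrite <- (Rmult_1_r s) at 2. apply Rmult_le_compat_l; [lra|].
  assert (/ (2 * INR d) <= / 1) by (apply Rinv_le_contravar; lra). lra.
Qed.

(** ** Third differences of the Green function are summable *)

Definition delta0 {d} : rseq d := fun n => if excluded_middle_informative (n = zzero) then 1 else 0.

Lemma lcoef_delta0 {d} (p : lpoly d) n : IZR (lcoef p n) = pconv p delta0 n.
Proof.
  rewrite lcoef_lsum, pconv_lsum. apply lsum_ext. intros ce _. unfold delta0.
  destruct (excluded_middle_informative (snd ce = n)) as [E|E],
    (excluded_middle_informative (zsub n (snd ce) = zzero)) as [E'|E']; try ring.
  - destruct E'. subst. zd.
  - destruct E. apply functional_extensionality; intros i.
    apply (f_equal (fun v => v i)) in E'. unfold zsub, zzero in E'. lia.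
Qed.

(** Duality between l^1 and the sup-norm. The test sequence is the sign of the kernel on the box,
    reflected, so that its image at the origin is the sum of absolute values over the box. *)
Lemma shift_op_l1_norm {d} (T : rseq d -> rseq d) c : shift_op T ->
  (forall x, sup_le x 1 -> Rabs (T x zzero) <= c) ->
  forall N, boxsum (fun k => Rabs (T delta0 k)) N <= c.
Proof.
  intros [p Hp] H N.
  set (sg := fun k => if Rle_dec 0 (T delta0 k) then 1 else -1).
  set (x := fun m : Zd d => if mem (box d N) (zopp m) then sg (zopp m) else 0).
  eapply Rle_trans; [|apply (H x)].
  - eapply Rle_trans; [|apply Rle_abs]. right. rewrite boxsum_lsum.
    rewrite (lsum_ext _ _ (fun k => lsum p (fun ce => fst ce *
        (if excluded_middle_informative (snd ce = k) then sg k else 0)))).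
    + rewrite lsum_exchange, Hp. unfold ap. apply lsum_ext. intros ce _.
      rewrite lsum_scal. f_equal. unfold x.
      replace (zopp (zsub zzero (snd ce))) with (snd ce) by zd.
      destruct (mem (box d N) (snd ce)) eqn:E.
      * apply mem_true in E. apply lsum_delta; auto using NoDup_box.
      * apply lsum_0. intros k Hk. destruct excluded_middle_informative; auto. subst.
        apply mem_true in Hk. congruence.
    + intros k _. replace (Rabs (T delta0 k)) with (sg k * T delta0 k).
      * rewrite Hp. unfold ap. rewrite <- lsum_scal. apply lsum_ext. intros ce _.
        unfold delta0. destruct (excluded_middle_informative (snd ce = k)) as [E|E],
          (excluded_middle_informative (zsub k (snd ce) = zzero)) as [E'|E']; try ring.
        -- destruct E'. subst. zd.
        -- destruct E. apply functional_extensionality; intros i.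
           apply (f_equal (fun v => v i)) in E'. unfold zsub, zzero in E'. lia.
      * unfold sg. destruct Rle_dec; [rewrite Rabs_pos_eq; lra|rewrite Rabs_left; lra].
  - intros m. unfold x, sg. destruct mem; [destruct Rle_dec|]; apply Rabs_le; lra.
Qed.

(** Comparison with a telescoping majorant: [g] is increasing and bounded, so [u] is a Cauchy
    sequence, and its total variation is at most the total increase of [g]. *)
Lemma dominated_cv (u g : nat -> R) B : (forall n, Rabs (u (S n) - u n) <= g (S n) - g n) ->
  (forall n, g n <= B) -> exists l, Un_cv u l /\ Rabs (l - u 0%nat) <= B - g 0%nat.
Proof.
  intros H HB.
  assert (Hg : Un_growing g) by (intros n; generalize (H n) (Rabs_pos (u (S n) - u n)); lra).
  destruct (growing_cv g Hg) as [gl Hgl].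
  { exists B. intros x [n ->]. apply HB. }
  assert (Hm : forall n k, Rabs (u (n + k)%nat - u n) <= g (n + k)%nat - g n).
  { intros n. induction k.
    - rewrite Nat.add_0_r, !Rminus_diag, Rabs_R0; lra.
    - rewrite Nat.add_succ_r. specialize (H (n + k)%nat).
      replace (u (S (n + k)) - u n) with ((u (S (n + k)) - u (n + k)%nat) + (u (n + k)%nat - u n)) by ring.
      eapply Rle_trans; [apply Rabs_triang|]. lra. }
  destruct (Rcomplete.R_complete u) as [l Hl].
  2: { exists l. split; auto. apply Rnot_lt_le. intros Hlt.
       destruct (Hl (Rabs (l - u 0%nat) - (B - g 0%nat))) as [N HN]; [lra|].
       specialize (HN N (le_n _)). specialize (Hm 0%nat N). specialize (HB N).
       simpl in Hm. unfold Rdist in HN. revert HN Hm Hlt. unfold Rabs.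
       repeat destruct Rcase_abs; lra. }
  intros eps He. destruct (Hgl (eps / 4)) as [N HN]; [lra|].
  exists N. intros n m Hn Hk. unfold Rdist in *.
  generalize (Hm N (n - N)%nat) (Hm N (m - N)%nat).
  replace (N + (n - N))%nat with n by lia. replace (N + (m - N))%nat with m by lia.
  generalize (HN n Hn) (HN m Hk) (HN N (le_n _)).
  unfold Rabs. repeat destruct Rcase_abs; lra.
Qed.

(** Summability of [n^(-3/2)] in telescoping form, from [1/s - 1/s' = 1/(s s' (s + s'))] for
    consecutive square roots [s < s' <= 3/2 s]. *)
Lemma inv_sqrt_cube_le k : (/ sqrt (INR (S k))) ^ 3 <=
  4 * (/ sqrt (INR (S k)) - / sqrt (INR (S (S k)))).
Proof.
  assert (H1 := INR_S_ge_1 k). set (s := sqrt (INR (S k))). set (s' := sqrt (INR (S (S k)))).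
  assert (Hs : 1 <= s) by (unfold s; rewrite <- sqrt_1; apply sqrt_le_1_alt; lra).
  assert (Hs' : s < s') by (apply sqrt_lt_1_alt; rewrite (S_INR (S k)); lra).
  assert (E : s' * s' = s * s + 1).
  { unfold s, s'. rewrite !sqrt_sqrt; rewrite ?(S_INR (S k)); lra. }
  assert (L : s' <= 3 / 2 * s) by nra.
  replace (/ s - / s') with (/ (s * s' * (s + s'))).
  2: { replace (/ s - / s') with ((s' - s) / (s * s')) by (field; lra).
       assert ((s' - s) * (s' + s) = 1) by lra.
       replace (s' - s) with (/ (s + s')); [field; lra|].
       apply Rmult_eq_reg_r with (s + s'); [|lra]. rewrite Rinv_l by lra. lra. }
  rewrite pow_inv. replace (4 * / (s * s' * (s + s'))) with (/ (s * s' * (s + s') / 4)) by (field; lra).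
  apply Rinv_le_contravar.
  - assert (0 < s * s' * (s + s')) by (repeat apply Rmult_lt_0_compat; lra). lra.
  - assert (s' * s' <= 2 * (s * s)) by nra.
    assert (s * (s' * s') <= s * (2 * (s * s))) by (apply Rmult_le_compat_l; lra).
    assert (s * s * s' <= s * s * (3 / 2 * s)) by (apply Rmult_le_compat_l; nra).
    simpl. nra.
Qed.

Lemma inv_sqrt_pos k : 0 < / sqrt (INR (S k)).
Proof. apply Rinv_0_lt_compat, sqrt_lt_R0. generalize (INR_S_ge_1 k); lra. Qed.

Section ThirdDifference.
Context {d : nat} (i j l : Fin.t d).

Definition dif3_walk k (x : rseq d) : rseq d := dif i (walkn k (dif j (walkn k (dif l (walkn k x))))).
(** As [f = 4d (1 - Q)], composing this operator with [f] gives [1 - Q^3], and raising the index of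
    [dif3_walk] by one inserts [Q^3]. Hence the Laplacian of the partial sums telescopes. *)
Definition walk_avg (x : rseq d) : rseq d := fun n => / (4 * INR d) * (x n + walk x n + walk (walk x) n).
(** Partial sums of the Neumann series of [D_i D_j D_l / f], with the powers of the walk grouped in
    threes so that every difference is next to its own [walkn k]. *)
Fixpoint potential_sum k (x : rseq d) : rseq d :=
  match k with
  | O => fun _ => 0
  | S k' => fun n => potential_sum k' x n + dif3_walk k' (walk_avg x) n
  end.

Lemma shift_op_dif3_walk k : shift_op (dif3_walk k).
Proof.
  unfold dif3_walk.
  apply (shift_op_comp (dif i) (fun x => walkn k (dif j (walkn k (dif l (walkn k x)))))); [apply shift_op_dif|].
  apply (shift_op_comp (walkn k) (fun x => dif j (walkn k (dif l (walkn k x))))); [apply shift_op_walkn|].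
  apply (shift_op_comp (dif j) (fun x => walkn k (dif l (walkn k x)))); [apply shift_op_dif|].
  apply (shift_op_comp (walkn k) (fun x => dif l (walkn k x))); [apply shift_op_walkn|].
  apply (shift_op_comp (dif l) (walkn k)); [apply shift_op_dif|apply shift_op_walkn].
Qed.

Lemma shift_op_walk_avg : shift_op walk_avg.
Proof.
  unfold walk_avg. apply (shift_op_cmul _ (fun x n => x n + walk x n + walk (walk x) n)).
  apply (shift_op_add (fun x n => x n + walk x n) (fun x => walk (walk x))).
  - apply (shift_op_add (fun x => x) walk); auto using shift_op_id, shift_op_walk.
  - apply (shift_op_comp walk walk); apply shift_op_walk.
Qed.

Lemma shift_op_potential_sum k : shift_op (potential_sum k).
Proof.
  induction k; simpl; [apply shift_op_zero|].
  apply (shift_op_add (potential_sum k) (fun x => dif3_walk k (walk_avg x))); auto.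
  apply (shift_op_comp (dif3_walk k) walk_avg); auto using shift_op_dif3_walk, shift_op_walk_avg.
Qed.

Lemma dif3_walk_S k x : dif3_walk (S k) x = dif3_walk k (walk (walk (walk x))).
Proof.
  unfold dif3_walk. rewrite !walkn_S.
  assert (HD : forall m (y : rseq d), walk (dif m y) = dif m (walk y))
    by (intros; apply shift_op_comm; auto using shift_op_walk, shift_op_dif).
  assert (HQ : forall y : rseq d, walk (walkn k y) = walkn k (walk y))
    by (intros; apply shift_op_comm; auto using shift_op_walk, shift_op_walkn).
  repeat (rewrite HD || rewrite HQ).
  reflexivity.
Qed.

Lemma dif3_walk_bound k x B : sup_le x B ->
  sup_le (dif3_walk k x) ((4 * INR d) ^ 3 * (/ sqrt (INR (S k))) ^ 3 * B).
Proof.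
  intros H. replace ((4 * INR d) ^ 3 * (/ sqrt (INR (S k))) ^ 3 * B) with
   (4 * INR d * / sqrt (INR (S k)) * (4 * INR d * / sqrt (INR (S k)) *
     (4 * INR d * / sqrt (INR (S k)) * B))) by ring.
  unfold dif3_walk. now do 3 apply gradient_bound.
Qed.

Lemma walk_avg_bound x B : sup_le x B -> sup_le (walk_avg x) B.
Proof.
  intros H n. assert (Hd := fin_INR i).
  assert (HB0 : 0 <= B) by (eapply Rle_trans; [apply Rabs_pos|apply (H zzero)]).
  assert (H1 := sup_le_walk i x B H). assert (H2 := sup_le_walk i _ B H1).
  assert (Hc : 0 < / (4 * INR d) <= / 4).
  { split; [apply Rinv_0_lt_compat; lra|apply Rinv_le_contravar; lra]. }
  unfold walk_avg. rewrite Rabs_mult, Rabs_pos_eq by lra.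
  assert (Rabs (x n + walk x n + walk (walk x) n) <= 3 * B).
  { eapply Rle_trans; [apply Rabs_triang|].
    assert (Ht := Rabs_triang (x n) (walk x n)). specialize (H n). specialize (H1 n). specialize (H2 n). lra. }
  assert (/ (4 * INR d) * Rabs (x n + walk x n + walk (walk x) n) <= / 4 * (3 * B)).
  { apply Rmult_le_compat; try lra. apply Rabs_pos. }
  lra.
Qed.

(** Minus a bound for the tail of the Neumann series: it increases, stays at most 0, and its
    increments dominate the terms, as [dominated_cv] requires. *)
Definition potential_bound k := - (4 * (4 * INR d) ^ 3 * / sqrt (INR (S k))).

Lemma dif3_walk_walk_avg_bound k x : sup_le x 1 -> sup_le (dif3_walk k (walk_avg x)) (potential_bound (S k) - potential_bound k).
Proof.
  intros H n. eapply Rle_trans; [apply (dif3_walk_bound k (walk_avg x) 1), walk_avg_bound, H|].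
  unfold potential_bound. assert (0 <= (4 * INR d) ^ 3) by (apply pow_le; generalize (pos_INR d); lra).
  replace (- (4 * (4 * INR d) ^ 3 * / sqrt (INR (S (S k)))) - - (4 * (4 * INR d) ^ 3 * / sqrt (INR (S k))))
   with ((4 * INR d) ^ 3 * (4 * (/ sqrt (INR (S k)) - / sqrt (INR (S (S k)))))) by ring.
  rewrite Rmult_1_r. apply Rmult_le_compat_l; auto. apply inv_sqrt_cube_le.
Qed.

Lemma potential_bound_neg k : potential_bound k <= 0.
Proof.
  unfold potential_bound. assert (0 <= (4 * INR d) ^ 3) by (apply pow_le; generalize (pos_INR d); lra).
  assert (H1 := inv_sqrt_pos k).
  assert (0 <= 4 * (4 * INR d) ^ 3 * / sqrt (INR (S k))) by (apply Rmult_le_pos; lra). lra.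
Qed.

Lemma potential_sum_bound k x : sup_le x 1 -> sup_le (potential_sum k x) (potential_bound k - potential_bound 0).
Proof.
  intros H. induction k; intros n; simpl potential_sum.
  - rewrite Rabs_R0, Rminus_diag. lra.
  - eapply Rle_trans; [apply Rabs_triang|]. generalize (IHk n) (dif3_walk_walk_avg_bound k x H n). lra.
Qed.

Lemma lap_potential_sum k x n : pconv (fpoly d) (potential_sum k x) n = dif3_walk 0 x n - dif3_walk k x n.
Proof.
  assert (Hd := fin_INR i).
  induction k.
  - simpl potential_sum. rewrite pconv_fpoly, lsum_fins_const. ring.
  - simpl potential_sum. rewrite (shift_op_plus (pconv (fpoly d))) by apply shift_op_pconv. rewrite IHk.
    rewrite (shift_op_comm (pconv (fpoly d)) (dif3_walk k)) by (apply shift_op_pconv || apply shift_op_dif3_walk).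
    replace (pconv (fpoly d) (walk_avg x)) with (fun m => x m - walk (walk (walk x)) m).
    + rewrite shift_op_minus by apply shift_op_dif3_walk. rewrite <- dif3_walk_S. ring.
    + assert (E : forall z, pconv (fpoly d) z = fun m => 4 * INR d * (z m - walk z m)).
      { intros z. fe. unfold walk. field. lra. }
      rewrite E. fe. unfold walk_avg. rewrite (shift_op_scal walk) by apply shift_op_walk.
      rewrite (shift_op_plus walk (fun m => x m + walk x m)), (shift_op_plus walk) by apply shift_op_walk. field. lra.
Qed.

(** By duality the kernels of all partial sums have l^1 norm at most [- potential_bound 0], which
    survives the pointwise limit box by box. Applying [f] to them leaves the third difference minus
    [dif3_walk k], and the latter tends to 0. *)
Lemma third_difference_l1 : exists b : rseq d, l1 b /\
  forall n, pconv (fpoly d) b n = dif i (dif j (dif l delta0)) n.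
Proof.
  assert (H1 : sup_le (@delta0 d) 1).
  { intros n. unfold delta0. destruct excluded_middle_informative; apply Rabs_le; lra. }
  assert (Hc : forall n, exists s, Un_cv (fun k => potential_sum k delta0 n) s).
  { intros n. destruct (dominated_cv (fun k => potential_sum k delta0 n) potential_bound 0) as [s [Hs _]]; [|apply potential_bound_neg|now exists s].
    intros k. simpl potential_sum. replace (potential_sum k delta0 n + dif3_walk k (walk_avg delta0) n - potential_sum k delta0 n)
      with (dif3_walk k (walk_avg delta0) n) by ring. now apply dif3_walk_walk_avg_bound. }
  destruct (choice _ Hc) as [b Hb]. exists b. split.
  - exists (- potential_bound 0). intros N.
    assert (Hl : Un_cv (fun k => boxsum (fun m => Rabs (potential_sum k delta0 m)) N) (boxsum (fun m => Rabs (b m)) N)).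
    { apply (Un_cv_lsum (box d N) (fun m k => Rabs (potential_sum k delta0 m))). intros m _. apply cv_cvabs, Hb. }
    apply Rnot_lt_le. intros Hlt.
    destruct (Hl (boxsum (fun m => Rabs (b m)) N - - potential_bound 0)) as [K HK]; [lra|].
    specialize (HK K (le_n _)). unfold Rdist in HK.
    assert (Hn : boxsum (fun m => Rabs (potential_sum K delta0 m)) N <= potential_bound K - potential_bound 0).
    { apply (shift_op_l1_norm (potential_sum K)); [apply shift_op_potential_sum|]. intros x Hx. now apply potential_sum_bound. }
    generalize (potential_bound_neg K). revert HK. unfold Rabs at 1. destruct Rcase_abs; lra.
  - intros n. eapply UL_sequence; [apply (shift_op_lim (pconv (fpoly d)) (fun k => potential_sum k delta0)); auto using shift_op_pconv|].
    eapply Un_cv_ext; [intros k; symmetry; apply lap_potential_sum|].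
    replace (dif i (dif j (dif l delta0)) n) with (dif3_walk 0 delta0 n - 0) by (unfold dif3_walk; simpl; ring).
    apply CV_minus; [apply Un_cv_const|].
    set (C := (4 * INR d) ^ 3).
    assert (HC : 0 <= C) by (apply pow_le; generalize (pos_INR d); lra).
    assert (Hz : Un_cv (fun k => C * / sqrt (INR (S k))) 0).
    { replace 0 with (C * 0) by ring. apply Un_cv_scal, sqrt_S_inv_cv. }
    intros eps He. destruct (Hz eps He) as [K HK]. exists K. intros k Hk. specialize (HK k Hk).
    unfold Rdist in *. rewrite Rminus_0_r in *. eapply Rle_lt_trans; [|apply HK].
    eapply Rle_trans; [apply (dif3_walk_bound k _ 1 H1)|]. eapply Rle_trans; [|apply Rle_abs].
    rewrite Rmult_1_r. fold C. apply Rmult_le_compat_l; auto.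
    assert (Hp := inv_sqrt_pos k). assert (/ sqrt (INR (S k)) <= 1).
    { rewrite <- Rinv_1. apply Rinv_le_contravar; [lra|]. rewrite <- sqrt_1.
      apply sqrt_le_1_alt, INR_S_ge_1. }
    simpl. rewrite Rmult_1_r.
    set (s := / sqrt _) in *. assert (s * s <= 1) by nra. nra.
Qed.
End ThirdDifference.

(** * Third differences in [I_d], and the equation [f.w = delta] *)

Definition dpoly {d} (i : Fin.t d) : lpoly d := [(1, zopp (zunit i)); (-1, zzero)]%Z.

Lemma pconv_dpoly {d} (i : Fin.t d) x : pconv (dpoly i) x = dif i x.
Proof.
  fe. unfold dpoly, dif. rewrite pconv_lsum. simpl.
  replace (zsub n (zopp (zunit i))) with (zadd n (zunit i)) by zd.
  replace (zsub n zzero) with n by zd. ring.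
Qed.

Lemma pconv_pmul {d} (p q : lpoly d) x : pconv (pmul p q) x = pconv p (pconv q x).
Proof.
  fe. unfold pmul. rewrite !pconv_lsum, lsum_flat_map. apply lsum_ext. intros a _.
  rewrite lsum_map, pconv_lsum, <- lsum_scal. apply lsum_ext. intros b _. simpl.
  rewrite mult_IZR. replace (zsub n (zadd (snd a) (snd b))) with (zsub (zsub n (snd a)) (snd b)) by zd.
  ring.
Qed.

Lemma third_difference_inI {d} (i j l : Fin.t d) : (2 <= d)%nat ->
  inI d (pmul (dpoly i) (pmul (dpoly j) (dpoly l))).
Proof.
  intros Hd. destruct (third_difference_l1 i j l) as [b [Hb Hf]].
  apply (l1_ext b); auto. intros n. symmetry. apply green_potential; auto.
  intros m. now rewrite Hf, lcoef_delta0, !pconv_pmul, !pconv_dpoly.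
Qed.

(** [delta0] is itself summable and its Laplacian is the coefficient function of [f], so
    [green_potential] applies with [b = delta0]. *)
Lemma lap_green d n : (2 <= d)%nat -> pconv (fpoly d) (green d) n = delta0 n.
Proof.
  intros Hd. apply green_potential; auto.
  - exists 1. intros N. apply (shift_op_l1_norm (fun x : rseq d => x)); [apply shift_op_id|]. auto.
  - intros m. symmetry. apply lcoef_delta0.
Qed.

(** ** Moments of the elements of [I_d] *)

Lemma star_green d (g : lpoly d) n :
  pconv (pstar g) (green d) n = pconv g (green d) (zopp n).
Proof.
  rewrite !pconv_lsum. unfold pstar. rewrite lsum_map. apply lsum_ext. intros ce _. simpl.
  rewrite <- green_opp. do 2 f_equal. zd.
Qed.

Lemma star_green_l1 d (g : lpoly d) : inI d g -> l1 (pconv (pstar g) (green d)).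
Proof.
  intros H. apply (l1_ext (fun k => pconv g (green d) (zopp k))).
  - intros n. symmetry. apply star_green.
  - apply (l1_inj (pconv g (green d)) zopp); auto. intros x y E.
    apply functional_extensionality; intros i. apply (f_equal (fun v => v i)) in E.
    unfold zopp in E. lia.
Qed.

(** So [xi_g] sends [f.y] to [g(alpha) y] modulo 1: with [a = g^*.w], the equation [f.w = delta]
    becomes [f.a = g^*], and summation by parts moves [f] onto [a]. *)
Lemma pairing d (g : lpoly d) y n : (2 <= d)%nat -> inI d g -> linf y ->
  series_to (fun k => pconv (pstar g) (green d) k * pconv (fpoly d) y (zsub n k)) (palpha g y n).
Proof.
  intros Hd Hg Hy. rewrite palpha_pstar.
  apply series_by_parts; auto using star_green_l1. intros k.
  rewrite (shift_op_comm (pconv (fpoly d)) (pconv (pstar g))) by apply shift_op_pconv.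
  rewrite lcoef_delta0. f_equal. fe. now apply lap_green.
Qed.

Definition step (n : nat) : R := / INR (S n).

Lemma step_pos n : 0 < step n.
Proof. apply Rinv_0_lt_compat. generalize (INR_S_ge_1 n); lra. Qed.

Lemma step_cv : Un_cv step 0.
Proof.
  intros eps He. destruct (INR_unbounded (/ eps)) as [N HN].
  exists N. intros n Hn. unfold Rdist, step. rewrite Rminus_0_r, Rabs_pos_eq.
  2: left; apply step_pos.
  rewrite <- (Rinv_inv eps). assert (0 < / eps) by now apply Rinv_0_lt_compat.
  apply le_INR in Hn. apply Rinv_lt_contravar.
  - apply Rmult_lt_0_compat; auto. generalize (INR_S_ge_1 n); lra.
  - rewrite S_INR. lra.
Qed.

Lemma step_sin_cv th : Un_cv (fun n => sin (step n * th) / step n) th.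
Proof.
  assert (H : derivable_pt_lim (fun e => sin (e * th)) 0 th).
  { apply is_derive_Reals. auto_derive; auto. rewrite Rmult_0_l, cos_0. ring. }
  intros eps He. destruct (H eps He) as [del Hdel].
  destruct (step_cv del (cond_pos del)) as [N HN]. exists N. intros n Hn.
  specialize (HN n Hn). unfold Rdist in *. rewrite Rminus_0_r in HN.
  assert (Hp := step_pos n). specialize (Hdel (step n)). rewrite Rplus_0_l, Rmult_0_l, sin_0, Rminus_0_r in Hdel.
  apply Hdel; auto. lra.
Qed.

Lemma step_cos_cv th : Un_cv (fun n => (2 - 2 * cos (step n * th)) / (step n * step n)) (th * th).
Proof.
  assert (H := step_sin_cv (th / 2)).
  assert (H2 := CV_mult _ _ _ _ H H). apply (Un_cv_scal 4) in H2.
  replace (th * th) with (4 * (th / 2 * (th / 2))) by field.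
  eapply Un_cv_ext; [|apply H2]. intros n. simpl.
  replace (step n * th) with (2 * (step n * (th / 2))) by field. rewrite cos_2a_sin.
  field. generalize (step_pos n); lra.
Qed.

Lemma cos_step_cv a th : Un_cv (fun n => cos (a + step n * th)) (cos a).
Proof.
  assert (H : Un_cv (fun n => a + step n * th) (a + 0 * th)).
  { apply (CV_plus (fun _ => a) (fun n => step n * th)); [apply Un_cv_const|].
    apply (CV_mult step (fun _ => th)); [apply step_cv|apply Un_cv_const]. }
  rewrite Rmult_0_l, Rplus_0_r in H.
  apply (continuity_seq cos (fun n => a + step n * th)); [apply continuity_cos|apply H].
Qed.

Lemma ip_scal {d} (n : Zd d) c x : ip n (fun i => c * x i) = c * ip n x.
Proof. rewrite !ip_lsum, <- lsum_scal. apply lsum_ext. intros; ring. Qed.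

(** [S n] is the transform of [g^*.w] at [step n * x], with phase [a0]; summability makes it
    continuous at 0. The phase selects the part of the symbol of [g] that is even or odd in [x]. *)
Lemma fourier_at_zero d (g : lpoly d) s a0 x : (2 <= d)%nat -> inI d g ->
  series_to (pconv (pstar g) (green d)) s ->
  exists S : nat -> R, Un_cv S (s * cos a0) /\
   forall n, lsum g (fun ce => IZR (fst ce) * cos (a0 + step n * (2 * PI * ip (snd ce) x))) =
     Fd d (fun i => step n * x i) * S n.
Proof.
  intros Hd Hg Hs. set (a := pconv (pstar g) (green d)) in *.
  assert (Ha : l1 a) by now apply star_green_l1.
  set (y := fun n (m : Zd d) => cos (a0 + 2 * PI * ip m (fun i => step n * x i))).
  assert (Hy : forall n, linf (y n)) by (intros n; exists 1; intros; apply cos_abs).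
  assert (HS : forall n, exists S, series_to (fun k => a k * y n (zsub zzero k)) S).
  { intros n. apply l1_series, l1_mult; auto. exists 1. intros. apply cos_abs. }
  destruct (choice _ HS) as [S HS']. exists S. split.
  - intros eps He. destruct (l1_tail a Ha (eps / 8)) as [N HN]; [lra|].
    assert (Hf : Un_cv (fun n => lsum (box d N) (fun k => a k * y n (zsub zzero k)))
       (lsum (box d N) (fun k => a k * cos a0))).
    { apply (Un_cv_lsum (box d N) (fun k n => a k * y n (zsub zzero k))). intros k _.
      apply Un_cv_scal. unfold y. eapply Un_cv_ext; [|apply (cos_step_cv a0 (2 * PI * ip (zsub zzero k) x))].
      intros n. simpl. rewrite ip_scal. f_equal. ring. }
    destruct (Hf (eps / 4)) as [K HK]; [lra|]. exists K. intros n Hn. specialize (HK n Hn).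
    assert (Htail : forall w : Zd d -> R, (forall k, Rabs (w k) <= 1) ->
       forall l, NoDup l -> (forall n, In n l -> ~ In n (box d N)) ->
         lsum l (fun k => Rabs (a k * w k)) <= eps / 8).
    { intros w Hw l Nl Hl. eapply Rle_trans; [|apply (HN l Nl Hl)]. apply lsum_le. intros k _.
      rewrite Rabs_mult. rewrite <- (Rmult_1_r (Rabs (a k))) at 2.
      apply Rmult_le_compat_l; [apply Rabs_pos|apply Hw]. }
    assert (H1 := series_near _ _ N _ (Htail (fun k => y n (zsub zzero k)) (fun k => cos_abs _)) (HS' n) N (le_n _)).
    assert (Hs2 : series_to (fun k => a k * cos a0) (s * cos a0)).
    { rewrite Rmult_comm. eapply series_ext; [|apply (series_scal a (cos a0) s Hs)].
      intros; simpl; ring. }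
    assert (H2 := series_near _ _ N _ (Htail (fun k => cos a0) (fun k => cos_abs _)) Hs2 N (le_n _)).
    rewrite boxsum_lsum in H1, H2. unfold Rdist in *.
    revert H1 H2 HK. unfold Rabs. repeat destruct Rcase_abs; lra.
  - intros n. assert (H := pairing d g (y n) zzero Hd Hg (Hy n)). fold a in H.
    assert (H1 := series_scal _ (Fd d (fun i => step n * x i)) _ (HS' n)).
    eapply series_unique; [|apply H1].
    replace (lsum g (fun ce => IZR (fst ce) * cos (a0 + step n * (2 * PI * ip (snd ce) x))))
      with (palpha g (y n) zzero).
    + eapply series_ext; [|apply H]. intros k. cbv beta. unfold y at 1.
      rewrite pconv_fpoly_cos. unfold y. ring.
    + rewrite palpha_lsum. apply lsum_ext. intros ce _. unfold y.
      replace (zadd (snd ce) zzero) with (snd ce) by zd. rewrite ip_scal. do 2 f_equal. ring.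
Qed.

Lemma Fd_step_cv d (x : Rd d) : Un_cv (fun n => Fd d (fun i => step n * x i) / (step n * step n))
  (lsum (fins d) (fun i => (2 * PI * x i) * (2 * PI * x i))).
Proof.
  eapply Un_cv_ext; [|apply (Un_cv_lsum (fins d)
    (fun i n => (2 - 2 * cos (step n * (2 * PI * x i))) / (step n * step n)))].
  - intros n. cbv beta. rewrite Fd_lsum.
    rewrite (lsum_ext _ _ (fun i => / (step n * step n) * (2 - 2 * cos (2 * PI * (step n * x i))))).
    + rewrite lsum_scal. unfold Rdiv. ring.
    + intros i _. replace (2 * PI * (step n * x i)) with (step n * (2 * PI * x i)) by ring.
      unfold Rdiv. ring.
  - intros i _. apply step_cos_cv.
Qed.

(** Along a ray the symbol of [g] is [F], of order [step^2], times a convergent sequence. Comparison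
    at orders 0, 1 and 2 gives the three moments; the factor [-2] comes from [2 - 2 cos x] being
    [x^2] to leading order. *)
Lemma moments d (g : lpoly d) s : (2 <= d)%nat -> inI d g ->
  series_to (pconv (pstar g) (green d)) s ->
  lsum g (fun ce => IZR (fst ce)) = 0 /\
  (forall x, lsum g (fun ce => IZR (fst ce) * ip (snd ce) x) = 0) /\
  (forall x, lsum g (fun ce => IZR (fst ce) * (ip (snd ce) x * ip (snd ce) x)) =
     -2 * s * lsum (fins d) (fun i => x i * x i)).
Proof.
  intros Hd Hg Hs.
  assert (Hpi := PI_RGT_0).
  assert (Hst : forall n, step n <> 0) by (intros n; generalize (step_pos n); lra).
  assert (Hstep2 : Un_cv (fun n => step n * step n) 0).
  { replace 0 with (0 * 0) by ring. apply CV_mult; apply step_cv. }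
  assert (M0 : lsum g (fun ce => IZR (fst ce)) = 0).
  { destruct (fourier_at_zero d g s 0 (fun _ => 0) Hd Hg Hs) as [S [_ HS]].
    specialize (HS 0%nat).
    rewrite (lsum_ext g _ (fun ce => IZR (fst ce) * cos (0 + step 0 * (2 * PI * ip (snd ce) (fun _ => 0))))).
    - rewrite HS, Fd_lsum, lsum_0; [ring|]. intros i _. rewrite !Rmult_0_r, cos_0. ring.
    - intros ce _. replace (ip (snd ce) (fun _ => 0)) with 0.
      + rewrite !Rmult_0_r, Rplus_0_r, cos_0. ring.
      + rewrite ip_lsum, lsum_0; auto. intros; ring. }
  split; [exact M0|]. split; intros x.
  - destruct (fourier_at_zero d g s (- (PI / 2)) x Hd Hg Hs) as [S [HcS HS]].
    assert (L1 : Un_cv (fun n => lsum g (fun ce => IZR (fst ce) * (sin (step n * (2 * PI * ip (snd ce) x)) / step n)))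
       (lsum g (fun ce => IZR (fst ce) * (2 * PI * ip (snd ce) x)))).
    { apply (Un_cv_lsum g (fun ce n => IZR (fst ce) * (sin (step n * (2 * PI * ip (snd ce) x)) / step n))).
      intros ce _. apply Un_cv_scal, step_sin_cv. }
    assert (L2 : Un_cv (fun n => step n * (Fd d (fun i => step n * x i) / (step n * step n) * S n)) 0).
    { replace 0 with (0 * (lsum (fins d) (fun i => (2 * PI * x i) * (2 * PI * x i)) * (s * cos (- (PI / 2))))) by ring.
      apply (CV_mult step); [apply step_cv|]. apply CV_mult; auto. apply Fd_step_cv. }
    assert (E : lsum g (fun ce => IZR (fst ce) * (2 * PI * ip (snd ce) x)) = 0).
    { eapply UL_sequence; [apply L1|]. eapply Un_cv_ext; [|apply L2]. intros n. cbv beta.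
      replace (step n * (Fd d (fun i => step n * x i) / (step n * step n) * S n)) with
        (/ step n * (Fd d (fun i => step n * x i) * S n)) by (field; auto).
      rewrite <- HS, <- lsum_scal. apply lsum_ext. intros ce _.
      rewrite Rplus_comm. replace (step n * (2 * PI * ip (snd ce) x) + - (PI / 2)) with
        (- (PI / 2 - step n * (2 * PI * ip (snd ce) x))) by ring.
      rewrite cos_neg, cos_shift. field. auto. }
    rewrite (lsum_ext g _ (fun ce => (2 * PI) * (IZR (fst ce) * ip (snd ce) x))) in E by (intros; ring).
    rewrite lsum_scal in E. apply Rmult_integral in E. lra.
  - destruct (fourier_at_zero d g s 0 x Hd Hg Hs) as [S [HcS HS]]. rewrite cos_0, Rmult_1_r in HcS.
    assert (L1 : Un_cv (fun n => lsum g (fun ce => IZR (fst ce) *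
        ((2 - 2 * cos (step n * (2 * PI * ip (snd ce) x))) / (step n * step n))))
       (lsum g (fun ce => IZR (fst ce) * ((2 * PI * ip (snd ce) x) * (2 * PI * ip (snd ce) x))))).
    { apply (Un_cv_lsum g (fun ce n => IZR (fst ce) *
        ((2 - 2 * cos (step n * (2 * PI * ip (snd ce) x))) / (step n * step n)))).
      intros ce _. apply Un_cv_scal, step_cos_cv. }
    assert (L2 : Un_cv (fun n => -2 * (Fd d (fun i => step n * x i) / (step n * step n) * S n))
       (-2 * (lsum (fins d) (fun i => (2 * PI * x i) * (2 * PI * x i)) * s))).
    { apply Un_cv_scal, CV_mult; auto. apply Fd_step_cv. }
    assert (E : lsum g (fun ce => IZR (fst ce) * ((2 * PI * ip (snd ce) x) * (2 * PI * ip (snd ce) x)))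
       = -2 * (lsum (fins d) (fun i => (2 * PI * x i) * (2 * PI * x i)) * s)).
    { eapply UL_sequence; [apply L1|]. eapply Un_cv_ext; [|apply L2]. intros n. cbv beta.
      replace (-2 * (Fd d (fun i => step n * x i) / (step n * step n) * S n)) with
        (-2 * / (step n * step n) * (Fd d (fun i => step n * x i) * S n)) by (field; auto).
      rewrite <- HS, <- lsum_scal.
      (* The constant in [2 - 2 cos] contributes nothing because the zeroth moment vanishes. *)
      replace (lsum g (fun ce => IZR (fst ce) * ((2 - 2 * cos (step n * (2 * PI * ip (snd ce) x))) / (step n * step n))))
       with (lsum g (fun ce => 2 / (step n * step n) * IZR (fst ce) +
        -2 * / (step n * step n) * (IZR (fst ce) * cos (0 + step n * (2 * PI * ip (snd ce) x))))).
      - rewrite lsum_plus, !lsum_scal, M0. ring.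
      - apply lsum_ext. intros ce _. rewrite Rplus_0_l. field. auto. }
    rewrite (lsum_ext g _ (fun ce => (4 * PI * PI) * (IZR (fst ce) * (ip (snd ce) x * ip (snd ce) x)))) in E
      by (intros; ring).
    rewrite (lsum_ext (fins d) _ (fun i => (4 * PI * PI) * (x i * x i))) in E by (intros; ring).
    rewrite !lsum_scal in E.
    apply Rmult_eq_reg_l with (4 * PI * PI); [rewrite E; ring|]. nra.
Qed.

Definition basis {d} (i : Fin.t d) : Rd d := fun j => IZR (zunit i j).

Lemma ip_basis {d} (n : Zd d) i : ip n (basis i) = IZR (n i).
Proof.
  rewrite ip_lsum. rewrite <- (lsum_zunit i (fun j => IZR (n j))). apply lsum_ext.
  intros; unfold basis; ring.
Qed.

Lemma ip_plus {d} (n : Zd d) x y : ip n (fun i => x i + y i) = ip n x + ip n y.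
Proof. rewrite !ip_lsum, <- lsum_plus. apply lsum_ext. intros; ring. Qed.

(** Polarisation at [basis i + basis j] puts the quadratic identity into the form that can be
    contracted with [D_i D_j y]. *)
Lemma moments_coord d (g : lpoly d) s : (2 <= d)%nat -> inI d g ->
  series_to (pconv (pstar g) (green d)) s ->
  (forall i, lsum g (fun ce => IZR (fst ce) * IZR (snd ce i)) = 0) /\
  (forall i j, lsum g (fun ce => IZR (fst ce) * (IZR (snd ce i) * IZR (snd ce j))) =
     -2 * s * IZR (zunit i j)).
Proof.
  intros Hd Hg Hs. destruct (moments d g s Hd Hg Hs) as [_ [M1 M2]]. split.
  - intros i. rewrite <- (M1 (basis i)). apply lsum_ext. intros. now rewrite ip_basis.
  - intros i j. assert (Hij := M2 (fun k => basis i k + basis j k)).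
    assert (Hi := M2 (basis i)). assert (Hj := M2 (basis j)).
    rewrite (lsum_ext g _ (fun ce => IZR (fst ce) * (ip (snd ce) (basis i) * ip (snd ce) (basis i)) +
       (IZR (fst ce) * (ip (snd ce) (basis j) * ip (snd ce) (basis j)) +
       2 * (IZR (fst ce) * (IZR (snd ce i) * IZR (snd ce j)))))) in Hij.
    2: { intros ce _. rewrite ip_plus, !ip_basis. ring. }
    rewrite (lsum_ext (fins d) _ (fun k => basis i k * basis i k + (basis j k * basis j k +
       2 * (basis i k * basis j k)))) in Hij by (intros; ring).
    rewrite !lsum_plus, Hi, Hj, !lsum_scal in Hij.
    replace (lsum (fins d) (fun k => basis i k * basis j k)) with (IZR (zunit i j)) in Hij.
    + lra.
    + unfold basis. rewrite (lsum_zunit i (fun k => IZR (zunit j k))).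
      unfold zunit. destruct (Fin.eq_dec i j), (Fin.eq_dec j i); congruence.
Qed.

Lemma is_int_IZR z : is_int (IZR z).
Proof. now exists z. Qed.
Lemma is_int_plus x y : is_int x -> is_int y -> is_int (x + y).
Proof. intros [a ->] [b ->]. exists (a + b)%Z. now rewrite plus_IZR. Qed.
Lemma is_int_opp x : is_int x -> is_int (- x).
Proof. intros [a ->]. exists (- a)%Z. now rewrite opp_IZR. Qed.
Lemma is_int_minus x y : is_int x -> is_int y -> is_int (x - y).
Proof. intros. apply is_int_plus; auto using is_int_opp. Qed.
Lemma is_int_mult x y : is_int x -> is_int y -> is_int (x * y).
Proof. intros [a ->] [b ->]. exists (a * b)%Z. now rewrite mult_IZR. Qed.

(** The second moment alone shows only that [2 s] is an integer. Subtracting the vanishing first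
    moment writes [- s] as the sum of the coefficients of [g] times the integers
    [e_i (e_i - 1)/2]. *)
Lemma moment_int d (g : lpoly d) s : (2 <= d)%nat -> inI d g ->
  series_to (pconv (pstar g) (green d)) s -> is_int s.
Proof.
  intros Hd Hg Hs. destruct (moments_coord d g s Hd Hg Hs) as [M1 M2].
  assert (i : Fin.t d) by (destruct d; [lia|exact Fin.F1]).
  assert (E : s = - lsum g (fun ce => IZR (fst ce) * (IZR (snd ce i) * (IZR (snd ce i) - 1) / 2))).
  { assert (H2 := M2 i i). specialize (M1 i).
    replace (IZR (zunit i i)) with 1 in H2 by (unfold zunit; destruct Fin.eq_dec; easy).
    rewrite (lsum_ext g _ (fun ce => / 2 * (IZR (fst ce) * (IZR (snd ce i) * IZR (snd ce i)) -
       IZR (fst ce) * IZR (snd ce i)))) by (intros; field).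
    rewrite lsum_scal, lsum_minus, H2, M1. field. }
  rewrite E. apply is_int_opp, is_int_lsum. intros ce _. apply is_int_mult; [apply is_int_IZR|].
  exists ((snd ce i * (snd ce i - 1)) / 2)%Z.
  assert (Hz : (snd ce i * (snd ce i - 1) = 2 * ((snd ce i * (snd ce i - 1)) / 2))%Z).
  { apply Z_div_exact_full_2; [lia|]. rewrite Z.mul_sub_distr_l, Z.mul_1_r.
    rewrite Zmod_even, Z.even_sub, Z.even_mul. destruct (Z.even (snd ce i)); reflexivity. }
  assert (H := f_equal IZR Hz). rewrite !mult_IZR, minus_IZR in H. lra.
Qed.

(** ** Taylor expansion modulo 1 *)

Lemma dif_comm {d} (i j : Fin.t d) x : dif i (dif j x) = dif j (dif i x).
Proof. apply shift_op_comm; apply shift_op_dif. Qed.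

Lemma is_int_iff x y : is_int (x - y) -> is_int x <-> is_int y.
Proof.
  intros H. split; intros H1.
  - replace y with (x - (x - y)) by ring. now apply is_int_minus.
  - replace x with ((x - y) + y) by ring. now apply is_int_plus.
Qed.

Lemma taylor0 {d} (y : rseq d) n : (forall i n, is_int (dif i y n)) ->
  forall e, is_int (y (zadd n e) - y n).
Proof.
  intros H. apply (zd_ind (fun e => is_int (y (zadd n e) - y n))).
  - replace (zadd n zzero) with n by zd. rewrite Rminus_diag. apply is_int_IZR.
  - intros e i. symmetry. apply is_int_iff.
    replace (_ - _ - _) with (dif i y (zadd n e)); [apply H|]. unfold dif.
    replace (zadd n (zadd e (zunit i))) with (zadd (zadd n e) (zunit i)) by zd. ring.
Qed.

(** A step along [e_l] changes the remainder by the remainder of [dif l y] at one order less. The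
    quadratic case repeats this. *)
Lemma taylor1 {d} (y : rseq d) n : (forall i j n, is_int (dif i (dif j y) n)) ->
  forall e, is_int (y (zadd n e) - y n - lsum (fins d) (fun i => IZR (e i) * dif i y n)).
Proof.
  intros H. apply (zd_ind (fun e => is_int (y (zadd n e) - y n - lsum (fins d) (fun i => IZR (e i) * dif i y n)))).
  - replace (zadd n zzero) with n by zd. rewrite lsum_0.
    + replace (_ - _) with 0 by ring. apply is_int_IZR.
    + intros i _. unfold zzero. ring.
  - intros e l. symmetry. apply is_int_iff.
    replace (_ - _) with (dif l y (zadd n e) - dif l y n).
    + apply taylor0. intros i m. apply H.
    + rewrite (lsum_ext (fins d) (fun i => IZR (zadd e (zunit l) i) * dif i y n)
        (fun i => IZR (e i) * dif i y n + IZR (zunit l i) * dif i y n)).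
      2: { intros i _. unfold zadd. rewrite plus_IZR. ring. }
      rewrite lsum_plus, (lsum_zunit l (fun i => dif i y n)). unfold dif at 1.
      replace (zadd n (zadd e (zunit l))) with (zadd (zadd n e) (zunit l)) by zd. ring.
Qed.

(** Newton's forward expansion: the two halved terms combine to [e_i e_j D_i D_j y] over pairs
    [i < j] and [e_i (e_i - 1)/2 D_i D_i y] on the diagonal. Without the diagonal correction the
    remainder would not be integral. *)
Lemma taylor2 {d} (y : rseq d) n : (forall i j l n, is_int (dif i (dif j (dif l y)) n)) ->
  forall e, is_int (y (zadd n e) - y n - lsum (fins d) (fun i => IZR (e i) * dif i y n)
    - / 2 * lsum (fins d) (fun i => lsum (fins d) (fun j => IZR (e i) * IZR (e j) * dif i (dif j y) n))
    + / 2 * lsum (fins d) (fun i => IZR (e i) * dif i (dif i y) n)).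
Proof.
  intros H. apply (zd_ind (fun e => is_int (y (zadd n e) - y n - lsum (fins d) (fun i => IZR (e i) * dif i y n)
    - / 2 * lsum (fins d) (fun i => lsum (fins d) (fun j => IZR (e i) * IZR (e j) * dif i (dif j y) n))
    + / 2 * lsum (fins d) (fun i => IZR (e i) * dif i (dif i y) n)))).
  - replace (zadd n zzero) with n by zd. rewrite !lsum_0.
    + replace (_ + _) with 0 by ring. apply is_int_IZR.
    + intros i _. unfold zzero. ring.
    + intros i _. apply lsum_0. intros. unfold zzero. ring.
    + intros i _. unfold zzero. ring.
  - intros e l. symmetry. apply is_int_iff.
    assert (E1 : lsum (fins d) (fun i => IZR (zadd e (zunit l) i) * dif i y n) =
      lsum (fins d) (fun i => IZR (e i) * dif i y n) + dif l y n).
    { rewrite <- (lsum_zunit l (fun i => dif i y n)), <- lsum_plus. apply lsum_ext. intros i _.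
      unfold zadd. rewrite plus_IZR. ring. }
    assert (E2 : lsum (fins d) (fun i => IZR (zadd e (zunit l) i) * dif i (dif i y) n) =
      lsum (fins d) (fun i => IZR (e i) * dif i (dif i y) n) + dif l (dif l y) n).
    { rewrite <- (lsum_zunit l (fun i => dif i (dif i y) n)), <- lsum_plus. apply lsum_ext. intros i _.
      unfold zadd. rewrite plus_IZR. ring. }
    assert (E3 : lsum (fins d) (fun i => lsum (fins d)
        (fun j => IZR (zadd e (zunit l) i) * IZR (zadd e (zunit l) j) * dif i (dif j y) n)) =
      lsum (fins d) (fun i => lsum (fins d) (fun j => IZR (e i) * IZR (e j) * dif i (dif j y) n))
      + 2 * lsum (fins d) (fun i => IZR (e i) * dif i (dif l y) n) + dif l (dif l y) n).
    { rewrite (lsum_ext (fins d) _ (fun i => lsum (fins d) (fun j => IZR (e i) * IZR (e j) * dif i (dif j y) n)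
         + IZR (e i) * dif i (dif l y) n + IZR (zunit l i) * (lsum (fins d) (fun j => IZR (e j) * dif i (dif j y) n)
           + dif i (dif l y) n))).
      - rewrite !lsum_plus, (lsum_zunit l (fun i => lsum (fins d) (fun j => IZR (e j) * dif i (dif j y) n)
           + dif i (dif l y) n)).
        rewrite (lsum_ext (fins d) (fun j => IZR (e j) * dif l (dif j y) n) (fun j => IZR (e j) * dif j (dif l y) n)).
        + ring.
        + intros j _. now rewrite dif_comm.
      - intros i _.
        rewrite (lsum_ext (fins d) _ (fun j => IZR (e i) * IZR (e j) * dif i (dif j y) n +
           (IZR (zunit l i) * (IZR (e j) * dif i (dif j y) n) +
           (IZR (zunit l j) * ((IZR (e i) + IZR (zunit l i)) * dif i (dif j y) n))))).
        + rewrite !lsum_plus, lsum_scal, (lsum_zunit l (fun j => (IZR (e i) + IZR (zunit l i)) * dif i (dif j y) n)).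
          ring.
        + intros j _. unfold zadd. rewrite !plus_IZR. ring. }
    replace (_ - _) with (dif l y (zadd n e) - dif l y n - lsum (fins d) (fun i => IZR (e i) * dif i (dif l y) n)).
    + apply taylor1. intros i j m. apply H.
    + rewrite E1, E2, E3. unfold dif at 1.
      replace (zadd n (zadd e (zunit l))) with (zadd (zadd n e) (zunit l)) by zd. field.
Qed.

Definition third_int {d} (y : rseq d) : Prop := forall i j l n, is_int (dif i (dif j (dif l y)) n).

Lemma lap_D2 {d} (y : rseq d) n :
  pconv (fpoly d) y n = - lsum (fins d) (fun i => dif i (dif i y) (zsub n (zunit i))).
Proof.
  rewrite pconv_fpoly.
  replace (2 * INR d * y n) with (INR d * (2 * y n)) by ring.
  rewrite <- lsum_fins_const, <- lsum_minus.
  replace (- lsum (fins d) (fun i => dif i (dif i y) (zsub n (zunit i)))) with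
    (-1 * lsum (fins d) (fun i => dif i (dif i y) (zsub n (zunit i)))) by ring.
  rewrite <- lsum_scal. apply lsum_ext. intros i _. unfold dif.
  replace (zadd (zsub n (zunit i)) (zunit i)) with n by zd. ring.
Qed.

(** Summed against [g], the terms constant or linear in [e] vanish, the diagonal correction
    included, and so do the mixed quadratic ones. There remains [- s] times the sum of [D_i D_i y]
    at [n]. The Laplacian has these second differences at [n - e_i]; the discrepancy is the integer
    [s] times a sum of third differences. *)
Lemma palpha_mod_lap d (g : lpoly d) s (y : rseq d) n : (2 <= d)%nat -> inI d g ->
  series_to (pconv (pstar g) (green d)) s -> third_int y ->
  is_int (palpha g y n - s * pconv (fpoly d) y n).
Proof.
  intros Hd Hg Hs Hy. destruct (moments d g s Hd Hg Hs) as [M0 _].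
  destruct (moments_coord d g s Hd Hg Hs) as [M1 M2].
  assert (Hsi := moment_int d g s Hd Hg Hs).
  set (T := fun e => y (zadd n e) - y n - lsum (fins d) (fun i => IZR (e i) * dif i y n)
    - / 2 * lsum (fins d) (fun i => lsum (fins d) (fun j => IZR (e i) * IZR (e j) * dif i (dif j y) n))
    + / 2 * lsum (fins d) (fun i => IZR (e i) * dif i (dif i y) n)).
  assert (HT : forall e, is_int (T e)) by (intros e; now apply taylor2).
  assert (S1 : forall u : Fin.t d -> R,
     lsum g (fun ce => IZR (fst ce) * lsum (fins d) (fun i => IZR (snd ce i) * u i)) = 0).
  { intros u. rewrite (lsum_ext g _ (fun ce => lsum (fins d) (fun i => u i * (IZR (fst ce) * IZR (snd ce i))))).
    - rewrite lsum_exchange. apply lsum_0. intros i _. rewrite lsum_scal, M1. ring.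
    - intros ce _. rewrite <- lsum_scal. apply lsum_ext. intros; ring. }
  assert (S2 : lsum g (fun ce => IZR (fst ce) *
      lsum (fins d) (fun i => lsum (fins d) (fun j => IZR (snd ce i) * IZR (snd ce j) * dif i (dif j y) n)))
      = -2 * s * lsum (fins d) (fun i => dif i (dif i y) n)).
  { rewrite (lsum_ext g _ (fun ce => lsum (fins d) (fun i => lsum (fins d) (fun j =>
        dif i (dif j y) n * (IZR (fst ce) * (IZR (snd ce i) * IZR (snd ce j))))))).
    - rewrite lsum_exchange, <- lsum_scal. apply lsum_ext. intros i _.
      rewrite lsum_exchange. rewrite <- (lsum_zunit i (fun j => dif i (dif j y) n)), <- lsum_scal.
      apply lsum_ext. intros j _. rewrite lsum_scal, M2. ring.
    - intros ce _. rewrite <- lsum_scal. apply lsum_ext. intros i _.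
      rewrite <- lsum_scal. apply lsum_ext. intros; ring. }
  assert (E : palpha g y n = lsum g (fun ce => IZR (fst ce) * T (snd ce))
      - s * lsum (fins d) (fun i => dif i (dif i y) n)).
  { assert (E0 : palpha g y n = lsum g (fun ce => IZR (fst ce) * T (snd ce)) + y n * lsum g (fun ce => IZR (fst ce))
      + lsum g (fun ce => IZR (fst ce) * lsum (fins d) (fun i => IZR (snd ce i) * dif i y n))
      + / 2 * lsum g (fun ce => IZR (fst ce) *
         lsum (fins d) (fun i => lsum (fins d) (fun j => IZR (snd ce i) * IZR (snd ce j) * dif i (dif j y) n)))
      + - / 2 * lsum g (fun ce => IZR (fst ce) * lsum (fins d) (fun i => IZR (snd ce i) * dif i (dif i y) n))).
    { rewrite <- !lsum_scal, <- !lsum_plus, palpha_lsum. apply lsum_ext. intros ce _. unfold T.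
      replace (zadd (snd ce) n) with (zadd n (snd ce)) by zd. ring. }
    rewrite E0, M0, (S1 (fun i => dif i y n)), (S1 (fun i => dif i (dif i y) n)), S2. field. }
  rewrite E, lap_D2.
  replace (_ - _) with (lsum g (fun ce => IZR (fst ce) * T (snd ce)) -
    s * lsum (fins d) (fun i => dif i (dif i (dif i y)) (zsub n (zunit i)))).
  - apply is_int_minus.
    + apply is_int_lsum. intros ce _. apply is_int_mult; auto using is_int_IZR.
    + apply is_int_mult; auto. apply is_int_lsum. intros i _. apply Hy.
  - rewrite (lsum_ext (fins d) (fun i => dif i (dif i (dif i y)) (zsub n (zunit i)))
      (fun i => dif i (dif i y) n - dif i (dif i y) (zsub n (zunit i)))).
    + rewrite lsum_minus. ring.
    + intros i _. unfold dif at 1. replace (zadd (zsub n (zunit i)) (zunit i)) with n by zd. ring.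
Qed.

(** ** The ideal of third powers *)

Lemma palpha_pmul {d} (p q : lpoly d) x : palpha (pmul p q) x = palpha p (palpha q x).
Proof.
  fe. unfold pmul. rewrite !palpha_lsum, lsum_flat_map. apply lsum_ext. intros a _.
  rewrite lsum_map, palpha_lsum, <- lsum_scal. apply lsum_ext. intros b _. simpl.
  rewrite mult_IZR. replace (zadd (zadd (snd a) (snd b)) n) with (zadd (snd b) (zadd (snd a) n)) by zd.
  ring.
Qed.

(** [dpoly] is the difference operator for [pconv], [apoly] the one for [palpha]. *)
Definition apoly {d} (i : Fin.t d) : lpoly d := [(1, zunit i); (-1, zzero)]%Z.

Lemma palpha_apoly {d} (i : Fin.t d) x : palpha (apoly i) x = dif i x.
Proof.
  fe. unfold apoly, dif. rewrite palpha_lsum. simpl.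
  replace (zadd (zunit i) n) with (zadd n (zunit i)) by zd.
  replace (zadd zzero n) with n by zd. ring.
Qed.

Lemma peval1_lsum {d} (p : lpoly d) : IZR (peval1 p) = lsum p (fun ce => IZR (fst ce)).
Proof. induction p; simpl; auto. now rewrite plus_IZR, IHp. Qed.

Lemma palpha_Iscr_int {d} (p : lpoly d) x : Iscr d p -> (forall i n, is_int (dif i x n)) ->
  forall n, is_int (palpha p x n).
Proof.
  intros Hp H n.
  replace (palpha p x n) with (lsum p (fun ce => IZR (fst ce) * (x (zadd n (snd ce)) - x n))).
  - apply is_int_lsum. intros ce _. apply is_int_mult; [apply is_int_IZR|now apply taylor0].
  - rewrite (lsum_ext p _ (fun ce => IZR (fst ce) * x (zadd (snd ce) n) - x n * IZR (fst ce))).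
    + rewrite lsum_minus, lsum_scal, <- peval1_lsum, Hp. rewrite palpha_lsum. simpl. ring.
    + intros ce _. replace (zadd n (snd ce)) with (zadd (snd ce) n) by zd. ring.
Qed.

(** One direction evaluates on products of the elements [u_i - 1]. The other peels off three factors
    in turn: a factor whose coefficients sum to 0 maps a sequence with integral differences to an
    integral one. *)
Lemma inX_third_int d (y : rseq d) : inX d (Iscr3 d) y <-> third_int y.
Proof.
  split.
  - intros H i j l n.
    rewrite <- !palpha_apoly, <- (palpha_pmul (apoly j)), <- palpha_pmul. apply H.
    exists [(apoly i, apoly j, apoly l)]. split.
    + repeat constructor.
    + cbn [flat_map fst snd]. now rewrite app_nil_r.
  - intros H g [L [HL Hg]] n. rewrite (palpha_lcoef _ _ _ _ Hg). clear g Hg.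
    assert (HD : forall (i : Fin.t d) p x, dif i (palpha p x) = palpha p (dif i x))
      by (intros; apply shift_op_comm; auto using shift_op_dif, shift_op_palpha).
    rewrite palpha_lsum, lsum_flat_map. apply is_int_lsum. intros [[a b] c] Hin.
    rewrite Forall_forall in HL. destruct (HL _ Hin) as [Ha [Hb Hc]]. simpl in *.
    rewrite <- (palpha_lsum (pmul a (pmul b c)) y n), !palpha_pmul.
    apply palpha_Iscr_int; auto. intros i m. rewrite !HD.
    apply palpha_Iscr_int; auto. intros j m'. rewrite !HD.
    apply palpha_Iscr_int; [exact Hc|]. intros l m''. apply H.
Qed.

(** * The constant [c(y)] and membership in [K_d] *)

Lemma linf_shift_op {d} (T : rseq d -> rseq d) x : shift_op T -> linf x -> linf (T x).
Proof.
  intros [p Hp] [B HB]. exists (lsum p (fun ce => Rabs (fst ce) * B)). intros n. rewrite Hp.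
  eapply Rle_trans; [apply lsum_abs|]. apply lsum_le. intros ce _. rewrite Rabs_mult.
  apply Rmult_le_compat_l; auto using Rabs_pos.
Qed.

Lemma linf_plus_const {d} (x : rseq d) c : linf x -> linf (fun n => x n + c).
Proof.
  intros [B HB]. exists (B + Rabs c). intros n. eapply Rle_trans; [apply Rabs_triang|].
  generalize (HB n); lra.
Qed.

(** The differences of [f.y] are sums of third differences of [y], up to sign. So [f.y] is constant
    modulo 1, and [c] is the fractional part of minus its value at the origin. *)
Lemma exists_unique_c d (y : rseq d) : linf y -> third_int y ->
  exists! c, 0 <= c < 1 /\ linfZ (fun n => pconv (fpoly d) y n + c).
Proof.
  intros Hy H3.
  assert (HD : forall n, is_int (pconv (fpoly d) y n - pconv (fpoly d) y zzero)).
  { intros n. replace n with (zadd zzero n) by zd. apply taylor0. intros l m.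
    rewrite (shift_op_comm (dif l) (pconv (fpoly d))) by (apply shift_op_dif || apply shift_op_pconv).
    rewrite lap_D2. apply is_int_opp, is_int_lsum. intros i _. apply H3. }
  set (r := - pconv (fpoly d) y zzero).
  assert (Hr : r = IZR (Int_part r) + frac_part r) by (unfold frac_part; ring).
  destruct (base_fp r) as [F0 F1].
  exists (frac_part r). split.
  - split; [lra|]. split.
    + apply linf_plus_const, linf_shift_op; auto using shift_op_pconv.
    + intros n. replace (pconv (fpoly d) y n + frac_part r) with
       ((pconv (fpoly d) y n - pconv (fpoly d) y zzero) - IZR (Int_part r)) by (unfold r in *; lra).
      apply is_int_minus; auto using is_int_IZR.
  - intros c [Hc [_ Hi]]. specialize (Hi zzero). destruct Hi as [z Hz].
    assert (E : c - frac_part r = IZR (z + Int_part r)) by (rewrite plus_IZR; unfold r in *; lra).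
    assert (Z0 : (z + Int_part r = 0)%Z).
    { assert (-1 < IZR (z + Int_part r) < 1) by lra. destruct H as [A B].
      apply lt_IZR in A, B. lia. }
    rewrite Z0 in E. lra.
Qed.

(** With [s] the sum of [g^*.w], the pairing equals [g(alpha) y + (c + m) s], that is
    [(g(alpha) y - s f.y) + s (f.y + c) + s m]. The first term is integral by the Taylor expansion,
    the other two because [s] is an integer. *)
Lemma lap_shift_inK d (y : rseq d) c m : (2 <= d)%nat -> linf y -> third_int y ->
  linfZ (fun n => pconv (fpoly d) y n + c) ->
  inK d (fun n => pconv (fpoly d) y n + c + IZR m).
Proof.
  intros Hd Hy H3 [Hb Hi]. split; [split|].
  - now apply linf_plus_const.
  - intros n. apply is_int_plus; auto using is_int_IZR.
  - intros g Hg n. destruct (l1_series _ (star_green_l1 d g Hg)) as [s Hs].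
    exists (palpha g y n + (c + IZR m) * s). split.
    + eapply series_ext; [|apply (series_plus _ _ _ _ (pairing d g y n Hd Hg Hy)
         (series_scal _ (c + IZR m) _ Hs))]. intros k. cbv beta. ring.
    + replace (_ + _) with ((palpha g y n - s * pconv (fpoly d) y n)
         + s * (pconv (fpoly d) y n + c) + s * IZR m) by ring.
      assert (Hsi := moment_int d g s Hd Hg Hs).
      apply is_int_plus; [apply is_int_plus|]; [now apply palpha_mod_lap| |];
        apply is_int_mult; auto using is_int_IZR.
Qed.

(** ** The Poisson equation for periodic sequences *)

Lemma walk_const {d} c : walk (fun _ : Zd d => c) = fun _ => c.
Proof. fe. unfold walk. rewrite pconv_fpoly, lsum_fins_const. ring. Qed.

Lemma walkn_const {d} k c : walkn k (fun _ : Zd d => c) = fun _ => c.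
Proof.
  induction k; simpl; auto. unfold walkn in *. simpl. now rewrite IHk, walk_const.
Qed.

Lemma walkn_minus_const {d} k (x : rseq d) c n : walkn k (fun m => x m - c) n = walkn k x n - c.
Proof. rewrite shift_op_minus by apply shift_op_walkn. now rewrite walkn_const. Qed.

(** A lattice path from [n] to [n + r] costs one gradient bound per edge, so [C] depends on [r]
    only. *)
Lemma path_bound {d} (r : Zd d) : exists C, 0 <= C /\ forall k x B, sup_le x B ->
  forall n, Rabs (walkn k x (zadd n r) - walkn k x n) <= C * / sqrt (INR (S k)) * B.
Proof.
  apply (zd_ind (fun r => exists C, 0 <= C /\ forall k x B, sup_le x B ->
    forall n, Rabs (walkn k x (zadd n r) - walkn k x n) <= C * / sqrt (INR (S k)) * B)).
  - exists 0. split; [lra|]. intros k x B _ n. replace (zadd n zzero) with n by zd.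
    rewrite Rminus_diag, Rabs_R0. lra.
  - assert (Hstep : forall (i : Fin.t d) k x B n, sup_le x B ->
      Rabs (walkn k x (zadd n (zunit i)) - walkn k x n) <= 4 * INR d * / sqrt (INR (S k)) * B).
    { intros i k x B n Hx. exact (gradient_bound i k x B Hx n). }
    intros m i. assert (Hd := fin_INR i).
    split; intros [C [HC H]]; exists (C + 4 * INR d); (split; [lra|]); intros k x B Hx n.
    + replace (zadd n (zadd m (zunit i))) with (zadd (zadd n m) (zunit i)) by zd.
      replace (_ - _) with ((walkn k x (zadd (zadd n m) (zunit i)) - walkn k x (zadd n m))
        + (walkn k x (zadd n m) - walkn k x n)) by ring.
      eapply Rle_trans; [apply Rabs_triang|].
      generalize (Hstep i k x B (zadd n m) Hx) (H k x B Hx n). lra.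
    + replace (_ - _) with ((walkn k x (zadd n (zadd m (zunit i))) - walkn k x n)
        - (walkn k x (zadd (zadd n m) (zunit i)) - walkn k x (zadd n m))).
      2: { replace (zadd n (zadd m (zunit i))) with (zadd (zadd n m) (zunit i)) by zd. ring. }
      eapply Rle_trans; [apply Rabs_triang|]. rewrite Rabs_Ropp.
      generalize (Hstep i k x B (zadd n m) Hx) (H k x B Hx n). lra.
Qed.

Definition osc {d} (x : rseq d) B := forall n m, Rabs (x n - x m) <= B.

(** By periodicity any two values differ as along a displacement in the finite list [L], so one
    constant [C] serves for all, and [k] makes [C / sqrt (k + 1)] less than [1/2]. As the walk fixes
    constants, subtracting [x zzero] turns the oscillation into a sup-norm bound. *)
Lemma osc_half d (G : Zd d -> Prop) : subgroup_fi d G -> exists k, forall x B,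
  invariant G x -> osc x B -> osc (walkn k x) (/ 2 * B).
Proof.
  intros [_ [_ [_ [L HL]]]].
  assert (HC : exists C, 0 <= C /\ forall r, In r L -> forall k x B, sup_le x B ->
    forall n, Rabs (walkn k x (zadd n r) - walkn k x n) <= C * / sqrt (INR (S k)) * B).
  { clear HL. induction L as [|r L [C [HC IH]]].
    - exists 0. split; [lra|]. intros r [].
    - destruct (path_bound r) as [C' [HC' H']]. exists (C + C'). split; [lra|].
      intros r' Hr k x B Hx n.
      assert (HB0 : 0 <= B) by (eapply Rle_trans; [apply Rabs_pos|apply (Hx zzero)]).
      assert (Hs := inv_sqrt_pos k). set (w := / sqrt _) in *.
      assert (0 <= C * w * B) by (repeat apply Rmult_le_pos; lra).
      assert (0 <= C' * w * B) by (repeat apply Rmult_le_pos; lra).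
      destruct Hr as [<-|Hr]; [generalize (H' k x B Hx n)|generalize (IH r' Hr k x B Hx n)];
        fold w; lra. }
  destruct HC as [C [HC H]].
  assert (Hz := Un_cv_scal C _ _ sqrt_S_inv_cv). rewrite Rmult_0_r in Hz.
  destruct (Hz (/ 2)) as [k Hk]; [lra|]. exists k. specialize (Hk k (le_n _)).
  unfold Rdist in Hk. rewrite Rminus_0_r in Hk.
  apply Rle_lt_trans with (r1 := C * / sqrt (INR (S k))) in Hk; [|apply Rle_abs].
  intros x B Hx Ho n m.
  assert (Hsb : sup_le (fun p => x p - x zzero) B) by (intros p; apply Ho).
  assert (HB0 : 0 <= B) by (eapply Rle_trans; [apply Rabs_pos|apply (Ho zzero zzero)]).
  destruct (HL (zsub n m)) as [r [g [Hr [Hg E]]]].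
  assert (En : walkn k x n = walkn k x (zadd m r)).
  { replace n with (zadd (zadd m r) g).
    - apply (shift_op_invariant G (walkn k) x (shift_op_walkn k) Hx g (zadd m r) Hg).
    - apply functional_extensionality; intros i. apply (f_equal (fun v => v i)) in E.
      unfold zadd, zsub in *. lia. }
  assert (Hm := H r Hr k _ B Hsb m). rewrite !walkn_minus_const in Hm.
  rewrite En. replace (walkn k x (zadd m r) - walkn k x m) with
    (walkn k x (zadd m r) - x zzero - (walkn k x m - x zzero)) by ring.
  eapply Rle_trans; [apply Hm|]. apply Rmult_le_compat_r; lra.
Qed.

Fixpoint wsum {d} k (x : rseq d) : rseq d :=
  match k with
  | O => fun _ => 0
  | S k' => fun n => wsum k' x n + walkn k' x n
  end.

Lemma shift_op_wsum {d} k : shift_op (@wsum d k).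
Proof.
  induction k; simpl; [apply shift_op_zero|]. apply (shift_op_add (wsum k) (walkn k)); auto using shift_op_walkn.
Qed.

Lemma lap_wsum d k (x : rseq d) n : (0 < d)%nat ->
  pconv (fpoly d) (wsum k x) n = 4 * INR d * (x n - walkn k x n).
Proof.
  intros Hd. assert (Hd' : 0 < INR d) by now apply lt_0_INR.
  induction k.
  - simpl wsum. rewrite pconv_fpoly, lsum_fins_const. unfold walkn. simpl. ring.
  - simpl wsum. rewrite (shift_op_plus (pconv (fpoly d))) by apply shift_op_pconv. rewrite IHk.
    change (walkn (S k) x n) with (walk (walkn k x) n). unfold walk. field. lra.
Qed.

(** [X p], obtained after [p] blocks of [k] steps, has oscillation at most [B / 2^p] but need not
    tend to 0. Recentring at the origin makes the Neumann series for [1 - Q^k] converge to [y0], and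
    the constants so removed are annihilated by [1 - Q^k]. Since
    [f (1 + Q + ... + Q^(k-1)) = 4d (1 - Q^k)], [wsum] converts [y0] into a solution for [f]. *)
Lemma periodic_poisson d (G : Zd d -> Prop) (v : rseq d) : (0 < d)%nat -> subgroup_fi d G ->
  linf v -> invariant G v ->
  exists y a, linf y /\ invariant G y /\ forall n, v n = pconv (fpoly d) y n + a.
Proof.
  intros Hd HG [B0 HB0] Hv. assert (Hd' : 0 < INR d) by now apply lt_0_INR.
  destruct (osc_half d G HG) as [k Hk].
  set (X := fun p => Nat.iter p (walkn k) v).
  set (B := 2 * B0).
  assert (HXi : forall p, invariant G (X p)).
  { induction p; simpl; auto. apply shift_op_invariant; auto using shift_op_walkn. }
  assert (HXo : forall p, osc (X p) (B * / 2 ^ p)).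
  { induction p.
    - intros n m. simpl. unfold B, Rminus. eapply Rle_trans; [apply Rabs_triang|].
      rewrite Rabs_Ropp. generalize (HB0 n) (HB0 m). lra.
    - replace (B * / 2 ^ S p) with (/ 2 * (B * / 2 ^ p)).
      + apply (Hk (X p)); auto.
      + simpl. field. apply pow_nonzero; lra. }
  assert (HB : 0 <= B).
  { unfold B. generalize (HB0 zzero) (Rabs_pos (v zzero)). lra. }
  set (u := fix u (P : nat) : rseq d := match P with
     | O => fun _ => 0 | S p => fun n => u p n + (X p n - X p zzero) end).
  (* A telescoping majorant of the geometric series: its increment at [p] is [B / 2^p]. *)
  set (gd := fun p => - (2 * B * / 2 ^ p)).
  assert (Hp2 : forall p, 0 < / 2 ^ p) by (intros; apply Rinv_0_lt_compat, pow_lt; lra).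
  assert (Hu : forall n, exists l, Un_cv (fun P => u P n) l /\ Rabs (l - u 0%nat n) <= 0 - gd 0%nat).
  { intros n. apply (dominated_cv (fun P => u P n) gd 0).
    - intros p. simpl u. replace (u p n + (X p n - X p zzero) - u p n) with (X p n - X p zzero) by ring.
      eapply Rle_trans; [apply HXo|]. unfold gd. right. simpl. field. apply pow_nonzero; lra.
    - intros p. unfold gd. assert (0 <= 2 * B * / 2 ^ p); [|lra].
      apply Rmult_le_pos; [lra|left; apply Hp2]. }
  destruct (choice _ Hu) as [y0 Hy0].
  assert (Hy0i : invariant G y0).
  { intros g n Hg. eapply UL_sequence; [apply (proj1 (Hy0 (zadd n g)))|].
    eapply Un_cv_ext; [|apply (proj1 (Hy0 n))]. intros P. induction P; simpl u; auto.
    now rewrite IHP, (HXi P g n Hg). }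
  assert (Hy0b : linf y0).
  { exists (2 * B). intros n. destruct (Hy0 n) as [_ Hb]. simpl u in Hb. unfold gd in Hb.
    simpl in Hb. rewrite Rminus_0_r in Hb. lra. }
  set (y := fun n => / (4 * INR d) * wsum k y0 n).
  assert (Hly : forall n, pconv (fpoly d) y n = y0 n - walkn k y0 n).
  { intros n. unfold y. rewrite (shift_op_scal (pconv (fpoly d))) by apply shift_op_pconv.
    rewrite lap_wsum by auto. field. lra. }
  assert (Hul : forall P n, u P n - walkn k (u P) n = v n - X P n).
  { induction P; intros n; simpl u.
    - rewrite walkn_const. change (X 0%nat n) with (v n). ring.
    - rewrite (shift_op_plus (walkn k)) by apply shift_op_walkn. rewrite walkn_minus_const.
      change (X (S P) n) with (walkn k (X P) n). specialize (IHP n). lra. }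
  assert (Hlim : forall n, Un_cv (fun P => v n - X P n) (pconv (fpoly d) y n)).
  { intros n. rewrite Hly. eapply Un_cv_ext; [intros P; apply Hul|].
    apply CV_minus; [apply Hy0|]. apply shift_op_lim; [apply shift_op_walkn|]. intros m; apply Hy0. }
  assert (Hosc0 : Un_cv (fun p => B * / 2 ^ p) 0).
  { replace 0 with (B * 0) by ring. apply Un_cv_scal. apply cv_infty_cv_0.
    intros M. destruct (Pow_x_infinity 2) with (b := M + 1) as [N HN].
    - rewrite Rabs_pos_eq; lra.
    - exists N. intros n Hn. specialize (HN n Hn). rewrite Rabs_pos_eq in HN; [lra|].
      apply pow_le; lra. }
  exists y, (v zzero - pconv (fpoly d) y zzero). repeat split.
  - apply (linf_shift_op (fun x n => / (4 * INR d) * wsum k x n)); auto.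
    apply (shift_op_cmul _ (wsum k)), shift_op_wsum.
  - apply (shift_op_invariant G (fun x n => / (4 * INR d) * wsum k x n)); auto.
    apply (shift_op_cmul _ (wsum k)), shift_op_wsum.
  - intros n.
    (* The left side is the limit of [X P n - X P zzero], which the decay of the oscillation forces
       to be 0. *)
    assert (E : (v n - pconv (fpoly d) y n) - (v zzero - pconv (fpoly d) y zzero) = 0); [|lra].
    apply (UL_sequence (fun P => X P n - X P zzero)).
    + eapply Un_cv_ext; [|apply (CV_minus _ _ _ _
        (CV_minus _ _ _ _ (Un_cv_const (v n)) (Hlim n))
        (CV_minus _ _ _ _ (Un_cv_const (v zzero)) (Hlim zzero)))].
      intros P. simpl. ring.
    + intros eps He. destruct (Hosc0 eps He) as [N HN]. exists N. intros P HP.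
      specialize (HN P HP). unfold Rdist in *. rewrite Rminus_0_r in *.
      eapply Rle_lt_trans; [apply HXo|]. eapply Rle_lt_trans; [apply Rle_abs|apply HN].
Qed.

(** * From [K_d] to integral third differences *)

Lemma palpha_dpoly {d} (i : Fin.t d) x n : palpha (dpoly i) x n = - dif i x (zsub n (zunit i)).
Proof.
  unfold dpoly, dif. rewrite palpha_lsum. simpl.
  replace (zadd (zopp (zunit i)) n) with (zsub n (zunit i)) by zd.
  replace (zadd zzero n) with n by zd.
  replace (zadd (zsub n (zunit i)) (zunit i)) with n by zd. ring.
Qed.

(** Under [palpha] each factor acts as a reflected difference, which costs a sign and a backward
    shift. *)
Lemma palpha_dpoly3 {d} (i j l : Fin.t d) x n :
  palpha (pmul (dpoly i) (pmul (dpoly j) (dpoly l))) x n =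
  - dif i (dif j (dif l x)) (zsub (zsub (zsub n (zunit i)) (zunit j)) (zunit l)).
Proof.
  rewrite !palpha_pmul, palpha_dpoly.
  rewrite (shift_op_comm (dif i) (palpha (dpoly j))), (shift_op_comm (dif i) (palpha (dpoly l)))
    by (apply shift_op_dif || apply shift_op_palpha).
  rewrite palpha_dpoly.
  rewrite (shift_op_comm (dif j) (palpha (dpoly l))) by (apply shift_op_dif || apply shift_op_palpha).
  rewrite palpha_dpoly, (dif_comm j i x), (dif_comm l i), (dif_comm l j x). ring.
Qed.

(** Testing on a product of three differences: its [s] is 0, so the constant [a], an arbitrary real
    number, drops out. The pairing is then a third difference of [y] up to sign. *)
Lemma inK_third_int d (y : rseq d) a : (2 <= d)%nat -> linf y ->
  inK d (fun n => pconv (fpoly d) y n + a) -> third_int y.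
Proof.
  intros Hd Hy [_ HK] i j l n.
  set (g := pmul (dpoly i) (pmul (dpoly j) (dpoly l))).
  assert (Hg : inI d g) by now apply third_difference_inI.
  destruct (l1_series _ (star_green_l1 d g Hg)) as [s Hs].
  (* The second moment [-2 s] is, up to sign, a third difference of a quadratic polynomial, hence
     0. *)
  assert (S0 : s = 0).
  { destruct (moments d g s Hd Hg Hs) as [_ [_ M2]]. specialize (M2 (basis i)).
    replace (lsum (fins d) (fun j => basis i j * basis i j)) with 1 in M2.
    - assert (E : lsum g (fun ce => IZR (fst ce) * (ip (snd ce) (basis i) * ip (snd ce) (basis i))) =
        palpha g (fun m => ip m (basis i) * ip m (basis i)) zzero).
      { rewrite palpha_lsum. apply lsum_ext. intros ce _.
        replace (zadd (snd ce) zzero) with (snd ce) by zd. reflexivity. }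
      rewrite E in M2. unfold g in M2. rewrite palpha_dpoly3 in M2. unfold dif in M2.
      rewrite !ip_zadd in M2. ring_simplify in M2. lra.
    - unfold basis. rewrite (lsum_zunit i (fun j => IZR (zunit i j))).
      unfold zunit. destruct Fin.eq_dec; easy. }
  (* The base point compensates for the three backward shifts. *)
  set (m := zadd (zadd (zadd n (zunit i)) (zunit j)) (zunit l)).
  destruct (HK g Hg m) as [t [Ht Hi]].
  assert (E : t = palpha g y m).
  { eapply series_unique; [apply Ht|].
    replace (palpha g y m) with (palpha g y m + a * s) by (rewrite S0; ring).
    eapply series_ext; [|apply (series_plus _ _ _ _ (pairing d g y m Hd Hg Hy) (series_scal _ a _ Hs))].
    intros k. cbv beta. ring. }
  rewrite E in Hi. unfold g in Hi. rewrite palpha_dpoly3 in Hi. apply is_int_opp in Hi.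
  rewrite Ropp_involutive in Hi.
  replace (zsub (zsub (zsub m (zunit i)) (zunit j)) (zunit l)) with n in Hi; auto.
  unfold m. zd.
Qed.

Theorem theorem3p11 (d : nat) (hd : (2 <= d)%nat) :
  (forall y : rseq d, linf y -> inX d (Iscr3 d) y ->
     (exists! c : R, 0 <= c < 1 /\ linfZ (fun n => pconv (fpoly d) y n + c)) /\
     (forall c : R, 0 <= c < 1 -> linfZ (fun n => pconv (fpoly d) y n + c) ->
        forall m : Z, inK d (fun n => pconv (fpoly d) y n + c + IZR m)))
  /\
  (forall Gamma : Zd d -> Prop, subgroup_fi d Gamma ->
     forall v : rseq d, linfZ v -> invariant Gamma v ->
       (inK d v <->
        exists (y : rseq d) (c : R) (m : Z),
          linf y /\ invariant Gamma y /\ inX d (Iscr3 d) y /\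
          0 <= c < 1 /\ linfZ (fun n => pconv (fpoly d) y n + c) /\
          forall n, v n = pconv (fpoly d) y n + c + IZR m)).
Proof.
  split.
  - intros y Hy HX. apply inX_third_int in HX. split.
    + now apply exists_unique_c.
    + intros c _ Hc m. now apply lap_shift_inK.
  - intros G HG v [Hvb Hvi] Hv. split.
    + intros HK.
      destruct (periodic_poisson d G v) as [y [a [Hy [Hyi E]]]]; auto; [lia|].
      (* The real constant left by the Poisson equation provides both data: its fractional part is
         [c], its integer part [m]. *)
      destruct (base_fp a) as [F0 F1].
      assert (Ea : a = IZR (Int_part a) + frac_part a) by (unfold frac_part; ring).
      exists y, (frac_part a), (Int_part a).
      split; [easy|]. split; [easy|]. split; [|split; [lra|split; [split|]]].
      * apply inX_third_int, (inK_third_int d y a); auto.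
        replace (fun n => pconv (fpoly d) y n + a) with v; auto.
        apply functional_extensionality, E.
      * apply linf_plus_const, linf_shift_op; auto using shift_op_pconv.
      * intros n. replace (pconv (fpoly d) y n + frac_part a) with (v n - IZR (Int_part a))
          by (rewrite E; lra).
        apply is_int_minus; auto using is_int_IZR.
      * intros n. rewrite E. lra.
    + intros [y [c [m [Hy [_ [HX [_ [Hc E]]]]]]]]. apply inX_third_int in HX.
      replace v with (fun n => pconv (fpoly d) y n + c + IZR m).
      * now apply lap_shift_inK.
      * symmetry. apply functional_extensionality, E.
Qed.
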